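(* Let $(f_1,\ldots,f_N;p_1,\ldots,p_N)$ be an admissible iterated function system, let $\mu_*$ be its unique invariant measure in $\mathcal M_1((0,1))$, and let $(X_n)_{n\ge0}$ be the corresponding stationary Markov chain with initial distribution $\mu_*$. Let $\varphi:[0,1]\to\mathbb R$ be a Lipschitz function with $\int_{[0,1]}\varphi\,\mathrm d\mu_*=0$. Then the limit $$\sigma^2:=\lim_{n\to\infty}\mathbb E\left(\frac{\varphi(X_0)+\cdots+\varphi(X_n)}{\sqrt n}\right)^2$$ exists (as a finite number in $[0,\infty)$) and $$\frac{\varphi(X_0)+\cdots+\varphi(X_n)}{\sqrt n}\Rightarrow\mathcal N(0,\sigma)\qquad\text{as }n\to\infty.$$ Moreover, the same is true for the chain started at an arbitrary point: for every $x\in(0,1)$, if $(X_n^x)_{n\ge0}$ denotes the corresponding Markov chain with $X_0^x=x$, then $$\lim_{n\to\infty}\mathbb E\left(\frac{\varphi(X_0^x)+\cdots+\varphi(X_n^x)}{\sqrt n}\right)^2=\sigma^2\quad\text{and}\quad\frac{\varphi(X_0^x)+\cdots+\varphi(X_n^x)}{\sqrt n}\Rightarrow\mathcal N(0,\sigma)\qquad\text{as }n\to\infty.$$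
   Context: $H^+$ denotes the set of increasing homeomorphisms $f:[0,1]\to[0,1]$ that are $C^1$ in a neighbourhood (in $[0,1]$) of $0$ and of $1$. Let $f_1,\ldots,f_N\in H^+$ be finitely many homeomorphisms and let $(p_1,\ldots,p_N)$ satisfy $p_i>0$ for all $i$ and $\sum_{i=1}^N p_i=1$. The family $(f_1,\ldots,f_N;p_1,\ldots,p_N)$ is called an admissible iterated function system if: (1) for every $x\in(0,1)$ there are $i,j\in\{1,\ldots,N\}$ with $f_i(x)<x<f_j(x)$; (2) $f_i'(0)>0$ and $f_i'(1)>0$ for all $i$, and $\sum_{i=1}^N p_i\log f_i'(0)>0$ and $\sum_{i=1}^N p_i\log f_i'(1)>0$. The corresponding Markov operator $P$ acts on finite Borel measures on $[0,1]$ by $P\mu(A)=\sum_{i=1}^N p_i\,\mu(f_i^{-1}(A))$ for Borel $A\subseteq[0,1]$. $\mathcal M_1((0,1))$ is the set of Borel probability measures on $(0,1)$, identified with the Borel probability measures $\mu$ on $[0,1]$ satisfying $\mu(\{0,1\})=0$. For an admissible iterated function system, $P$ has exactly one invariant measure ($P\mu=\mu$) in $\mathcal M_1((0,1))$; it is denoted $\mu_*$. The corresponding Markov chain with initial distribution $\nu$ is the time-homogeneous Markov chain on $[0,1]$ with $X_0$ distributed according to $\nu$ and transition probability $\pi(x,A)=P\delta_x(A)=\sum_{i=1}^N p_i\mathbf 1_A(f_i(x))$; equivalently, $X_{n+1}=f_{\omega_{n+1}}(X_n)$ where $\omega_1,\omega_2,\ldots$ are i.i.d. with $\mathrm{Prob}(\omega_n=i)=p_i$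 and independent of $X_0$. $\Rightarrow$ denotes convergence in distribution. $\mathcal N(0,\sigma)$ with $\sigma\ge0$ is the centred normal law with variance $\sigma^2$, i.e. with characteristic function $t\mapsto\exp(-t^2\sigma^2/2)$ (the Dirac mass at $0$ if $\sigma=0$). *)

(* Defs.v *)
From HB Require Import structures.
From mathcomp Require Import all_boot all_order all_algebra.
From mathcomp Require Import all_classical all_reals all_analysis.

Set Implicit Arguments.
Unset Strict Implicit.
Unset Printing Implicit Defensive.

Import Order.TTheory GRing.Theory Num.Theory.
Import numFieldNormedType.Exports.

Local Open Scope classical_set_scope.
Local Open Scope ring_scope.

(* Maps of [0,1] are functions R -> R of which only the values on I01 matter;
   Borel probability measures on [0,1] are those on R giving I01 mass 1. *)

Section interval_maps.
Context {R : realType}.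
Implicit Types (f : R -> R) (x a : R).

Definition I01 : set R := `[0, 1]%classic.

Definition diff_quotient f x : R -> R := fun y => (f y - f x) / (y - x).

(* Differentiation of f as a function on [0,1]: one-sided at 0 and at 1, and
   insensitive to the values of f outside [0,1]. *)
Definition derivable01 f x := cvg (diff_quotient f x @ within I01 x^').

Definition deriv01 f x : R := lim (diff_quotient f x @ within I01 x^').

Definition C1_near f a :=
  exists2 U : set R, nbhs a U &
    (forall x, (U `&` I01) x -> derivable01 f x) /\
    {within U `&` I01, continuous (deriv01 f)}.

Definition homeo01 f :=
  [/\ set_bij I01 I01 f,
      {within I01, continuous f} &
      exists2 g : R -> R, {within I01, continuous g} & {in I01, cancel f g}].

Definition Hplus f :=
  [/\ homeo01 f,
      {in I01 &, {homo f : x y / x < y}},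
      C1_near f 0 &
      C1_near f 1].

End interval_maps.

Section iterated_function_system.
Context {R : realType} {N : nat}.
Variables (f : 'I_N -> R -> R) (p : 'I_N -> R).

Definition admissible_IFS :=
  [/\ forall i, Hplus (f i),
      (forall i, 0 < p i) /\ \sum_(i < N) p i = 1,
      forall x, 0 < x < 1 -> exists i j, f i x < x < f j x,
      forall i, 0 < deriv01 (f i) 0 /\ 0 < deriv01 (f i) 1 &
      0 < \sum_(i < N) p i * ln (deriv01 (f i) 0) /\
      0 < \sum_(i < N) p i * ln (deriv01 (f i) 1)].

(* I01 `&` f i @^-1` A is the preimage of A under f i : [0,1] -> [0,1]. *)
Definition markov_op (mu : set R -> \bar R) (A : set R) : \bar R :=
  (\sum_(i < N) (p i)%:E * mu (I01 `&` f i @^-1` A))%E.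

Definition transition (x : R) (A : set R) : \bar R := markov_op (\d_x) A.

(* Probability measures on (0,1), seen as measures on [0,1] that do not charge
   the endpoints. *)
Definition prob_on_open01 (mu : probability R R) :=
  mu I01 = 1%E /\ mu [set 0; 1] = 0%E.

Definition invariant_measure (mu : probability R R) :=
  forall A : set R, measurable A -> markov_op mu A = mu A.

(* The last clause says that transition (X n) A is the conditional probability
   of X n.+1 \in A given the sigma-algebra generated by X 0, ..., X n. *)
Definition markov_chain (nu : set R -> \bar R) d (T : measurableType d)
    (Pr : probability T R) (X : nat -> {RV Pr >-> R}) :=
  [/\ forall n w, I01 (X n w),
      forall A : set R, measurable A -> distribution Pr (X 0%N) A = nu A &
      forall (n : nat) (A : set R) (B : set T),
        measurable A ->
        g_sigma_preimage (fun k : 'I_n.+1 => (X k : T -> R)) B ->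
        Pr (B `&` X n.+1 @^-1` A) =
        (\int[Pr]_(w in B) transition (X n w) A)%E].

End iterated_function_system.

Section limit_law.
Context {R : realType}.

(* The centred normal law with standard deviation s >= 0.  The library's
   normal_prob 0 0 is the uniform law on [0,1], hence the case distinction. *)
Definition centred_normal (s : R) : set R -> \bar R :=
  if s == 0 then \d_(0 : R) else normal_prob 0 s.

Definition cvg_in_distribution d (T : measurableType d) (Pr : probability T R)
    (Y : nat -> T -> R) (nu : set R -> \bar R) :=
  forall g : R -> R, continuous g -> [bounded g x | x in [set: R]] ->
    'E_Pr[g \o Y n]%E @[n --> \oo] --> (\int[nu]_x (g x)%:E)%E.

Definition normalized_sum (phi : R -> R) T (X : nat -> T -> R) (n : nat) (w : T)
    : R :=
  (\sum_(k < n.+1) phi (X k w)) / Num.sqrt n%:R.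

Definition satisfies_CLT (phi : R -> R) (sigma : R) d (T : measurableType d)
    (Pr : probability T R) (X : nat -> T -> R) :=
  'E_Pr[fun w => (normalized_sum phi X n w ^+ 2)%R]%E @[n --> \oo]
    --> ((sigma ^+ 2)%:E)%E /\
  cvg_in_distribution Pr (normalized_sum phi X) (centred_normal sigma).

End limit_law.

(* Main.v *)
Require Import Defs.
From HB Require Import structures.
From mathcomp Require Import all_boot all_order all_algebra.
From mathcomp Require Import all_classical all_reals all_analysis.
From mathcomp Require Import measurable_realfun ring lra.

Set Implicit Arguments.
Unset Strict Implicit.
Unset Printing Implicit Defensive.

Import Order.TTheory GRing.Theory Num.Theory.
Import numFieldNormedType.Exports.

Local Open Scope classical_set_scope.
Local Open Scope ring_scope.

(* The averaging operator U g = sum_i p_i (g o f_i) preserves monotonicity.  The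
   exponents at the endpoints being positive, x^(-al) + (1-x)^(-be) is a Lyapunov
   function W with compact sublevels in (0,1), and two independent copies of the
   chain started at x <= y exchange their order with positive probability, so U
   contracts the W-weighted oscillation of increasing functions.  A Lipschitz
   function is a difference of increasing ones, whence h with h - U h = phi: up
   to a coboundary the Birkhoff sums are a martingale, and the Poisson equation
   for its conditional variance, which is again a difference of increasing
   functions, gives sigma^2.  Replacing the increments by Gaussian ones, one at a
   time, in a heat kernel shows that the normalised sum tested against a Gaussian
   differs from its limit by C W(x) / sqrt n.  Together with the second moments
   this implies weak convergence; the bound at the starting point x integrates
   over every initial law that integrates W, such as mu. *)

(** The endpoints repel in the mean, so no uniform contraction of distances is available; order is
    the substitute. For increasing [g] and x <= y, the difference g(Y) - g(X) of two independent
    copies becomes nonpositive once they have exchanged their order, and this is where the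
    contraction comes from. Points near the endpoints, where an exchange may take arbitrarily long,
    are handled by the weight, as in Harris' theorem.

    Replacing a martingale increment by a Gaussian one of constant variance costs an error of order
    1/n, hence of order 1 over n steps, because the conditional variance is not constant. A
    correction built from the second Poisson equation cancels this term and leaves n errors of order
    n^(-3/2). The heat kernel starts at a time b > 0: this keeps its derivatives bounded and treats
    sigma = 0 like every other value.

    The remainders contain third powers of the increments and products with the second Poisson
    solution, all of which must be bounded by W; hence both equations are solved with roots of W as
    weights. *)

Section averaging.
Context {R : realType} {N : nat}.
Variable p : 'I_N -> R.

(** The state space is a parameter because the operator acts both on functions of the position and
    on functions of the pair of Birkhoff sum and position. *)
Definition avg (S : Type) (F : 'I_N -> S -> S) (g : S -> R) (s : S) : R :=
  \sum_(i < N) p i * g (F i s).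

Definition prob_weights := (forall i, 0 < p i) /\ \sum_(i < N) p i = 1.

Hypothesis hp : prob_weights.

Lemma weight_ge0 i : 0 <= p i.
Proof. exact/ltW/hp.1. Qed.

Section invariant_domain.
Context {S : Type}.
Variables (F : 'I_N -> S -> S) (D : S -> Prop).
Hypothesis FD : forall i s, D s -> D (F i s).

Local Notation U := (avg F).

Lemma avg_le g h : (forall s, D s -> g s <= h s) ->
  forall s, D s -> U g s <= U h s.
Proof.
move=> gh s Ds; apply: ler_sum => i _.
by apply: ler_wpM2l; [exact: weight_ge0|apply/gh/FD].
Qed.

Lemma iter_avg_le n g h : (forall s, D s -> g s <= h s) ->
  forall s, D s -> iter n U g s <= iter n U h s.
Proof. by move=> gh; elim: n => //= n IH; exact: avg_le. Qed.

Lemma avg_eq g h : (forall s, D s -> g s = h s) ->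
  forall s, D s -> U g s = U h s.
Proof. by move=> gh s Ds; apply: eq_bigr => i _; rewrite gh //; exact: FD. Qed.

Lemma iter_avg_eq n g h : (forall s, D s -> g s = h s) ->
  forall s, D s -> iter n U g s = iter n U h s.
Proof. by move=> gh; elim: n => //= n IH; exact: avg_eq. Qed.

Lemma avg_cst c : U (fun=> c) = fun=> c.
Proof. by apply/funext => s; rewrite /avg -mulr_suml hp.2 mul1r. Qed.

Lemma iter_avg_cst n c : iter n U (fun=> c) = fun=> c.
Proof. by elim: n => //= n ->; exact: avg_cst. Qed.

Lemma avg_lin a b g h :
  U (fun s => a * g s + b * h s) = fun s => a * U g s + b * U h s.
Proof.
apply/funext => s; rewrite /avg !mulr_sumr -big_split /=.
by apply: eq_bigr => i _; ring.
Qed.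

Lemma iter_avg_lin n a b g h : iter n U (fun s => a * g s + b * h s) =
  fun s => a * iter n U g s + b * iter n U h s.
Proof. by elim: n => //= n ->; exact: avg_lin. Qed.

Lemma iter_avgD n g h : iter n U (fun s => g s + h s) =
  fun s => iter n U g s + iter n U h s.
Proof.
rewrite (_ : (fun s => g s + h s) = fun s => 1 * g s + 1 * h s).
  by rewrite iter_avg_lin; apply/funext => s; rewrite !mul1r.
by apply/funext => s; rewrite !mul1r.
Qed.

Lemma iter_avgZ n a g : iter n U (fun s => a * g s) =
  fun s => a * iter n U g s.
Proof.
rewrite (_ : (fun s => a * g s) = fun s => a * g s + 0 * g s).
  by rewrite iter_avg_lin; apply/funext => s; rewrite mul0r addr0.
by apply/funext => s; rewrite mul0r addr0.
Qed.

Lemma iter_avgB n g h : iter n U (fun s => g s - h s) =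
  fun s => iter n U g s - iter n U h s.
Proof.
rewrite (_ : (fun s => g s - h s) = fun s => 1 * g s + (-1) * h s).
  by rewrite iter_avg_lin; apply/funext => s; rewrite mul1r mulN1r.
by apply/funext => s; rewrite mul1r mulN1r.
Qed.

Lemma iter_avg_ge0 n g : (forall s, D s -> 0 <= g s) ->
  forall s, D s -> 0 <= iter n U g s.
Proof.
move=> g0 s Ds; rewrite -[leLHS]/((fun=> 0 : R) s) -(iter_avg_cst n 0).
exact: iter_avg_le.
Qed.

Lemma iter_avg_norm n g h : (forall s, D s -> `|g s| <= h s) ->
  forall s, D s -> `|iter n U g s| <= iter n U h s.
Proof.
move=> gh s Ds; rewrite ler_norml.
have -> /= : - iter n U h s <= iter n U g s.
  have := @iter_avg_le n (fun s => -1 * h s) g _ s Ds.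
  rewrite iter_avgZ mulN1r; apply => t /gh.
  by rewrite ler_norml mulN1r => /andP[].
by apply: iter_avg_le => // t /gh; rewrite ler_norml => /andP[].
Qed.

Lemma weight_avg_le i g : (forall s, D s -> 0 <= g s) ->
  forall s, D s -> p i * g (F i s) <= U g s.
Proof.
move=> g0 s Ds; rewrite /avg (bigD1 i) //= lerDl sumr_ge0 // => j _.
by rewrite mulr_ge0 ?weight_ge0 // g0 //; exact: FD.
Qed.

End invariant_domain.
End averaging.

Section geometric_sequences.
Context {R : realType}.

Lemma geometric_cauchy_cvg (a : R^nat) (C q : R) :
  0 <= q < 1 -> (forall n, `|a n.+1 - a n| <= C * q ^+ n) ->
  exists2 l : R, a @ \oo --> l & forall n, `|a n - l| <= C / (1 - q) * q ^+ n.
Proof.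
move=> /andP[q0 q1] ha.
have q1' : 0 < 1 - q by rewrite subr_gt0.
have C0 : 0 <= C by rewrite -[C]mulr1 -(expr0 q); exact: le_trans (ha 0%N).
have hd k n : `|a (n + k)%N - a n| <= C / (1 - q) * q ^+ n.
  (* The sharper bound, with the difference of the two powers, is the one that telescopes in the
     induction on [k]. *)
  suff : `|a (n + k)%N - a n| <= C / (1 - q) * (q ^+ n - q ^+ (n + k)%N).
    move=> /le_trans; apply; rewrite ler_wpM2l ?divr_ge0 ?(ltW q1') //.
    by rewrite gerBl exprn_ge0.
  elim: k => [|k IH]; first by rewrite addn0 !subrr normr0 mulr0.
  rewrite addnS (_ : _ - _ = (a (n + k).+1 - a (n + k)%N) +
    (a (n + k)%N - a n)); last by ring.
  apply: le_trans (ler_normD _ _) _.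
  rewrite (_ : _ * _ = C * q ^+ (n + k) +
    C / (1 - q) * (q ^+ n - q ^+ (n + k))); first exact: lerD.
  by rewrite exprS; field; rewrite gt_eqF.
have g0 : (fun n => C / (1 - q) * q ^+ n) @ \oo --> (0 : R).
  rewrite -[X in _ --> X](mulr0 (C / (1 - q))).
  by apply: cvgM; [exact: cvg_cst|apply: cvg_expr; rewrite ger0_norm].
have ac : cvgn a.
  apply/cauchy_cvgP/cauchy_exP => e e0.
  have [n _ hn] : \forall n \near \oo, C / (1 - q) * q ^+ n < e.
    near=> n.
    have : `|0 - C / (1 - q) * q ^+ n| < e.
      by near: n; move/cvgr_dist_lt : g0; apply.
    by rewrite sub0r normrN; exact/le_lt_trans/ler_norm.
  exists (a n); exists n => // i /= ni.
  rewrite /ball /= distrC -(subnKC ni).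
  exact: le_lt_trans (hd _ _) (hn n (leqnn n)).
exists (limn a) => // n.
have hl : (fun k => `|a n - a k|) @ \oo --> `|a n - limn a|.
  by apply: cvg_norm; apply: cvgB => //; exact: cvg_cst.
apply: (cvgr_to_le hl); near=> k.
rewrite distrC -{1}(@subnKC n k); first exact: hd.
by near: k; exists n.
Unshelve. all: by end_near. Qed.

Lemma bernoulli_ineq (t : R) (m : nat) : 0 <= t <= 1 -> 1 - m%:R * t <= (1 - t) ^+ m.
Proof.
move=> /andP[t0 t1]; elim: m => [|m IH]; first by rewrite mul0r subr0 expr0.
rewrite exprS; apply: (@le_trans _ _ ((1 - t) * (1 - m%:R * t))).
  rewrite -natr1; have : 0 <= m%:R * t * t by rewrite !mulr_ge0.
  lra.
by rewrite ler_wpM2l // subr_ge0.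
Qed.

End geometric_sequences.

(** * Contraction of increasing functions *)

Section harris.
Context {R : realType} {N : nat}.
Variables (p : 'I_N -> R) (F : 'I_N -> R -> R).

Definition in01 (x : R) := 0 < x < 1.

Definition incr01 (g : R -> R) :=
  forall x y, in01 x -> in01 y -> x <= y -> g x <= g y.

Hypothesis hp : prob_weights p.
Hypothesis F01 : forall i x, in01 x -> in01 (F i x).
Hypothesis Fincr : forall i, incr01 (F i).

Local Notation U := (avg p F).

Definition drift (V : R -> R) (gam K : R) :=
  forall x, in01 x -> U V x <= gam * V x + K.

(* From every point of the compact set, one admissible word of length m leads
   below 1/2; its probability bounds the average from below. *)
Definition split_down (d : R) (m : nat) := exists2 eps : R, 0 < eps &
  forall y, in01 y -> y <= 1 - d -> exists z, [/\ in01 z, z <= 1 / 2 &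
    forall G, (forall x, in01 x -> 0 <= G x) -> eps * G z <= iter m U G y].

Definition split_up (d : R) (m : nat) := exists2 eps : R, 0 < eps &
  forall y, in01 y -> d <= y -> exists z, [/\ in01 z, 1 / 2 <= z &
    forall G, (forall x, in01 x -> 0 <= G x) -> eps * G z <= iter m U G y].

(** All large lengths are required so that both directions are available with one common length: the
    two copies of the chain run for the same number of steps. *)
Definition splitting := forall d, 0 < d -> exists m0, forall m, (m0 <= m)%N ->
  split_down d m /\ split_up d m.

Definition compact_sublevels (V : R -> R) := forall B, exists2 d, 0 < d &
  forall x, in01 x -> V x <= B -> d <= x <= 1 - d.

Lemma avg_incr g : incr01 g -> incr01 (U g).
Proof.
move=> ig x y hx hy xy; apply: ler_sum => i _.
apply: ler_wpM2l; first exact: weight_ge0.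
by apply: ig; [exact: F01|exact: F01|exact: Fincr].
Qed.

Lemma iter_avg_incr n g : incr01 g -> incr01 (iter n U g).
Proof. by move=> ig; elim: n => //= n; exact: avg_incr. Qed.

Lemma iter_drift V gam K n : 0 <= gam < 1 -> 0 <= K -> drift V gam K ->
  forall x, in01 x -> iter n U V x <= gam ^+ n * V x + K / (1 - gam).
Proof.
move=> /andP[g0 g1] K0 dV x hx; have g1' : 0 < 1 - gam by rewrite subr_gt0.
elim: n => [|n IH] in x hx *.
  by rewrite expr0 mul1r /= lerDl divr_ge0 // ltW.
rewrite iterSr; apply: le_trans (_ : iter n U (fun x => gam * V x + K) x <= _).
  exact: (iter_avg_le hp F01).
rewrite (iter_avgD p F n (fun x => gam * V x) (fun=> K)) iter_avgZ.
rewrite (iter_avg_cst hp) exprS.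
apply: le_trans (_ : gam * (gam ^+ n * V x + K / (1 - gam)) + K <= _).
  by rewrite lerD2r ler_wpM2l // IH.
by rewrite le_eqVlt; apply/orP; left; apply/eqP; field; rewrite gt_eqF.
Qed.

Section contraction.
Variables (V : R -> R) (gam K : R).
Hypotheses (V1 : forall x, in01 x -> 1 <= V x) (hgam : 0 <= gam < 1)
  (K0 : 0 <= K) (dV : drift V gam K) (cV : compact_sublevels V)
  (spl : splitting).

(** [D] bounds the oscillation of [g] relative to the weighted distance 2 + b (V x + V y) of Harris'
    theorem. Ordered pairs suffice, since the other sign is automatic for increasing [g]. *)
Definition slope_le (b D : R) (g : R -> R) := forall x y, in01 x -> in01 y ->
  x <= y -> g y - g x <= D * (2 + b * (V x + V y)).

Let K1 := K / (1 - gam).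

Let g1' : 0 < 1 - gam. Proof. by rewrite subr_gt0; case/andP: hgam. Qed.

Let K1_ge0 : 0 <= K1. Proof. by rewrite divr_ge0 // ltW. Qed.

Let iterV n x : in01 x -> iter n U V x <= gam ^+ n * V x + K1.
Proof. by move=> hx; apply: iter_drift. Qed.

Let iterV1 n x : in01 x -> iter n U V x <= V x + K1.
Proof.
move=> hx; apply: le_trans (iterV n hx) _; rewrite lerD2r ler_piMl //.
  by apply: le_trans (V1 hx).
by case/andP: hgam => g0 g1; rewrite exprn_ile1 // ltW.
Qed.

(** Two regimes. If V x + V y is large, the drift shrinks the weight. Otherwise x and y are in a
    compact part of (0,1), and in [m] steps the independent copies exchange their order with
    probability at least [eps]. *)
Lemma block_contraction : exists m b al, [/\ (0 < m)%N, 0 < b, 1 / 2 <= al < 1 &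
  forall g D, incr01 g -> 0 <= D -> slope_le b D g ->
    slope_le b (al * D) (iter m U g)].
Proof.
case/andP: (hgam) => g0 g1.
(* Chosen so that (1 - gam) / 2 times [Rb] is 4 (K1 + 1), which dominates the additive constant of
   the drift. *)
pose Rb := 8 * (K1 + 1) / (1 - gam).
have [d d0 hd] := cV Rb.
have [m0 hm0] := spl d0.
pose m := maxn m0 1.
have [[ed ed0 hdn] [eu eu0 hup]] := hm0 m (leq_maxl _ _).
pose eps := ed * eu.
have eps0 : 0 < eps by rewrite mulr_gt0.
(* So small that the additive constant of the drift costs at most [eps], half of the gain 2 eps of
   an exchange. *)
pose b := Num.min 1 (eps / (2 * (K1 + 1))).
have K11 : 0 < K1 + 1 by rewrite ltr_wpDl.
have b0 : 0 < b by rewrite lt_min ltr01 divr_gt0 // mulr_gt0.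
have bK : 2 * b * K1 <= eps.
  apply: (@le_trans _ _ (eps / (2 * (K1 + 1)) * (2 * (K1 + 1)))); last first.
    by rewrite divfK // gt_eqF // mulr_gt0.
  rewrite (_ : 2 * b * K1 = b * (2 * K1)); last by ring.
  apply: ler_pM; [exact: ltW|by rewrite mulr_ge0|by rewrite ge_min lexx orbT|].
  lra.
(* The first two bounds serve the regime of large weights, the last one the regime of exchange. *)
pose al := Num.max ((1 + gam) / 2) (Num.max (1 - 2 * b) (1 - eps / 2)).
have al1 : al < 1 by rewrite !gt_max; apply/and3P; split; lra.
have alg : (1 + gam) / 2 <= al by rewrite /al le_max lexx.
have alb : 1 - 2 * b <= al by rewrite /al !le_max lexx orbT.
have ale : 1 - eps / 2 <= al by rewrite /al !le_max lexx !orbT.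
exists m, b, al; split=> //.
- by rewrite leq_max orbT.
- by rewrite al1 andbT; lra.
move=> g D ig D0 sg x y hx hy xy.
set S := V x + V y.
have [Vx1 Vy1] := (V1 hx, V1 hy).
have gm : gam ^+ m <= gam.
  by rewrite /m; case: (maxn m0 1) (leq_maxr m0 1) => // k _;
    rewrite exprS ler_piMr // exprn_ile1 // ltW.
have iV z : in01 z -> iter m U V z <= gam * V z + K1.
  move=> hz; apply: le_trans (iterV m hz) _; rewrite lerD2r ler_wpM2r //.
  exact: le_trans (V1 hz).
have [iVx iVy] := (iV _ hx, iV _ hy).
(* The independent coupling of the two chains, run for m steps. *)
pose G x' y' := D * (2 + b * (V x' + V y')) - (g y' - g x').
have G0 x' y' : in01 x' -> in01 y' -> 0 <= G x' y'.
  move=> hx' hy'; rewrite subr_ge0; have [xy'|/ltW yx'] := leP x' y'; first exact: sg.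
  apply: (@le_trans _ _ 0); first by rewrite subr_le0 ig.
  have := V1 hx'; have := V1 hy' => ? ?.
  by rewrite mulr_ge0 // addr_ge0 // mulr_ge0 ?(ltW b0) //; lra.
have GE y' : iter m U (G^~ y') x =
    D * (2 + b * (iter m U V x + V y')) - (g y' - iter m U g x).
  rewrite (_ : G^~ y' = fun x' => (D * b) * V x' +
      1 * (g x' + (D * (2 + b * V y') - g y'))); last first.
    by apply/funext => x'; rewrite /G; ring.
  rewrite iter_avg_lin (iter_avgD p F m g (fun=> _)) (iter_avg_cst hp).
  ring.
pose H y' := iter m U (G^~ y') x.
have HE : iter m U H y = D * (2 + b * (iter m U V x + iter m U V y)) -
    (iter m U g y - iter m U g x).
  rewrite (_ : H = fun y' => (D * b) * V y' +
     (-1) * (g y' + (- (D * (2 + b * iter m U V x)) - iter m U g x))); last first.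
    by apply/funext => y'; rewrite /H GE; ring.
  rewrite iter_avg_lin (iter_avgD p F m g (fun=> _)) (iter_avg_cst hp).
  ring.
have H0 y' : in01 y' -> 0 <= H y'.
  by move=> hy'; apply: (iter_avg_ge0 hp F01) => // x' hx'; exact: G0.
have hS2 : 2 <= S by rewrite /S; lra.
(* For large weights the mere nonnegativity of the coupled mean of [G] is enough. *)
have [SR|SR] := leP Rb S.
  have : 0 <= iter m U H y by apply: (iter_avg_ge0 hp F01).
  rewrite HE subr_ge0 => /le_trans; apply; rewrite -mulrA mulrCA ler_wpM2l //.
  have h1 : (1 - gam) / 2 * Rb <= (al - gam) * S.
    apply: ler_pM => //; first by rewrite divr_ge0 // ltW.
      by rewrite /Rb divr_ge0 ?(ltW g1') // mulr_ge0 // ltW.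
    lra.
  rewrite (_ : (1 - gam) / 2 * Rb = 4 * (K1 + 1)) in h1; last first.
    by rewrite /Rb; field; rewrite gt_eqF.
  have h2 : b * (4 * (K1 + 1)) <= b * ((al - gam) * S).
    by rewrite ler_wpM2l // ltW.
  have h3 : b * (iter m U V x + iter m U V y) <= b * (gam * S + 2 * K1).
    by rewrite ler_wpM2l ?(ltW b0) // /S; lra.
  have h4 : 0 <= b * K1 by rewrite mulr_ge0 // ltW.
  lra.
have SVR : V x + V y < Rb by [].
have hdx : d <= x by have /andP[] : d <= x <= 1 - d by apply: hd => //; lra.
have hdy : y <= 1 - d by have /andP[] : d <= y <= 1 - d by apply: hd => //; lra.
have [zu [hzu zu2 Gu]] := hup _ hx hdx.
have [zd [hzd zd2 Gd]] := hdn _ hy hdy.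
(* At the exchanged pair zd <= 1/2 <= zu monotonicity gives g zd <= g zu, so [G zu zd] is at least 2
   D; independence multiplies the probabilities [ed] and [eu]. *)
have h1 : D * (2 * eps) <= iter m U H y.
  apply: le_trans (Gd _ H0).
  apply: (@le_trans _ _ (ed * (eu * G zu zd))); last first.
    rewrite ler_wpM2l ?(ltW ed0) // /H.
    by apply: (Gu (G^~ zd)) => x' hx'; exact: G0.
  rewrite mulrA -/eps (_ : D * (2 * eps) = eps * (D * 2)); last by ring.
  rewrite ler_wpM2l ?(ltW eps0) // /G.
  have gz : g zd <= g zu by apply: ig => //; lra.
  have Vz : 0 <= D * (b * (V zu + V zd)).
    have := V1 hzu; have := V1 hzd => ? ?.
    by rewrite mulr_ge0 // mulr_ge0 ?(ltW b0) //; lra.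
  lra.
rewrite HE in h1.
have h3 : b * (iter m U V x + iter m U V y) <= b * (gam * S + 2 * K1).
  by rewrite ler_wpM2l ?(ltW b0) // /S; lra.
have h4 : b * (gam * S) <= b * (al * S).
  by rewrite ler_wpM2l ?(ltW b0) // ler_wpM2r //; lra.
have h5 : D * (2 + b * (iter m U V x + iter m U V y) - 2 * eps) <=
          D * (al * (2 + b * S)).
  by rewrite ler_wpM2l //; lra.
lra.
Qed.

(** Blocks of length [m] contract by [al]; the fewer than [m] remaining steps cost only a bounded
    factor. *)
Lemma monotone_contraction : exists C q, [/\ 0 <= C, 0 <= q < 1 &
  forall g B, incr01 g -> (forall x, in01 x -> `|g x| <= B * V x) ->
  forall n x y, in01 x -> in01 y -> x <= y ->
    0 <= iter n U g y - iter n U g x <= C * q ^+ n * (B * (V x + V y))].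
Proof.
have [m [b [al [m0 b0 /andP[al2 al1] hb]]]] := block_contraction.
have mR : (1 : R) <= m%:R by rewrite ler1n.
(* With q = 1 - t, Bernoulli's inequality gives al <= q ^ m, which avoids taking an m-th root. *)
pose t := (1 - al) / m%:R.
have t0 : 0 < t by rewrite divr_gt0 ?subr_gt0 // ltr0n.
have t1 : t <= 1 / 2.
  rewrite /t ler_pdivrMr ?ltr0n //; apply: (@le_trans _ _ (1/2 * 1)); first lra.
  by rewrite ler_wpM2l.
pose q := 1 - t.
have q0 : 0 < q by rewrite /q; lra.
have alq : al <= q ^+ m.
  apply: le_trans (bernoulli_ineq m (_ : 0 <= t <= 1)); last by apply/andP; split; lra.
  by rewrite /t mulrC divfK ?pnatr_eq0 -?lt0n //; lra.
pose kap := 1 + b * K1.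
have kap0 : 0 <= kap by rewrite /kap addr_ge0 // mulr_ge0 // ltW.
(* [kap] pays for the leftover steps, q ^ (-m) for rounding [n] down to a multiple of [m], 1 / b for
   the initial slope B / b, and 1 + b for absorbing the constant 2 into V x + V y. *)
exists (kap * (1 + b) / b / q ^+ m), q; split.
- rewrite divr_ge0 ?exprn_ge0 ?(ltW q0) // divr_ge0 ?(ltW b0) //.
  by rewrite mulr_ge0 // addr_ge0 // ltW.
- by rewrite (ltW q0) /q; lra.
move=> g B ig gB n x y hx hy xy; apply/andP; split.
  by rewrite subr_ge0; exact: iter_avg_incr.
have B0 : 0 <= B.
  have h := gB _ hx; have := V1 hx => Vx.
  by rewrite -(@pmulr_lge0 _ (V x)); [exact: le_trans h|lra].
have sg : slope_le b (B / b) g.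
  move=> u v hu hv uv; have := gB _ hu; have := gB _ hv.
  rewrite !ler_norml => /andP[_ gv] /andP[gu _].
  rewrite (_ : B / b * _ = B * (2 / b) + B * (V u + V v)); last first.
    by field; rewrite gt_eqF.
  have : 0 <= B * (2 / b) by rewrite mulr_ge0 // divr_ge0 // ltW.
  lra.
have blocks j : slope_le b (al ^+ j * (B / b)) (iter (j * m) U g).
  elim: j => [|j IH]; first by rewrite expr0 mul1r.
  rewrite mulSn iterD exprS -mulrA; apply: hb => //.
    exact: iter_avg_incr.
  by rewrite mulr_ge0 ?exprn_ge0 ?divr_ge0 ?(ltW b0) //; lra.
have steps r j : slope_le b (al ^+ j * (B / b) * kap) (iter (r + j * m) U g).
  move=> u v hu hv uv; rewrite iterD.
  set g' := iter (j * m) U g.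
  set D := al ^+ j * (B / b).
  have D0 : 0 <= D.
    by rewrite mulr_ge0 ?exprn_ge0 ?divr_ge0 ?(ltW b0) //; lra.
  (* Between blocks the single steps only transport the weight; no contraction is claimed for
     them. *)
  have key k u' v' : in01 u' -> in01 v' -> u' <= v' ->
      iter k U g' v' - iter k U g' u' <=
      D * (2 + b * (iter k U V u' + iter k U V v')).
    elim: k u' v' => [|k IH] u' v' hu' hv' uv' /=; first exact: blocks.
    rewrite {1 2 3 4}/avg -sumrB.
    rewrite (_ : D * _ = \sum_(i < N) p i * (D * (2 + b *
       (iter k U V (F i u') + iter k U V (F i v'))))); last first.
      rewrite -big_split /= mulr_sumr -[X in D * (X + _)](mulr1 2) -hp.2.
      rewrite mulr_sumr -big_split mulr_sumr /=.
      by apply: eq_bigr => i _; ring.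
    apply: ler_sum => i _; rewrite -mulrBr ler_wpM2l ?(weight_ge0 hp) //.
    by apply: IH; [exact: F01|exact: F01|exact: Fincr].
  apply: le_trans (key r u v hu hv uv) _.
  rewrite -(mulrA D) ler_wpM2l //.
  have := iterV1 r hu; have := iterV1 r hv; have := V1 hu; have := V1 hv.
  move=> Vv Vu iVv iVu.
  have h1 : b * (iter r U V u + iter r U V v) <= b * (V u + V v + 2 * K1).
    rewrite ler_wpM2l ?(ltW b0) //. lra.
  have h2 : 0 <= b * K1 * b * (V u + V v).
    have bK : 0 <= b * K1 by rewrite mulr_ge0 // ltW.
    by apply: mulr_ge0; [rewrite mulr_ge0 // ltW|lra].
  by rewrite /kap; lra.
have := steps (n %% m)%N (n %/ m)%N x y hx hy xy.
rewrite addnC -divn_eq => /le_trans; apply.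
have [Vx Vy] := (V1 hx, V1 hy).
have alqn : al ^+ (n %/ m) <= q ^+ n / q ^+ m.
  rewrite ler_pdivlMr ?exprn_gt0 //.
  apply: (@le_trans _ _ (q ^+ (m * (n %/ m)) * q ^+ (n %% m))).
    rewrite exprM; apply: ler_pM; rewrite ?exprn_ge0 ?(ltW q0) //; first lra.
      by rewrite lerXn2r ?nnegrE ?exprn_ge0 ?(ltW q0) //; lra.
    apply: ler_wiXn2l; [exact: ltW|by rewrite /q; lra|].
    by rewrite ltnW // ltn_pmod.
  by rewrite -exprD mulnC -divn_eq.
apply: (@le_trans _ _ (q ^+ n / q ^+ m * (B / b) * kap * ((1 + b) * (V x + V y)))).
  apply: ler_pM.
  - by rewrite !mulr_ge0 ?exprn_ge0 ?invr_ge0 ?(ltW b0) //; lra.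
  - by rewrite addr_ge0 // mulr_ge0 ?(ltW b0) //; lra.
  - rewrite ler_wpM2r // ler_wpM2r // divr_ge0 // ltW //.
  - lra.
rewrite le_eqVlt; apply/orP; left; apply/eqP.
by field; rewrite ?gt_eqF ?exprn_gt0.
Qed.

End contraction.
End harris.

(** * The Poisson equation for differences of increasing functions *)

Section poisson.
Context {R : realType} {N : nat}.
Variables (p : 'I_N -> R) (F : 'I_N -> R -> R).
Hypothesis hp : prob_weights p.
Hypothesis F01 : forall i x, in01 x -> in01 (F i x).
Hypothesis Fincr : forall i, incr01 (F i).
Hypothesis spl : splitting p F.

Local Notation U := (avg p F).

Definition lyapunov (V : R -> R) := [/\ forall x, in01 x -> 1 <= V x,
  compact_sublevels V &
  exists gam K, [/\ 0 <= gam < 1, 0 <= K & drift p F V gam K]].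

(** By Jensen, U (sqrt V) <= sqrt (U V), and sqrt (gam V + K) <= sqrt gam sqrt V + sqrt K. Used
    twice, it turns the fourth root of the weight into a Lyapunov function. *)
Lemma lyapunov_sqrt V : lyapunov V -> lyapunov (fun x => Num.sqrt (V x)).
Proof.
move=> [V1 cV [gam [K [/andP[g0 g1] K0 dV]]]].
have V0 x : in01 x -> 0 <= V x by move=> hx; apply: le_trans (V1 x hx).
have sV x : in01 x -> Num.sqrt (V x) ^+ 2 = V x by move=> hx; rewrite sqr_sqrtr ?V0.
split.
- by move=> x hx; rewrite -[leLHS]sqrtr1 ler_sqrt ?V1 // V0.
- move=> B; have [d d0 hd] := cV (B ^+ 2); exists d => // x hx VB.
  apply: hd => //; rewrite -sV // lerXn2r ?nnegrE ?sqrtr_ge0 //.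
  exact: le_trans (sqrtr_ge0 _) VB.
exists (Num.sqrt gam), (Num.sqrt K); split; rewrite ?sqrtr_ge0 //.
  by rewrite -[ltRHS]sqrtr1 ltr_sqrt.
move=> x hx; set a := U _ x.
have a0 : 0 <= a by apply: sumr_ge0 => i _; rewrite mulr_ge0 ?sqrtr_ge0 ?weight_ge0.
have aV : a ^+ 2 <= U V x.
  (* The variance of sqrt V under one step of the chain is nonnegative. *)
  have : 0 <= \sum_(i < N) p i * (Num.sqrt (V (F i x)) - a) ^+ 2.
    by apply: sumr_ge0 => i _; rewrite mulr_ge0 ?sqr_ge0 ?weight_ge0.
  rewrite (_ : \sum_(i < N) _ = U V x - a ^+ 2) ?subr_ge0 //.
  have -> : \sum_(i < N) p i * (Num.sqrt (V (F i x)) - a) ^+ 2 =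
    \sum_(i < N) (p i * V (F i x) + (- (2 * a)) * (p i * Num.sqrt (V (F i x)))
      + a ^+ 2 * p i).
    apply: eq_bigr => i _; move: (sV _ (F01 i hx)).
    by move: (Num.sqrt (V (F i x))) => t <-; ring.
  rewrite !big_split /= -!mulr_sumr hp.2 -/(U V x).
  by rewrite (_ : \sum_(i < N) _ = a) //; ring.
have b0 : 0 <= Num.sqrt gam * Num.sqrt (V x) + Num.sqrt K.
  by rewrite addr_ge0 ?mulr_ge0 ?sqrtr_ge0.
rewrite -(ler_sqr a0 b0); apply: le_trans aV _; apply: le_trans (dV x hx) _.
rewrite sqrrD exprMn !sqr_sqrtr ?V0 //.
have : 0 <= Num.sqrt gam * Num.sqrt (V x) * Num.sqrt K by rewrite !mulr_ge0 ?sqrtr_ge0.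
lra.
Qed.

(* The class of functions for which the Poisson equation can be solved; it is
   invariant under U and, up to squaring the weight, under products. *)
Definition bvar (V g : R -> R) := exists g1 g2 B, [/\ incr01 g1, incr01 g2,
  forall x, in01 x -> `|g1 x| <= B * V x /\ `|g2 x| <= B * V x &
  forall x, in01 x -> g x = g1 x - g2 x].

Lemma bvar_eq V g h : (forall x, in01 x -> g x = h x) -> bvar V g -> bvar V h.
Proof.
move=> gh [g1 [g2 [B [i1 i2 b e]]]]; exists g1, g2, B; split => // x hx.
by rewrite -gh // e.
Qed.

Lemma bvarD V g h : bvar V g -> bvar V h -> bvar V (fun x => g x + h x).
Proof.
move=> [g1 [g2 [B [i1 i2 b e]]]] [h1 [h2 [B' [i1' i2' b' e']]]].
exists (fun x => g1 x + h1 x), (fun x => g2 x + h2 x), (B + B'); split.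
- by move=> x y hx hy xy; rewrite lerD ?i1 ?i1'.
- by move=> x y hx hy xy; rewrite lerD ?i2 ?i2'.
- move=> x hx; have [b1 b2] := b x hx; have [b1' b2'] := b' x hx.
  by rewrite mulrDl; split; apply: le_trans (ler_normD _ _) _; rewrite lerD.
- by move=> x hx; rewrite e // e' //; ring.
Qed.

Lemma bvarN V g : bvar V g -> bvar V (fun x => - g x).
Proof.
move=> [g1 [g2 [B [i1 i2 b e]]]]; exists g2, g1, B; split => //.
- by move=> x hx; have [] := b x hx.
- by move=> x hx; rewrite e // opprB.
Qed.

Lemma bvarB V g h : bvar V g -> bvar V h -> bvar V (fun x => g x - h x).
Proof. by move=> hg hh; apply: bvarD => //; exact: bvarN. Qed.

Lemma bvar_incr V g B : incr01 g -> (forall x, in01 x -> `|g x| <= B * V x) ->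
  (forall x, in01 x -> 0 <= V x) -> bvar V g.
Proof.
move=> ig gB V0; exists g, (fun=> 0), `|B|; split => //.
- move=> x hx; rewrite normr0; split; last by rewrite mulr_ge0 // V0.
  by apply: le_trans (gB x hx) _; rewrite ler_wpM2r ?V0 ?ler_norm.
- by move=> x hx; rewrite subr0.
Qed.

Lemma bvar_cst V c : (forall x, in01 x -> 1 <= V x) -> bvar V (fun=> c).
Proof.
move=> V1; apply: (@bvar_incr _ _ `|c|) => // x hx.
  by rewrite ler_peMr // V1.
exact: le_trans (V1 x hx).
Qed.

Lemma bvarZ V a g : bvar V g -> bvar V (fun x => a * g x).
Proof.
have pos b h : 0 <= b -> bvar V h -> bvar V (fun x => b * h x).
  move=> b0 [g1 [g2 [B [i1 i2 bd e]]]].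
  exists (fun x => b * g1 x), (fun x => b * g2 x), (b * B); split => //.
  - by move=> x y hx hy xy; rewrite ler_wpM2l ?i1.
  - by move=> x y hx hy xy; rewrite ler_wpM2l ?i2.
  - move=> x hx; have [b1 b2] := bd x hx.
    by rewrite !normrM (ger0_norm b0) -!mulrA !ler_wpM2l.
  - by move=> x hx; rewrite e // mulrBr.
move=> hg; have [a0|a0] := leP 0 a; first exact: pos.
apply: (@bvar_eq _ (fun x => - (- a * g x))); first by move=> x _; ring.
by apply/bvarN/pos => //; rewrite oppr_ge0 ltW.
Qed.

Lemma bvar_bound V g : (forall x, in01 x -> 0 <= V x) -> bvar V g ->
  exists2 B, 0 <= B & forall x, in01 x -> `|g x| <= B * V x.
Proof.
move=> V0 [g1 [g2 [B [i1 i2 b e]]]]; exists (`|B| + `|B|) => [|x hx].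
  by rewrite addr_ge0.
have [b1 b2] := b x hx; have := ler_wpM2r (V0 x hx) (ler_norm B) => BV.
rewrite e // mulrDl; apply: le_trans (ler_normB _ _) _.
by rewrite lerD //; [exact: le_trans b1 BV|exact: le_trans b2 BV].
Qed.

Let half01 : in01 (1 / 2 : R).
Proof. by apply/andP; split; lra. Qed.

(* Two monotone factors vanishing at 1/2 have the same sign everywhere, so their
   product is a difference of two monotone functions. *)
Let bvar_mul0 V g h B B' : incr01 g -> incr01 h -> g (1 / 2) = 0 ->
  h (1 / 2) = 0 -> 0 <= B -> 0 <= B' ->
  (forall x, in01 x -> `|g x| <= B * V x) ->
  (forall x, in01 x -> `|h x| <= B' * V x) ->
  bvar (fun x => V x ^+ 2) (fun x => g x * h x).
Proof.
move=> ig ih g0 h0 B0 B'0 gB hB.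
have bound u v x : in01 x -> `|u| <= `|g x| -> `|v| <= `|h x| ->
    `|u * v| <= (B * B') * V x ^+ 2.
  move=> hx ug vh; rewrite normrM (_ : _ * _ = B * V x * (B' * V x)); last by ring.
  apply: ler_pM => //; [exact: le_trans ug (gB x hx)|exact: le_trans vh (hB x hx)].
have max_ge0 (a : R) : 0 <= Num.max a 0 by rewrite le_max lexx orbT.
have min_le0 (a : R) : Num.min a 0 <= 0 by rewrite ge_min lexx orbT.
have max_mono (a b : R) : a <= b -> Num.max a 0 <= Num.max b 0.
  by move=> ab; rewrite ge_max !le_max ab lexx orbT.
have min_mono (a b : R) : a <= b -> Num.min a 0 <= Num.min b 0.
  by move=> ab; rewrite le_min !ge_min ab lexx orbT.
(* The positive parts carry the product to the right of 1/2. To the left of 1/2 the product is that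
   of the negative parts, which decreases. *)
exists (fun x => Num.max (g x) 0 * Num.max (h x) 0),
       (fun x => - (Num.min (g x) 0 * Num.min (h x) 0)), (B * B'); split.
- move=> x y hx hy xy; have := ig x y hx hy xy; have := ih x y hx hy xy => h1 h2.
  by apply: ler_pM; rewrite ?max_ge0 ?max_mono.
- move=> x y hx hy xy; have := ig x y hx hy xy; have := ih x y hx hy xy => h1 h2.
  rewrite lerN2 -mulrNN -[leRHS]mulrNN.
  by apply: ler_pM; rewrite ?oppr_ge0 ?lerN2 ?min_le0 ?min_mono.
- move=> x hx; rewrite normrN; split; apply: bound => //.
  + by rewrite /Num.max; case: ifP; rewrite ?normr0.
  + by rewrite /Num.max; case: ifP; rewrite ?normr0.
  + by rewrite /Num.min; case: ifP; rewrite ?normr0.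
  + by rewrite /Num.min; case: ifP; rewrite ?normr0.
- move=> x hx; have [x2|/ltW x2] := leP x (1 / 2).
    have := ig _ _ hx half01 x2; have := ih _ _ hx half01 x2; rewrite g0 h0 => a b.
    by rewrite !max_r // !min_l // mul0r sub0r opprK.
  have := ig _ _ half01 hx x2; have := ih _ _ half01 hx x2; rewrite g0 h0 => a b.
  by rewrite !max_l // !min_r // mul0r oppr0 subr0.
Qed.

(** Subtracting the values at 1/2 makes all monotone parts vanish there; the constants split off
    produce terms of first order, which V ^ 2 >= V still bounds. *)
Lemma bvarM V g h : (forall x, in01 x -> 1 <= V x) -> bvar V g -> bvar V h ->
  bvar (fun x => V x ^+ 2) (fun x => g x * h x).
Proof.
move=> V1 hg hh.
have V0 x : in01 x -> 0 <= V x by move=> hx; apply: le_trans (V1 x hx).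
have V21 x : in01 x -> 1 <= V x ^+ 2 by move=> hx; rewrite exprn_ege1 ?V1.
have norm k : bvar V k -> exists k1 k2 c B, [/\ incr01 k1, incr01 k2, 0 <= B,
    k1 (1 / 2) = 0 /\ k2 (1 / 2) = 0 &
    forall x, in01 x -> [/\ `|k1 x| <= B * V x, `|k2 x| <= B * V x &
      k x = k1 x - k2 x + c]].
  move=> [k1 [k2 [B [i1 i2 b e]]]].
  have [b1 b2] := b _ half01.
  exists (fun x => k1 x - k1 (1 / 2)), (fun x => k2 x - k2 (1 / 2)),
    (k1 (1 / 2) - k2 (1 / 2)), (`|B| + `|k1 (1 / 2)| + `|k2 (1 / 2)|); split.
  - by move=> x y hx hy xy; rewrite lerB // i1.
  - by move=> x y hx hy xy; rewrite lerB // i2.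
  - by rewrite !addr_ge0.
  - by rewrite !subrr.
  move=> x hx; have [b1' b2'] := b x hx; have Vx := V1 x hx.
  have BV : B * V x <= `|B| * V x by rewrite ler_wpM2r ?V0 ?ler_norm.
  have a1 : `|k1 (1 / 2)| <= `|k1 (1 / 2)| * V x by rewrite ler_peMr.
  have a2 : `|k2 (1 / 2)| <= `|k2 (1 / 2)| * V x by rewrite ler_peMr.
  have p1 := normr_ge0 (k1 (1 / 2)); have p2 := normr_ge0 (k2 (1 / 2)).
  rewrite !mulrDl; split.
  - by apply: le_trans (ler_normB _ _) _; lra.
  - by apply: le_trans (ler_normB _ _) _; lra.
  - by rewrite e //; ring.
have wk k B : incr01 k -> (forall x, in01 x -> `|k x| <= B * V x) -> 0 <= B ->
    bvar (fun x => V x ^+ 2) k.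
  move=> ik kB B0; apply: (@bvar_incr _ _ B) => //; last by move=> x _; exact: sqr_ge0.
  move=> x hx.
  apply: le_trans (kB x hx) _; rewrite ler_wpM2l // expr2 ler_peMr ?V0 //.
  exact: V1.
have [g1 [g2 [c [B [ig1 ig2 B0 [g10 g20] eg]]]]] := norm g hg.
have [h1 [h2 [c' [B' [ih1 ih2 B'0 [h10 h20] eh]]]]] := norm h hh.
have [G1 G2] : (forall x, in01 x -> `|g1 x| <= B * V x) /\
    (forall x, in01 x -> `|g2 x| <= B * V x) by split=> x /eg[].
have [H1 H2] : (forall x, in01 x -> `|h1 x| <= B' * V x) /\
    (forall x, in01 x -> `|h2 x| <= B' * V x) by split=> x /eh[].
apply: (@bvar_eq _ (fun x => (g1 x * h1 x - g1 x * h2 x) -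
    (g2 x * h1 x - g2 x * h2 x) + (c' * (g1 x - g2 x) + c * (h1 x - h2 x) + c * c'))).
  by move=> x hx; have [_ _ ->] := eg x hx; have [_ _ ->] := eh x hx; ring.
apply: bvarD; first apply: bvarB; first apply: bvarB.
- exact: (bvar_mul0 ig1 ih1 g10 h10 B0 B'0 G1 H1).
- exact: (bvar_mul0 ig1 ih2 g10 h20 B0 B'0 G1 H2).
- apply: bvarB.
    exact: (bvar_mul0 ig2 ih1 g20 h10 B0 B'0 G2 H1).
  exact: (bvar_mul0 ig2 ih2 g20 h20 B0 B'0 G2 H2).
apply: bvarD; last exact: bvar_cst.
by apply: bvarD; apply: bvarZ; apply: bvarB; by [exact: wk G1 B0|exact: wk G2 B0|
  exact: wk H1 B'0|exact: wk H2 B'0].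
Qed.

Lemma lyapunov_growth V : lyapunov V -> exists2 M, 0 <= M &
  forall x, in01 x -> U V x <= M * V x.
Proof.
move=> [V1 _ [gam [K [/andP[g0 g1] K0 dV]]]]; exists (gam + K).
  exact: addr_ge0.
move=> x hx; apply: le_trans (dV x hx) _.
by rewrite mulrDl lerD2l ler_peMr // V1.
Qed.

Lemma bvar_avg V g : lyapunov V -> bvar V g -> bvar V (U g).
Proof.
move=> lV [g1 [g2 [B [i1 i2 b e]]]]; have [M M0 hM] := lyapunov_growth lV.
have [V1 _ _] := lV.
have aux k : (forall x, in01 x -> `|k x| <= B * V x) -> forall x, in01 x ->
    `|U k x| <= `|B| * M * V x.
  move=> kB x hx; apply: le_trans (_ : U (fun x => `|B| * V x) x <= _).
    apply: (@iter_avg_norm _ _ _ hp _ _ _ F01 1) => // y hy.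
    apply: le_trans (kB y hy) _; rewrite ler_wpM2r ?ler_norm //.
    exact: le_trans (V1 y hy).
  by have /= -> := iter_avgZ p F 1 `|B| V; rewrite -mulrA ler_wpM2l ?hM.
exists (U g1), (U g2), (`|B| * M); split.
- exact: avg_incr.
- exact: avg_incr.
- by move=> x hx; split; apply: aux => // y hy; have [] := b y hy.
- move=> x hx; rewrite (avg_eq p F01 e) //.
  by have := iter_avgB p F 1 g1 g2 => /= ->.
Qed.

(** The differences U^(n+1) g - U^n g are averages of differences of U^n g between two points, hence
    decay geometrically. So U^n g tends to a constant [c], and h is the sum of all U^n g - c. *)
Let poisson_incr V g B : lyapunov V -> incr01 g ->
  (forall x, in01 x -> `|g x| <= B * V x) -> exists c h, [/\ bvar V h,
  forall x, in01 x -> h x - U h x = g x - c &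
  forall x, in01 x -> iter n U g x @[n --> \oo] --> c].
Proof.
move=> lV ig gB; have [V1 cV [gam [K [hg K0 dV]]]] := lV.
have V0 x : in01 x -> 0 <= V x by move=> hx; apply: le_trans (V1 x hx).
have [C [q [C0 hq hC]]] := monotone_contraction hp F01 Fincr V1 hg K0 dV cV spl.
have [M M0 hM] := lyapunov_growth lV.
have /andP[q0 q1] := hq.
have C' n x y : in01 x -> in01 y ->
    `|iter n U g y - iter n U g x| <= C * q ^+ n * (B * (V x + V y)).
  move=> hx hy; have [xy|/ltW yx] := leP x y.
    by have /andP[h1 h2] := hC g B ig gB n x y hx hy xy; rewrite ger0_norm.
  rewrite distrC [V x + _]addrC.
  by have /andP[h1 h2] := hC g B ig gB n y x hy hx yx; rewrite ger0_norm.
have B0 : 0 <= B.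
  have h := gB _ half01; have Vx := V1 _ half01.
  by rewrite -(@pmulr_lge0 _ (V (1 / 2))); [exact: le_trans h|lra].
pose C1 := C * B * (M + 1).
have step n x : in01 x -> `|iter n.+1 U g x - iter n U g x| <= C1 * V x * q ^+ n.
  (* The value at x is written as an average of constants, to be compared branch by branch with the
     values at the points [F i x]. *)
  move=> hx; rewrite /= -[X in _ - X](congr1 (fun k => k x) (avg_cst hp F (iter n U g x))).
  rewrite {1 3}/avg -sumrB.
  apply: le_trans (ler_norm_sum _ _ _) _.
  apply: le_trans (_ : \sum_(i < N) p i * (C * q ^+ n * (B * (V x + V (F i x)))) <= _).
    apply: ler_sum => i _; rewrite -mulrBr normrM ger0_norm ?weight_ge0 //.
    by rewrite ler_wpM2l ?weight_ge0 // C' // F01.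
  have -> : \sum_(i < N) p i * (C * q ^+ n * (B * (V x + V (F i x)))) =
      C * q ^+ n * B * (V x + U V x).
    rewrite mulrDr -[X in X + _]mulr1 -hp.2 !mulr_sumr -big_split /=.
    by apply: eq_bigr => i _; ring.
  rewrite (_ : C1 * _ * _ = C * q ^+ n * B * (V x + M * V x)); last by rewrite /C1; ring.
  by rewrite ler_wpM2l ?lerD2l ?hM // !mulr_ge0 // exprn_ge0.
have cex x : in01 x -> exists2 l : R, iter n U g x @[n --> \oo] --> l &
    forall n, `|iter n U g x - l| <= C1 * V x / (1 - q) * q ^+ n.
  by move=> hx; apply: geometric_cauchy_cvg => // n; exact: step.
have [c hc _] := cex _ half01.
have q'0 : (fun n => q ^+ n) @ \oo --> (0 : R) by apply: cvg_expr; rewrite ger0_norm.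
have cx x : in01 x -> iter n U g x @[n --> \oo] --> c /\
    forall n, `|iter n U g x - c| <= C1 * V x / (1 - q) * q ^+ n.
  (* The limit does not depend on the point, since the oscillation between any two points tends to
     0. *)
  move=> hx; have [l hl bl] := cex x hx; suff -> : c = l by [].
  have d0 : (fun n => iter n U g (1 / 2) - iter n U g x) @ \oo --> (0 : R).
    apply: (@squeeze_cvgr _ _ _ _ (fun n => - (C * B * (V x + V (1 / 2))) * q ^+ n)
      (fun n => C * B * (V x + V (1 / 2)) * q ^+ n)).
    - near=> n; rewrite mulNr -ler_norml.
      apply: le_trans (C' n _ _ hx half01) _; rewrite le_eqVlt; apply/orP; left.
      by apply/eqP; ring.
    - rewrite -[X in _ --> X](mulr0 (- (C * B * (V x + V (1 / 2))))).
      by apply: cvgM => //; exact: cvg_cst.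
    - rewrite -[X in _ --> X](mulr0 (C * B * (V x + V (1 / 2)))).
      by apply: cvgM => //; exact: cvg_cst.
  apply/eqP; rewrite -subr_eq0; apply/eqP.
  by apply: (@cvg_unique _ (@Rhausdorff R) _ _ _ _ (cvgB hc hl) d0).
pose a x n : R := \sum_(k < n) (iter k U g x - c).
have ha x : in01 x -> exists2 l : R, a x @ \oo --> l &
    forall n, `|a x n - l| <= C1 * V x / (1 - q) / (1 - q) * q ^+ n.
  move=> hx; apply: geometric_cauchy_cvg => // n.
  by rewrite /a big_ord_recr /= addrAC subrr add0r; exact: (cx x hx).2.
pose h x := lim (a x @ \oo).
have hP x : in01 x -> a x @ \oo --> h x /\ `|h x| <= C1 / (1 - q) / (1 - q) * V x.
  move=> hx; have [l al bl] := ha x hx.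
  rewrite /h (cvg_lim (@Rhausdorff R) al); split=> //.
  have := bl 0%N; rewrite /a big_ord0 sub0r normrN expr0 mulr1.
  by move=> /le_trans; apply; rewrite le_eqVlt; apply/orP; left; apply/eqP; ring.
exists c, h; split; last by move=> x /cx[].
(* A pointwise limit of sums of increasing functions is increasing, so [h] stays in the class. *)
- apply: bvar_incr V0 => [|x hx]; last by have [_ hx2] := hP x hx; exact: hx2.
  move=> x y hx hy xy; apply: (ler_cvg_to (hP x hx).1 (hP y hy).1).
  near=> n; apply: ler_sum => i _; rewrite lerB //.
  exact: (iter_avg_incr hp F01 Fincr).
- move=> x hx.
  have Ua n : \sum_(i < N) p i * a (F i x) n = a x n.+1 - (g x - c).
    have -> : \sum_(i < N) p i * a (F i x) n =
        \sum_(k < n) (U (iter k U g) x - c).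
      rewrite /a; under eq_bigr => i _ do rewrite mulr_sumr.
      rewrite exchange_big /=; apply: eq_bigr => k _.
      rewrite -[X in _ = _ - X](congr1 (fun k => k x) (avg_cst hp F c)) -sumrB.
      by apply: eq_bigr => i _; rewrite mulrBr.
    by rewrite /a big_ord_recl /= addrAC subrr add0r.
  have l1 : (fun n => a x n.+1 - (g x - c)) @ \oo --> h x - (g x - c).
    apply: cvgB; last exact: cvg_cst.
    by have := (hP x hx).1; rewrite -[X in X -> _](@cvg_shiftS _ (a x)).
  have l2 : (fun n => \sum_(i < N) p i * a (F i x) n) @ \oo --> U h x.
    apply: cvg_big => [|i _]; [exact: add_continuous|apply: cvgM]; first exact: cvg_cst.
    exact: (hP _ (F01 i hx)).1.
  have eU : U h x = h x - (g x - c).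
    apply: (@cvg_unique _ (@Rhausdorff R) _ _ _ _ l2).
    by rewrite (_ : (fun n => _) = fun n => a x n.+1 - (g x - c)) //; apply/funext.
  by rewrite eU; ring.
Unshelve. all: by end_near. Qed.

(** The last clause identifies [c]: it shows that the mean of the observable vanishes and that the
    limiting variance is nonnegative. *)
Lemma poisson_equation V g : lyapunov V -> bvar V g -> exists c h, [/\ bvar V h,
  forall x, in01 x -> h x - U h x = g x - c &
  forall x, in01 x -> iter n U g x @[n --> \oo] --> c].
Proof.
move=> lV [g1 [g2 [B [i1 i2 b e]]]].
have b1 x : in01 x -> `|g1 x| <= B * V x by move=> /b[].
have b2 x : in01 x -> `|g2 x| <= B * V x by move=> /b[].
have [c1 [h1 [v1 e1 l1]]] := poisson_incr lV i1 b1.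
have [c2 [h2 [v2 e2 l2]]] := poisson_incr lV i2 b2.
exists (c1 - c2), (fun x => h1 x - h2 x); split; first exact: bvarB.
- move=> x hx; have /= -> := iter_avgB p F 1 h1 h2.
  have := e1 x hx; have := e2 x hx; rewrite e //; lra.
- move=> x hx.
  rewrite (_ : (fun n => _) = fun n => iter n U g1 x - iter n U g2 x).
    by apply: cvgB; [exact: l1|exact: l2].
  apply/funext => n; rewrite (iter_avg_eq p F01 n e) //.
  by rewrite iter_avgB.
Qed.

End poisson.

(** * The Lyapunov function and the crossing of two orbits *)

Section words.
Context {R : realType} {N : nat}.
Variables (p : 'I_N -> R) (F : 'I_N -> R -> R).
Hypothesis hp : prob_weights p.
Hypothesis F01 : forall i x, in01 x -> in01 (F i x).
Hypothesis Fincr : forall i, incr01 (F i).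

Definition run (w : seq 'I_N) (x : R) := foldl (fun y i => F i y) x w.

Lemma run_in01 w x : in01 x -> in01 (run w x).
Proof. by elim: w x => //= i w IH x hx; exact/IH/F01. Qed.

Lemma run_incr w : incr01 (run w).
Proof.
elim: w => //= i w IH x y hx hy xy.
by apply: IH; [exact: F01|exact: F01|exact: Fincr].
Qed.

(** Keeps the one trajectory that reads [w]; the others contribute nonnegatively. *)
Lemma word_avg_le w G y : (forall x, in01 x -> 0 <= G x) -> in01 y ->
  (\prod_(i <- w) p i) * G (run w y) <= iter (size w) (avg p F) G y.
Proof.
move=> G0; elim: w y => [|i w IH] y hy; first by rewrite big_nil mul1r.
rewrite big_cons -mulrA; apply: le_trans (weight_avg_le hp F01 i _ hy).
  by rewrite ler_wpM2l ?(weight_ge0 hp) // IH // F01.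
by move=> s; exact: (iter_avg_ge0 hp F01).
Qed.

Lemma word_weight_gt0 w : 0 < \prod_(i <- w) p i.
Proof. by apply: prodr_gt0 => i _; exact: hp.1. Qed.

Hypothesis Fcont : forall i x, in01 x -> {for x, continuous (F i)}.
Hypothesis Fdown : forall x, in01 x -> exists i, F i x < x.

(** Otherwise the infimum of the reachable points lies in [1/2, x]. Some map moves it strictly down,
    and by continuity it moves nearby reachable points below the infimum as well. *)
Lemma word_down x : in01 x -> exists w, run w x <= 1 / 2.
Proof.
move=> hx; apply: contrapT => /forallNP nw.
have {}nw w : 1 / 2 < run w x by rewrite ltNge; apply/negP/nw.
pose S := [set run w x | w in [set: seq 'I_N]].
have Sx : S x by exists [::].
have lS : has_lbound S by exists (1 / 2) => _ [w _ <-]; exact/ltW.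
have l2 : 1 / 2 <= inf S.
  by apply: lb_le_inf; [exists x|move=> _ [w _ <-]; exact/ltW].
have lx : inf S <= x by apply: ge_inf.
have hl : in01 (inf S) by case/andP: hx => ? ?; apply/andP; split; lra.
have [i Fl] := Fdown hl.
have : nbhs (inf S) [set y | F i y < inf S].
  exact: (cvgr_lt _ (Fcont hl) _ Fl).
move=> /nbhs_ballP[d /= d0 hd].
have [_ [w _ <-] wd] := @inf_adherent _ S d d0 (conj (ex_intro _ x Sx) lS).
have Sw v : S (run v x) by exists v.
have lw := ge_inf lS (Sw w).
have : F i (run w x) < inf S.
  by apply: hd; rewrite /ball /= ler0_norm ?subr_le0 // opprB ltrBlDl.
apply/negP; rewrite -leNgt.
have -> : F i (run w x) = run (rcons w i) x by rewrite /run -cats1 foldl_cat.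
exact: ge_inf.
Qed.

(** A word that works is prolonged by a letter that lowers the current point. *)
Lemma word_down_size x : in01 x -> exists m0, forall m, (m0 <= m)%N ->
  exists2 w, size w = m & run w x <= 1 / 2.
Proof.
move=> hx; have [w0 hw0] := word_down hx; exists (size w0) => m.
move=> /subnKC <-; elim: (m - size w0)%N => [|k [w sw hw]].
  by exists w0; rewrite ?addn0.
have [i hi] := Fdown (run_in01 w hx).
exists (rcons w i); first by rewrite size_rcons sw addnS.
by rewrite /run -cats1 foldl_cat /=; apply: le_trans (ltW hi) hw.
Qed.

End words.

Section flip.
Context {R : realType} {N : nat}.
Variables (p : 'I_N -> R) (F : 'I_N -> R -> R).

(** The conjugate of [F i] by the reflection x -> 1 - x, which transfers results at the endpoint 0
    to the endpoint 1. *)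
Definition flip (i : 'I_N) (x : R) : R := 1 - F i (1 - x).

Lemma flip_in01 : (forall i x, in01 x -> in01 (F i x)) ->
  forall i x, in01 x -> in01 (flip i x).
Proof.
move=> F01 i x /andP[x0 x1].
have /andP[h0 h1] : in01 (F i (1 - x)) by apply: F01; apply/andP; split; lra.
by apply/andP; split; rewrite /flip; lra.
Qed.

Lemma flip_incr : (forall i, incr01 (F i)) -> forall i, incr01 (flip i).
Proof.
move=> Fi i x y /andP[x0 x1] /andP[y0 y1] xy; rewrite lerD2l lerN2.
by apply: Fi; [apply/andP; split; lra|apply/andP; split; lra|lra].
Qed.

Lemma run_flip w x : run flip w (1 - x) = 1 - run F w x.
Proof.
rewrite /run; elim: w x => //= i w IH x.
by rewrite {2}/flip subKr IH.
Qed.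

Lemma flip_continuous :
  (forall i x, in01 x -> {for x, continuous (F i)}) ->
  forall i x, in01 x -> {for x, continuous (flip i)}.
Proof.
move=> Fc i x /andP[x0 x1]; apply: cvgB; first exact: cvg_cst.
apply: continuous_comp; first by apply: cvgB; [exact: cvg_cst|exact: cvg_id].
by apply: Fc; apply/andP; split; lra.
Qed.

End flip.

Section drift_of_repelling_endpoints.
Context {R : realType} {N : nat}.
Variables (p : 'I_N -> R) (F : 'I_N -> R -> R).
Hypothesis hp : prob_weights p.
Hypothesis F01 : forall i x, in01 x -> in01 (F i x).
Hypothesis Fincr : forall i, incr01 (F i).

(** By monotonicity, a word that brings the extreme point of the compact set across 1/2 does so for
    all its points; its probability is the uniform [eps]. *)
Lemma splittingP :
  (forall i x, in01 x -> {for x, continuous (F i)}) ->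
  (forall x, in01 x -> exists i j, F i x < x < F j x) -> splitting p F.
Proof.
move=> Fc Fud d d0.
have Fdn x : in01 x -> exists i, F i x < x.
  by move=> /Fud[i [j /andP[h _]]]; exists i.
have Fup x : in01 x -> exists i, flip F i x < x.
  move=> /andP[x0 x1]; have : in01 (1 - x) by apply/andP; split; lra.
  by move=> /Fud[i [j /andP[_ h]]]; exists j; rewrite /flip; lra.
pose d' := Num.min d (1 / 2).
have d'0 : 0 < d' by rewrite lt_min d0; lra.
have d'd : d' <= d by rewrite ge_min lexx.
have d'2 : d' <= 1 / 2 by rewrite ge_min lexx orbT.
have hd1 : in01 (1 - d') by apply/andP; split; lra.
have hd : in01 d' by apply/andP; split; lra.
have [m1 h1] := word_down_size F01 Fc Fdn hd1.
have [m2 h2] := word_down_size (flip_in01 F01) (flip_continuous Fc) Fup hd1.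
exists (maxn m1 m2) => m; rewrite geq_max => /andP[/h1[w1 <- hw1] /h2[w2 sw2 hw2]].
split.
  exists (\prod_(i <- w1) p i) => [|y hy yd]; first exact: word_weight_gt0.
  exists (run F w1 y); split; first exact: run_in01.
    by apply: le_trans hw1; apply: run_incr => //; lra.
  by move=> G G0; exact: word_avg_le.
exists (\prod_(i <- w2) p i) => [|y hy yd]; first exact: word_weight_gt0.
exists (run F w2 y); split; first exact: run_in01.
  move: hw2; rewrite run_flip => hw2.
  have : run F w2 d' <= run F w2 y by apply: run_incr => //; lra.
  lra.
by move=> G G0; rewrite -sw2; exact: word_avg_le.
Qed.

(** From exp(-t) >= 1 - t one gets exp(t) (1 - t) <= 1, while (1 + t + 2 t^2)(1 - t) = 1 + t^2 (1 -
    2 t) >= 1. *)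
Lemma expR_le_quad (t : R) : t <= 1 / 2 -> expR t <= 1 + t + 2 * t ^+ 2.
Proof.
move=> t2; have h := expR_ge1Dx (- t).
have t1 : 0 < 1 - t by lra.
have : expR t * (1 - t) <= 1.
  by rewrite -[leRHS](expRxMexpNx_1 t) ler_wpM2l ?expR_ge0.
have : 1 <= (1 + t + 2 * t ^+ 2) * (1 - t).
  have : 0 <= t ^+ 2 * (1 - 2 * t) by rewrite mulr_ge0 ?sqr_ge0; lra.
  lra.
by move=> h1 h2; rewrite -(ler_pM2r t1); exact: le_trans h2 h1.
Qed.

(** Near 0 the map [F i] multiplies by at least exp(l i), where the mean of [l] is positive; hence
    the mean of exp(-al l) is 1 - al mu / 2 plus a quadratic term, below 1 for small [al]. Beyond
    [d] the decreasing power is bounded through its values at the points [F i d]. *)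
Lemma power_drift (a : 'I_N -> R) :
  (forall i, 0 < a i) -> 0 < \sum_(i < N) p i * ln (a i) ->
  (forall i b, b < a i -> exists2 d, 0 < d & forall x, 0 < x < d -> b * x <= F i x) ->
  exists al gam K, [/\ 0 < al, 0 <= gam < 1, 0 <= K &
    drift p F (fun x => expR (- al * ln x)) gam K].
Proof.
move=> a0; set mu := \sum_(i < N) _ => mu0 Fa.
(* Half of the mean exponent is given up, so that exp(l i) is strictly below the derivative and the
   mean of [l] is still mu / 2. *)
pose l i := ln (a i) - mu / 2.
pose M := \sum_(i < N) p i * l i ^+ 2.
pose L := \sum_(i < N) `|l i|.
have M0 : 0 <= M by apply: sumr_ge0 => i _; rewrite mulr_ge0 ?sqr_ge0 ?(weight_ge0 hp).
have L0 : 0 <= L by apply: sumr_ge0.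
have lL i : `|l i| <= L by rewrite /L (bigD1 i) //= lerDl sumr_ge0.
(* The first bound keeps the exponents below 1/2, as [expR_le_quad] demands; the second makes the
   quadratic term at most half of the linear gain. *)
pose al := Num.min (1 / (2 * (1 + L))) (mu / (8 * (M + 1))).
have al0 : 0 < al.
  by rewrite lt_min; apply/andP; split; rewrite divr_gt0 // mulr_gt0 //; lra.
have alL i : - al * l i <= 1 / 2.
  apply: le_trans (ler_norm _) _; rewrite normrM normrN (gtr0_norm al0).
  apply: (@le_trans _ _ (1 / (2 * (1 + L)) * (1 + L))).
    apply: ler_pM => //; first exact: ltW.
      by rewrite ge_min lexx.
    by have := lL i; lra.
  by rewrite le_eqVlt; apply/orP; left; apply/eqP; field; rewrite gt_eqF //; lra.
have alM : al * M <= mu / 8.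
  apply: (@le_trans _ _ (mu / (8 * (M + 1)) * (M + 1))).
    apply: ler_pM => //; [exact: ltW|by rewrite ge_min lexx orbT|lra].
  by rewrite le_eqVlt; apply/orP; left; apply/eqP; field; rewrite gt_eqF //; lra.
pose gam := \sum_(i < N) p i * expR (- al * l i).
have gam0 : 0 <= gam.
  by apply: sumr_ge0 => i _; rewrite mulr_ge0 ?expR_ge0 ?(weight_ge0 hp).
have gam1 : gam < 1.
  have sl : \sum_(i < N) p i * l i = mu / 2.
    rewrite /l; under eq_bigr => i _ do rewrite mulrBr.
    by rewrite sumrB -mulr_suml hp.2 -/mu; lra.
  apply: le_lt_trans (_ : 1 - al * (mu / 2) + 2 * al ^+ 2 * M < 1).
    rewrite -sl /M -[X in X - _]hp.2 !mulr_sumr -sumrB -big_split /=.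
    apply: ler_sum => i _.
    apply: le_trans (ler_wpM2l (weight_ge0 hp i) (expR_le_quad (alL i))) _.
    by rewrite le_eqVlt; apply/orP; left; apply/eqP; ring.
  have : al * (al * M) <= al * (mu / 8) by rewrite ler_wpM2l // ltW.
  have : 0 < al * mu by rewrite mulr_gt0.
  rewrite expr2; lra.
have hb i : exists2 d, 0 < d & forall x, 0 < x < d -> expR (l i) * x <= F i x.
  apply: Fa; rewrite /l expRD lnK ?posrE // gtr_pMr //.
  by rewrite expR_lt1; lra.
have [d [d0 d1 hd]] : exists d, [/\ 0 < d, d < 1 &
    forall i x, 0 < x <= d -> expR (l i) * x <= F i x].
  have /choice[D hD] : forall i, exists d, 0 < d /\
      forall x, 0 < x < d -> expR (l i) * x <= F i x.
    by move=> i; have [d d0 h] := hb i; exists d.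
  exists (\big[Num.min/(1 / 2)]_(i < N) (D i / 2)); split.
  - apply: (big_ind (fun d => 0 < d)) => [|u v u0 v0|i _]; first lra.
      by rewrite lt_min u0.
    by have [? _] := hD i; lra.
  - by apply: le_lt_trans (bigmin_le_id _ _ _ _) _; lra.
  - move=> i x /andP[x0 xd]; have [Di hDi] := hD i; apply: hDi; rewrite x0 /=.
    by apply: le_lt_trans xd _; apply: (@le_lt_trans _ _ (D i / 2));
      [exact: bigmin_le_cond|lra].
have hd01 : in01 d by apply/andP.
exists al, gam, (\sum_(i < N) p i * expR (- al * ln (F i d))); split => //.
- by rewrite gam0.
- by apply: sumr_ge0 => i _; rewrite mulr_ge0 ?expR_ge0 ?(weight_ge0 hp).
have lnle (u v : R) : 0 < u -> u <= v -> expR (- al * ln v) <= expR (- al * ln u).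
  move=> u0 uv; rewrite ler_expR !mulNr lerN2 ler_wpM2l ?(ltW al0) //.
  by rewrite ler_ln ?posrE //; exact: lt_le_trans uv.
move=> x hx; have /andP[x0 x1] := hx.
have [xd|/ltW dx] := leP x d.
  apply: le_trans (_ : gam * expR (- al * ln x) <= _); last first.
    by rewrite lerDl; apply: sumr_ge0 => i _; rewrite mulr_ge0 ?expR_ge0 ?(weight_ge0 hp).
  rewrite /gam mulr_suml; apply: ler_sum => i _.
  rewrite -mulrA ler_wpM2l ?(weight_ge0 hp) //.
  apply: le_trans (lnle (expR (l i) * x) _ _ _) _.
  - by rewrite mulr_gt0 ?expR_gt0.
  - by apply: hd; rewrite x0.
  - by rewrite lnM ?posrE ?expR_gt0 // expRK mulrDr expRD.
apply: le_trans (_ : \sum_(i < N) p i * expR (- al * ln (F i d)) <= _); last first.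
  by rewrite lerDr mulr_ge0 ?expR_ge0.
apply: ler_sum => i _; rewrite ler_wpM2l ?(weight_ge0 hp) // lnle //.
  by have /andP[] := F01 i hd01.
exact: Fincr.
Qed.

End drift_of_repelling_endpoints.

Section weight.
Context {R : realType} {N : nat}.
Variables (p : 'I_N -> R) (F : 'I_N -> R -> R).
Hypothesis hp : prob_weights p.
Hypothesis F01 : forall i x, in01 x -> in01 (F i x).
Hypothesis Fincr : forall i, incr01 (F i).

Definition endpoint_weight (al be x : R) :=
  expR (- al * ln x) + expR (- be * ln (1 - x)).

(** The summand at 1 is the power weight of the flipped system evaluated at 1 - x, so the two drift
    inequalities add up. *)
Lemma lyapunov_endpoint_weight (a b : 'I_N -> R) :
  (forall i, 0 < a i) -> 0 < \sum_(i < N) p i * ln (a i) ->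
  (forall i, 0 < b i) -> 0 < \sum_(i < N) p i * ln (b i) ->
  (forall i c, c < a i -> exists2 d, 0 < d & forall x, 0 < x < d -> c * x <= F i x) ->
  (forall i c, c < b i -> exists2 d, 0 < d & forall x, 0 < x < d ->
    c * x <= flip F i x) ->
  exists al be, lyapunov p F (endpoint_weight al be).
Proof.
move=> a0 sa b0 sb Fa Fb.
have [al [g [K [al0 /andP[g0 g1] K0 dr]]]] := power_drift hp F01 Fincr a0 sa Fa.
have [be [g' [K' [be0 /andP[g'0 g'1] K'0 dr']]]] :=
  power_drift hp (flip_in01 F01) (flip_incr Fincr) b0 sb Fb.
exists al, be; split.
- move=> x /andP[x0 x1]; rewrite /endpoint_weight.
  have : 1 <= expR (- al * ln x).
    by apply: le_trans (expR_ge1Dx _); rewrite lerDl mulNr -mulrN mulr_ge0 ?(ltW al0) // oppr_ge0 ln_le0 // ltW.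
  by have := expR_ge0 (- be * ln (1 - x)); lra.
- move=> B.
  have far (c y : R) : 0 < c -> 0 < y -> expR (- c * ln y) <= B ->
      expR (- (B / c)) <= y.
    move=> c0 y0 hB; rewrite -[leRHS](@lnK R) ?posrE // ler_expR.
    have := le_trans (expR_ge1Dx _) hB => h.
    by rewrite -mulNr ler_pdivrMr //; lra.
  exists (Num.min (expR (- (B / al))) (expR (- (B / be)))).
    by rewrite lt_min !expR_gt0.
  move=> x /andP[x0 x1] hB; apply/andP; split.
    rewrite ge_min far //; apply: le_trans hB.
    by rewrite lerDl expR_ge0.
  rewrite lerBrDl -lerBrDr ge_min (far be) ?orbT ?subr_gt0 //.
  by apply: le_trans hB; rewrite lerDr expR_ge0.
exists (Num.max g g'), (K + K'); split.
- by rewrite le_max g0 gt_max g1 g'1.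
- exact: addr_ge0.
move=> x hx; have /andP[x0 x1] := hx.
have hx' : in01 (1 - x) by apply/andP; split; lra.
have := dr x hx; have := dr' _ hx'.
have -> : avg p F (endpoint_weight al be) x = avg p F (fun x => expR (- al * ln x)) x
    + avg p (flip F) (fun x => expR (- be * ln x)) (1 - x).
  rewrite /avg -big_split /=; apply: eq_bigr => i _.
  by rewrite /flip subKr mulrDr.
rewrite /endpoint_weight => h1 h2.
have e1 := expR_ge0 (- al * ln x); have e2 := expR_ge0 (- be * ln (1 - x)).
have : g * expR (- al * ln x) <= Num.max g g' * expR (- al * ln x).
  by rewrite ler_wpM2r // le_max lexx.
have : g' * expR (- be * ln (1 - x)) <= Num.max g g' * expR (- be * ln (1 - x)).
  by rewrite ler_wpM2r // le_max lexx orbT.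
lra.
Qed.

End weight.

(** * Estimates for the heat kernel *)

Section derivation_rules.
Context {R : realType}.
Implicit Types (f g : R -> R) (x a b : R).

(** Derivatives are carried as explicit values: the rules build one expression, and [der_eq] leaves
    its comparison with the wanted one to [ring] or [field]. *)
Definition der f x a := is_derive (x : R^o) (1 : R^o) (f : R^o -> R^o) a.

Lemma der_eq f x a b : der f x a -> a = b -> der f x b.
Proof. by move=> h <-. Qed.

Lemma derC c x : der (fun=> c) x 0.
Proof. exact: is_derive_cst. Qed.

Lemma derI x : der id x 1.
Proof. exact: is_derive_id. Qed.

Lemma derB f g x a b : der f x a -> der g x b -> der (fun t => f t - g t) x (a - b).
Proof. by move=> hf hg; exact: is_deriveB. Qed.

Lemma derN f x a : der f x a -> der (fun t => - f t) x (- a).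
Proof. by move=> hf; exact: is_deriveN. Qed.

Lemma derM f g x a b : der f x a -> der g x b ->
  der (fun t => f t * g t) x (a * g x + f x * b).
Proof.
move=> hf hg; apply: der_eq; first exact: (is_deriveM hf hg).
by rewrite /GRing.scale /=; ring.
Qed.

Lemma derV f x a : f x != 0 -> der f x a -> der (fun t => (f t)^-1) x (- a / (f x) ^+ 2).
Proof.
move=> fx hf; apply: der_eq; first exact: (is_deriveV fx hf).
by rewrite /GRing.scale /=; ring.
Qed.

Lemma derexp f x a : der f x a -> der (fun t => expR (f t)) x (a * expR (f x)).
Proof.
move=> hf; apply: der_eq; first exact: (is_derive1_comp (is_derive_expR _) hf).
by rewrite mulrC.
Qed.

Lemma derln x : 0 < x -> der (@ln R) x x^-1.
Proof. exact: is_derive1_ln. Qed.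

Lemma der_continuous f x a : der f x a -> {for x, continuous f}.
Proof. by case=> h _; apply: differentiable_continuous; exact/derivable1_diffP. Qed.

End derivation_rules.

Section mean_value.
Context {R : realType}.
Variable J : R -> Prop.
Hypothesis Jconv : forall x y z, J x -> J y -> x <= z <= y -> J z.

Definition between (a b t : R) := a <= t <= b \/ b <= t <= a.

(** [J] will be the whole line for the space variable and an interval of times bounded away from 0
    for the time variable. *)
Lemma mvt_bound (f df : R -> R) (a b K : R) :
  J a -> J b -> (forall t, J t -> der f t (df t)) ->
  (forall t, between a b t -> `|df t| <= K) -> `|f b - f a| <= K * `|b - a|.
Proof.
wlog ab : a b / a <= b.
  move=> wl Ja Jb hf hK; have [ab|/ltW ba] := leP a b; first exact: wl.
  rewrite distrC (distrC b); apply: wl => // t [tt|tt]; apply: hK; [right|left] => //.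
move=> Ja Jb hf hK.
have cf : {within `[a, b], continuous f}.
  apply: derivable_within_continuous => t; rewrite in_itv /= => tab.
  by have [] := hf t (Jconv Ja Jb tab).
have df' t : t \in `]a, b[ -> is_derive t 1 f (df t).
  rewrite in_itv /= => /andP[t1 t2]; apply: hf; apply: Jconv Ja Jb _.
  by rewrite !ltW.
have [c cab ->] := MVT_segment ab df' cf.
rewrite normrM ler_wpM2r //; apply: hK; left.
by rewrite in_itv /= in cab.
Qed.

(** The mean value bound applied to [f] minus its affine part; the sharp factor 1/2 is given up. *)
Lemma taylor1_bound (f f1 : R -> R) (a b C : R) : J a -> J b -> 0 <= C ->
  (forall t, J t -> der f t (f1 t)) ->
  (forall t, between a b t -> `|f1 t - f1 a| <= C * `|t - a|) ->
  `|f b - f a - (b - a) * f1 a| <= C * `|b - a| ^+ 2.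
Proof.
move=> Ja Jb C0 hf hC.
have -> : f b - f a - (b - a) * f1 a =
    (f b - b * f1 a) - (f a - a * f1 a) by ring.
rewrite expr2 mulrA.
apply: (@mvt_bound (fun t => f t - t * f1 a) (fun t => f1 t - f1 a)) => //.
  move=> t Jt; apply: der_eq; first by apply: derB (hf t Jt) (derM (derI t) (derC _ _)).
  by rewrite mul1r mulr0 addr0.
move=> t tab; apply: le_trans (hC t tab) _; rewrite ler_wpM2l //.
by case: tab => /andP[? ?]; [rewrite !ger0_norm|rewrite !ler0_norm]; lra.
Qed.

Lemma taylor2_bound (f f1 f2 : R -> R) (a b C : R) : J a -> J b -> 0 <= C ->
  (forall t, J t -> der f t (f1 t)) -> (forall t, J t -> der f1 t (f2 t)) ->
  (forall t, between a b t -> `|f2 t - f2 a| <= C * `|t - a|) ->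
  `|f b - f a - (b - a) * f1 a - (b - a) ^+ 2 / 2 * f2 a| <= C * `|b - a| ^+ 3.
Proof.
move=> Ja Jb C0 hf hf1 hC.
have -> : f b - f a - (b - a) * f1 a - (b - a) ^+ 2 / 2 * f2 a =
    (f b - b * f1 a - (b - a) * (b - a) / 2 * f2 a) -
    (f a - a * f1 a - (a - a) * (a - a) / 2 * f2 a) by ring.
rewrite exprSr mulrA.
apply: (@mvt_bound (fun t => f t - t * f1 a - (t - a) * (t - a) / 2 * f2 a)
  (fun t => f1 t - f1 a - (t - a) * f2 a)) => //.
  move=> t Jt; apply: der_eq.
    apply: derB; first by apply: derB (hf t Jt) (derM (derI t) (derC _ _)).
    have dta := derB (derI t) (derC a t).
    exact: (derM (derM (derM dta dta) (derC _ _)) (derC _ _)).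
  by rewrite /=; field.
move=> t tab.
have Jt : J t by case: tab => ?; [apply: Jconv Ja Jb _|apply: Jconv Jb Ja _].
apply: (@le_trans _ _ (C * `|t - a| ^+ 2)).
  apply: taylor1_bound => // s sat; apply: hC.
  by case: tab sat => /andP[? ?] [/andP[? ?]|/andP[? ?]];
    (left; apply/andP; split; lra) || (right; apply/andP; split; lra).
rewrite ler_wpM2l // lerXn2r ?nnegrE //.
by case: tab => /andP[? ?]; [rewrite !ger0_norm|rewrite !ler0_norm]; lra.
Qed.

End mean_value.

Section heat_kernel.
Context {R : realType}.
Implicit Types (t y : R).

(** The unnormalised Gaussian density exp(-y^2 / (2 t)) / sqrt t. As a single exponential, its
    derivatives are polynomials in y and 1 / t times itself. *)
Definition heat t y : R := expR (- (y * y * t^-1 / 2) - ln t / 2).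
Definition heat1 t y : R := (- (y * t^-1)) * heat t y.
Definition heat2 t y : R := (y * y * (t^-1 * t^-1) - t^-1) * heat t y.
Definition heat3 t y : R :=
  (- (y * y * y * (t^-1 * t^-1 * t^-1)) + 3 * y * (t^-1 * t^-1)) * heat t y.
(** The fourth space derivative; half of it is the time derivative of [heat2]. *)
Definition heat4 t y : R :=
  (y * y * y * y * (t^-1 * t^-1 * t^-1 * t^-1)
    - 6 * (y * y) * (t^-1 * t^-1 * t^-1) + 3 * (t^-1 * t^-1)) * heat t y.

Let dersq y : der (fun y => y * y) y (y + y).
Proof.
apply: der_eq; first exact: (derM (derI y) (derI y)).
by rewrite mul1r mulr1.
Qed.

Lemma der_heat t y : der (heat t) y (heat1 t y).
Proof.
apply: der_eq.
  apply: derexp; apply: derB; last exact: derC.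
  apply: derN.
  exact: (derM (derM (dersq y) (derC _ _)) (derC _ _)).
rewrite /heat1 /heat /=; congr (_ * _); move: t^-1 => z; by field.
Qed.

Lemma der_heat1 t y : der (heat1 t) y (heat2 t y).
Proof.
apply: der_eq.
  apply: derM; last exact: der_heat.
  exact: (derN (derM (derI y) (derC _ _))).
by rewrite /heat2 /heat1 /=; ring.
Qed.

Lemma der_heat2 t y : der (heat2 t) y (heat3 t y).
Proof.
apply: der_eq.
  apply: derM; last exact: der_heat.
  exact: (derB (derM (dersq y) (derC _ _)) (derC _ _)).
by rewrite /heat3 /heat1 /=; ring.
Qed.

Lemma der_heat_t t y : 0 < t -> der (heat^~ y) t (heat2 t y / 2).
Proof.
move=> t0; have tn : t != 0 by rewrite gt_eqF.
apply: der_eq.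
  apply: derexp; apply: derB.
    apply: derN.
    exact: (derM (derM (derC _ _) (@derV _ id _ _ tn (derI t))) (derC _ _)).
  exact: (derM (derln t0) (derC _ _)).
by rewrite /heat2 /heat /=; field.
Qed.

Lemma der_heat2_t t y : 0 < t -> der (heat2^~ y) t (heat4 t y / 2).
Proof.
move=> t0; have tn : t != 0 by rewrite gt_eqF.
have dV := @derV _ id _ _ tn (derI t).
apply: der_eq.
  apply: derM; last exact: der_heat_t.
  exact: (derB (derM (derC _ _) (derM dV dV)) dV).
by rewrite /heat4 /heat2 /=; field.
Qed.

Lemma heat_gt0 t y : 0 < heat t y.
Proof. exact: expR_gt0. Qed.

(** In terms of w = y^2 / (2 t) the polynomial is 1 + 2 t w + 4 t^2 w^2, and exp(w) dominates both w
    and w^2 / 2. *)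
Lemma heat_moment_bound b b' : 0 < b -> exists2 C, 0 <= C &
  forall t y, b <= t <= b' -> (1 + y ^+ 2 + y ^+ 4) * heat t y <= C.
Proof.
move=> b0; exists ((1 + 2 * `|b'| + 8 * `|b'| ^+ 2) * expR (- ln b / 2)).
  by rewrite mulr_ge0 ?expR_ge0 // !addr_ge0 // mulr_ge0 // exprn_ge0.
move=> t y /andP[bt tb]; have t0 : 0 < t by exact: lt_le_trans bt.
have tb' : t <= `|b'| by apply: le_trans tb (ler_norm _).
set w := y * y * t^-1 / 2.
have w0 : 0 <= w.
  by rewrite /w -expr2 divr_ge0 // divr_ge0 ?sqr_ge0 // ltW.
have yw : y ^+ 2 = 2 * t * w by rewrite /w; field; rewrite gt_eqF.
have yw4 : y ^+ 4 = 4 * t ^+ 2 * w ^+ 2.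
  by rewrite -[4%N]/(2 * 2)%N exprM yw; ring.
rewrite /heat -/w expRD mulrA; apply: ler_pM; rewrite ?expR_ge0 //.
- by rewrite mulr_ge0 ?expR_ge0 // !addr_ge0 ?sqr_ge0 // -[4%N]/(2 * 2)%N exprM sqr_ge0.
- rewrite expRN ler_pdivrMr ?expR_gt0 // yw yw4.
  have e1 := expR_ge1Dx w; have := expR_ge1Dxn 1 w0.
  rewrite (_ : (2`!)%:R = 2 :> R) // => e2.
  apply: (@le_trans _ _ ((1 + 2 * t + 8 * t ^+ 2) * expR w)).
    have h1 : 2 * t * w <= 2 * t * expR w by rewrite ler_wpM2l ?mulr_ge0 ?(ltW t0) //; lra.
    have h2 : 4 * t ^+ 2 * w ^+ 2 <= 4 * t ^+ 2 * (2 * expR w).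
      rewrite ler_wpM2l ?mulr_ge0 ?sqr_ge0 //; lra.
    lra.
  rewrite ler_wpM2r ?expR_ge0 // !lerD ?ler_wpM2l //.
  by rewrite lerXn2r ?nnegrE ?(ltW t0).
- rewrite ler_expR !mulNr lerN2 ler_wpM2r // ler_ln ?posrE //.
Qed.

Lemma heat_derivs_bound b b' : 0 < b -> exists2 C, 0 <= C &
  forall t y, b <= t <= b' -> [/\ `|heat1 t y| <= C, `|heat2 t y| <= C,
    `|heat3 t y| <= C & `|heat4 t y| <= C].
Proof.
move=> b0; have [C C0 hC] := heat_moment_bound b' b0.
pose K := 1 + b^-1.
have K1 : 1 <= K by rewrite lerDl invr_ge0 ltW.
have K4 : 0 <= K ^+ 4 by rewrite exprn_ge0 //; lra.
(* 10 = 1 + 6 + 3 is the sum of the absolute coefficients of [heat4], the largest among the four; K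
   ^ 4 dominates all powers of 1 / t that occur. *)
exists (10 * K ^+ 4 * C); first by rewrite mulr_ge0 // mulr_ge0.
move=> t y /[dup] tb /andP[bt tb']; have t0 : 0 < t by exact: lt_le_trans bt.
have z0 : 0 <= t^-1 by rewrite invr_ge0 ltW.
have zK : t^-1 <= K.
  by apply: (@le_trans _ _ b^-1); rewrite ?lef_pV2 ?posrE // lerDr.
have zn k : (k <= 4)%N -> `|t^-1| ^+ k <= K ^+ 4.
  move=> k4; apply: (@le_trans _ _ (K ^+ k)); last by rewrite ler_weXn2l.
  by rewrite ger0_norm // lerXn2r ?nnegrE //; lra.
set P := 1 + y ^+ 2 + y ^+ 4.
have y20 := sqr_ge0 y; have y40 : 0 <= y ^+ 4 by rewrite -[4%N]/(2 * 2)%N exprM sqr_ge0.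
have yn k : (k <= 4)%N -> `|y| ^+ k <= P.
  have y2 : y ^+ 2 = `|y| ^+ 2 by rewrite real_normK ?num_real.
  have y4 : y ^+ 4 = `|y| ^+ 4 by rewrite -[4%N]/(2 * 2)%N !exprM y2.
  have n0 := normr_ge0 y.
  case: k => [_|[_|[_|[_|[_|//]]]]]; rewrite /P ?y2 ?y4 ?expr0 ?expr1.
  - by have := sqr_ge0 `|y|; have : 0 <= `|y| ^+ 4 by []; lra.
  - by have := sqr_ge0 (`|y| - 1); have : 0 <= `|y| ^+ 4 by []; have := sqr_ge0 `|y|; lra.
  - have : 0 <= `|y| ^+ 4 by []; lra.
  - have h : 0 <= `|y| ^+ 2 * (`|y| - 1) ^+ 2 by rewrite mulr_ge0 ?sqr_ge0.
    have e2 := sqr_ge0 (`|y| - 1); have e3 := sqr_ge0 `|y|; lra.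
  - have := sqr_ge0 `|y|; lra.
have mono j k (c : R) : (j <= 4)%N -> (k <= 4)%N -> 0 <= c ->
    c * (`|y| ^+ j * `|t^-1| ^+ k) <= c * (P * K ^+ 4).
  by move=> j4 k4 c0; rewrite ler_wpM2l // ler_pM ?yn ?zn // exprn_ge0.
have fin q : `|q| <= 10 * (P * K ^+ 4) -> `|q * heat t y| <= 10 * K ^+ 4 * C.
  move=> hq; rewrite normrM (gtr0_norm (heat_gt0 t y)).
  apply: le_trans (_ : 10 * (P * K ^+ 4) * heat t y <= _).
    by rewrite ler_wpM2r // ltW // heat_gt0.
  rewrite (_ : 10 * (P * K ^+ 4) * heat t y = 10 * K ^+ 4 * (P * heat t y)); last by ring.
  by rewrite ler_wpM2l ?hC // mulr_ge0 // exprn_ge0 //; lra.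
have PK : 0 <= P * K ^+ 4.
  by rewrite mulr_ge0 ?exprn_ge0 //; rewrite /P; lra.
split; apply: fin.
- have := @mono 1%N 1%N 1 isT isT ler01; rewrite normrN normrM !expr1; lra.
- apply: le_trans (ler_normB _ _) _; rewrite !normrM.
  have := @mono 2%N 2%N 1 isT isT ler01; have := @mono 0%N 1%N 1 isT isT ler01.
  rewrite !expr2 expr0 expr1; lra.
- apply: le_trans (ler_normD _ _) _; rewrite normrN !normrM.
  have := @mono 3%N 3%N 1 isT isT ler01; have := @mono 1%N 2%N 3 isT isT (ler0n _ _).
  rewrite !exprS !expr0 (ger0_norm (ler0n _ 3)); lra.
- apply: le_trans (ler_normD _ _) _; apply: le_trans (lerD (ler_normB _ _) (lexx _)) _.
  rewrite !normrM.
  have := @mono 4%N 4%N 1 isT isT ler01; have := @mono 2%N 3%N 6 isT isT (ler0n _ _).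
  have := @mono 0%N 2%N 3 isT isT (ler0n _ _).
  rewrite !exprS !expr0 (ger0_norm (ler0n _ 3)) (ger0_norm (ler0n _ 6)); lra.
Qed.

(* The regularity of solutions of u_t = u_ss / 2 used by the swapping argument,
   with u1 = u_s and u2 = u_ss. *)
Definition heat_test (b b' : R) (u u1 u2 : R -> R -> R) (C : R) := [/\ 0 <= C,
  forall t s x, b <= t <= b' ->
    `|u t (s + x) - u t s - x * u1 t s - x ^+ 2 / 2 * u2 t s| <= C * `|x| ^+ 3,
  forall t t' s, b <= t <= b' -> b <= t' <= b' ->
    `|u t' s - u t s - (t' - t) / 2 * u2 t s| <= C * `|t' - t| ^+ 2,
  forall t t' s s', b <= t <= b' -> b <= t' <= b' ->
    `|u2 t' s' - u2 t s| <= C * (`|t' - t| + `|s' - s|) &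
  forall t s s', b <= t <= b' -> `|u2 t s| <= C /\ `|u t s' - u t s| <= C * `|s' - s|].

(** Third derivatives bound the variation of u_ss in space. Its variation in time is bounded by
    fourth derivatives, since the heat equation gives u_sst = u_ssss / 2. *)
Lemma heat_testP b b' a : 0 < b -> exists C, heat_test b b'
  (fun t s => heat t (s - a)) (fun t s => heat1 t (s - a))
  (fun t s => heat2 t (s - a)) C.
Proof.
move=> b0; have [C C0 hC] := heat_derivs_bound b' b0.
have n2 : `|2^-1| = 2^-1 :> R by rewrite gtr0_norm ?invr_gt0.
pose J (t : R) := True; pose I t := b <= t <= b'.
have JT r : J r by [].
have Jc x y z : J x -> J y -> x <= z <= y -> J z by [].
have Ic x y z : I x -> I y -> x <= z <= y -> I z.
  by move=> /andP[? ?] /andP[? ?] /andP[? ?]; apply/andP; split; lra.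
have Ib x y z : I x -> I y -> between x y z -> I z.
  by move=> Ix Iy [|]; [exact: Ic|exact: Ic].
have I0 t : I t -> 0 < t by move=> /andP[h _]; exact: lt_le_trans h.
have lip2 t s s' : I t -> `|heat2 t s' - heat2 t s| <= C * `|s' - s|.
  move=> It; apply: (@mvt_bound _ J Jc _ (heat3 t)) => // [r _|r _].
    exact: der_heat2.
  by have [] := hC t r It.
have lip2t t t' s : I t -> I t' -> `|heat2 t' s - heat2 t s| <= C * `|t' - t|.
  move=> It It'; apply: (@mvt_bound _ I Ic (heat2^~ s) (fun r => heat4 r s / 2)) => //.
    by move=> r Ir; apply: der_heat2_t; exact: I0.
  move=> r /(Ib _ _ _ It It') Ir; have [_ _ _] := hC r s Ir.
  rewrite /= (normrM (heat4 r s)) n2.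
  have := normr_ge0 (heat4 r s); lra.
exists C; split => //.
- move=> t s x It.
  have e1 : s - a + x - (s - a) = x by ring.
  have e2 : s + x - a = s - a + x by ring.
  have := @taylor2_bound _ J Jc (heat t) (heat1 t) (heat2 t) (s - a) (s - a + x) C
    (JT _) (JT _) C0 (fun r _ => der_heat t r) (fun r _ => der_heat1 t r)
    (fun r _ => lip2 t _ _ It).
  by rewrite e1 e2.
- move=> t t' s It It'.
  have := @taylor1_bound _ I Ic (heat^~ (s - a)) (fun r => heat2 r (s - a) / 2) t t' C
    It It' C0 (fun r Ir => der_heat_t _ (I0 r Ir)).
  rewrite (_ : (t' - t) * (_ / 2) = (t' - t) / 2 * heat2 t (s - a)); last by ring.
  apply => r rr; rewrite -mulrBl normrM n2.
  have Ir := Ib _ _ _ It It' rr.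
  have := lip2t t r (s - a) It Ir; have := normr_ge0 (heat2 r (s - a) - heat2 t (s - a)).
  lra.
- move=> t t' s s' It It'.
  rewrite (_ : _ - _ = (heat2 t' (s' - a) - heat2 t (s' - a)) +
    (heat2 t (s' - a) - heat2 t (s - a))); last by ring.
  apply: le_trans (ler_normD _ _) _; rewrite mulrDr lerD ?lip2t //.
  by apply: le_trans (lip2 _ _ _ It) _; rewrite opprB addrA subrK.
- move=> t s s' It; split; first by have [] := hC t (s - a) It.
  have := @mvt_bound _ J Jc (heat t) (heat1 t) (s - a) (s' - a) C (JT _) (JT _)
    (fun r _ => der_heat t r).
  rewrite opprB addrA subrK; apply => r _.
  by have [] := hC t r It.
Qed.

End heat_kernel.

(** * The central limit theorem for the averaging operator *)

Section clt_core.
Context {R : realType} {N : nat}.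
Variables (p : 'I_N -> R) (F : 'I_N -> R -> R).
Hypothesis hp : prob_weights p.
Hypothesis F01 : forall i x, in01 x -> in01 (F i x).
Hypothesis Fincr : forall i, incr01 (F i).
Hypothesis spl : splitting p F.

Local Notation U := (avg p F).

(* The chain of pairs (S_n, X_n), where S_n is the Birkhoff sum of phi. *)
Definition skew (phi : R -> R) (i : 'I_N) (z : R * R) : R * R :=
  (z.1 + phi (F i z.2), F i z.2).

Section martingale.
Variables (phi h kap W : R -> R) (sg2 Mw Bh Bu Bd Bk : R).
(** The martingale: the Birkhoff sum already contains phi at the current point, and phi + U h = h,
    so one step changes [m] by exactly [d]. *)
Let m (z : R * R) := z.1 + U h z.2.
Let d i x := h (F i x) - U h x.
Let D (z : R * R) := is_true (in01 z.2).
Local Notation T := (avg p (skew phi)).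

Hypotheses (sg0 : 0 <= sg2) (Bh0 : 0 <= Bh) (Bu0 : 0 <= Bu)
  (Bd0 : 0 <= Bd) (Bk0 : 0 <= Bk).
Hypothesis poisson_h : forall x, in01 x -> h x - U h x = phi x.
Hypothesis poisson_kap : forall x, in01 x ->
  kap x - U kap x = (\sum_(i < N) p i * d i x ^+ 2) - sg2.
Hypothesis W1 : forall x, in01 x -> 1 <= W x.
Hypothesis iterW : forall n x, in01 x -> iter n U W x <= Mw * W x.
Hypothesis hB : forall x, in01 x -> `|h x| <= Bh * W x /\ `|h x| ^+ 2 <= Bh * W x.
Hypothesis uB : forall x, in01 x -> `|U h x| <= Bu * W x /\ `|U h x| ^+ 2 <= Bu * W x.
Hypothesis dB : forall i x, in01 x -> `|d i x| ^+ 3 <= Bd * W x /\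
  `|d i x| * `|kap (F i x)| <= Bd * W x.
Hypothesis kB : forall x, in01 x -> `|kap x| <= Bk * W x.

Let skewD i z : D z -> D (skew phi i z).
Proof. exact: F01. Qed.

Let m_skew i z : D z -> m (skew phi i z) = m z + d i z.2.
Proof.
move=> Dz; rewrite /m /d /=.
have /= := poisson_h (skewD i Dz); rewrite /D /=; lra.
Qed.

Let sum_d x : \sum_(i < N) p i * d i x = 0.
Proof.
rewrite /d; under eq_bigr => i _ do rewrite mulrBr.
by rewrite sumrB -mulr_suml hp.2 mul1r subrr.
Qed.

Let iterT_snd (g : R -> R) n z : iter n T (fun z => g z.2) z = iter n U g z.2.
Proof.
elim: n z => //= n IH z; rewrite /avg; apply: eq_bigr => i _.
by rewrite IH.
Qed.

Section heat_step.
Variables (b b' C : R) (u u1 u2 : R -> R -> R).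
Hypothesis hu : heat_test b b' u u1 u2 C.

(* The second term compensates, via the Poisson equation of kap, for the
   fluctuation of the conditional variance of the martingale increments. *)
Let Theta (e t : R) (z : R * R) := u t (m z * e) + e ^+ 2 / 2 * (u2 t (m z * e) * kap z.2).

Let C1 := C * (2 * Bd + sg2 ^+ 2 + sg2 * Bk).

(** Terms of order e vanish because the increments are centred. At order e^2 the conditional
    variance, minus the sg2 coming from the time shift, equals kap - U kap and cancels against the
    change of the correction term. The remainders are the Taylor error [E1], the jump [E2] of u_ss,
    the heat equation error [E3] and the time shift [E4] of u_ss. *)
Lemma heat_one_step (e t : R) (z : R * R) : 0 <= e <= 1 -> b <= t <= b' ->
  b <= t + sg2 * e ^+ 2 <= b' -> D z ->
  `|T (Theta e t) z - Theta e (t + sg2 * e ^+ 2) z| <= C1 * e ^+ 3 * W z.2.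
Proof.
move=> /andP[e0 e1] tb tb' Dz; set t' := t + _.
have [C0 taylor heateq lip2 _] := hu.
set x := z.2; have hx : in01 x by [].
have Wx := W1 hx.
set M := m z * e.
pose E1 i := u t (M + d i x * e) - u t M - (d i x * e) * u1 t M
   - (d i x * e) ^+ 2 / 2 * u2 t M.
pose E2 i := (u2 t (M + d i x * e) - u2 t M) * kap (F i x).
pose E3 := u t' M - u t M - (t' - t) / 2 * u2 t M.
pose E4 := (u2 t' M - u2 t M) * kap x.
have decomp : T (Theta e t) z - Theta e t' z =
    \sum_(i < N) p i * E1 i + e ^+ 2 / 2 * (\sum_(i < N) p i * E2 i)
      - E3 - e ^+ 2 / 2 * E4.
  have -> : T (Theta e t) z = \sum_(i < N) p i * E1 i +
      e ^+ 2 / 2 * (\sum_(i < N) p i * E2 i) + u t M * \sum_(i < N) p i +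
      e * u1 t M * (\sum_(i < N) p i * d i x) +
      e ^+ 2 / 2 * u2 t M * (\sum_(i < N) p i * d i x ^+ 2) +
      e ^+ 2 / 2 * u2 t M * U kap x.
    rewrite /avg !mulr_sumr -!big_split /=; apply: eq_bigr => i _.
    rewrite /Theta m_skew // mulrDl -/M /= -/x /E1 /E2. ring.
  have := poisson_kap hx; rewrite sum_d hp.2 /Theta -/x -/M /E3 /E4.
  set S := \sum_(i < N) p i * d i x ^+ 2 => hk.
  have -> : S = kap x - U kap x + sg2 by lra.
  rewrite (_ : t' - t = sg2 * e ^+ 2); first ring.
  by rewrite /t' addrC addKr.
have b1 : `|\sum_(i < N) p i * E1 i| <= C * Bd * e ^+ 3 * W x.
  apply: le_trans (ler_norm_sum _ _ _) _.
  rewrite -[leRHS]mul1r -hp.2 mulr_suml; apply: ler_sum => i _.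
  rewrite normrM (ger0_norm (weight_ge0 hp i)) ler_wpM2l ?(weight_ge0 hp) //.
  apply: le_trans (taylor _ _ _ tb) _.
  rewrite normrM (ger0_norm e0) exprMn (_ : _ * W x = C * (Bd * W x * e ^+ 3)).
    rewrite ler_wpM2l // ler_wpM2r ?exprn_ge0 //; exact: (dB i hx).1.
  by ring.
have b2 : `|\sum_(i < N) p i * E2 i| <= C * Bd * e * W x.
  apply: le_trans (ler_norm_sum _ _ _) _.
  rewrite -[leRHS]mul1r -hp.2 mulr_suml; apply: ler_sum => i _.
  rewrite normrM (ger0_norm (weight_ge0 hp i)) ler_wpM2l ?(weight_ge0 hp) //.
  rewrite normrM; apply: le_trans (ler_wpM2r (normr_ge0 _) (lip2 _ _ _ _ tb tb)) _.
  rewrite subrr normr0 add0r (_ : M + _ - M = d i x * e); last by ring.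
  rewrite normrM (ger0_norm e0).
  by have := ler_wpM2l (mulr_ge0 C0 e0) (dB i hx).2; lra.
have t't : t' - t = sg2 * e ^+ 2 by rewrite /t' addrC addKr.
have se0 : 0 <= sg2 * e ^+ 2 by rewrite mulr_ge0 ?sqr_ge0.
have b3 : `|E3| <= C * sg2 ^+ 2 * e ^+ 3 * W x.
  apply: le_trans (heateq _ _ _ tb tb') _; rewrite t't (ger0_norm se0).
  rewrite (_ : C * _ = C * sg2 ^+ 2 * e ^+ 3 * e); last by ring.
  rewrite ler_wpM2l; [by []|by rewrite mulr_ge0 ?exprn_ge0 // mulr_ge0 ?sqr_ge0|].
  exact: le_trans e1 Wx.
have b4 : `|E4| <= C * sg2 * Bk * e ^+ 2 * W x.
  rewrite normrM; apply: le_trans (ler_wpM2r (normr_ge0 _) (lip2 _ _ _ _ tb tb')) _.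
  rewrite t't subrr normr0 addr0 (ger0_norm se0).
  rewrite (_ : C * sg2 * Bk * e ^+ 2 * W x = C * (sg2 * e ^+ 2) * (Bk * W x)); last by ring.
  by rewrite ler_wpM2l ?kB // mulr_ge0.
have e20 : 0 <= e ^+ 2 / 2 by rewrite divr_ge0 // sqr_ge0.
rewrite decomp.
apply: le_trans (_ : `|\sum_(i < N) p i * E1 i| + e ^+ 2 / 2 * `|\sum_(i < N) p i * E2 i|
    + `|E3| + e ^+ 2 / 2 * `|E4| <= _).
  apply: le_trans (ler_normB _ _) _; rewrite normrM (ger0_norm e20) lerD2r.
  apply: le_trans (ler_normB _ _) _; rewrite lerD2r.
  by apply: le_trans (ler_normD _ _) _; rewrite normrM (ger0_norm e20).
have h2 := ler_wpM2l e20 b2; have h4 := ler_wpM2l e20 b4.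
have W0 : 0 <= W x by lra.
have e30 : 0 <= e ^+ 3 by rewrite exprn_ge0.
have e43 : C * sg2 * Bk * W x * e ^+ 4 <= C * sg2 * Bk * W x * e ^+ 3.
  by rewrite ler_wpM2l ?mulr_ge0 // ler_wiXn2l.
have p1 : 0 <= C * sg2 * Bk * W x * e ^+ 3 by rewrite !mulr_ge0.
have p2 : 0 <= C * Bd * W x * e ^+ 3 by rewrite !mulr_ge0.
have q2 : e ^+ 2 / 2 * (C * Bd * e * W x) = C * Bd * W x * e ^+ 3 / 2 by ring.
have q4 : e ^+ 2 / 2 * (C * sg2 * Bk * e ^+ 2 * W x) = C * sg2 * Bk * W x * e ^+ 4 / 2.
  by ring.
rewrite q2 in h2; rewrite q4 in h4.
rewrite (_ : C1 * e ^+ 3 * W x = 2 * (C * Bd * W x * e ^+ 3) +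
  C * sg2 ^+ 2 * e ^+ 3 * W x + C * sg2 * Bk * W x * e ^+ 3); last by rewrite /C1; ring.
rewrite (_ : C * Bd * e ^+ 3 * W x = C * Bd * W x * e ^+ 3) in b1; last by ring.
lra.
Qed.

Let bound_sum e k (z : R * R) := C1 * e ^+ 3 * \sum_(j < k) iter j U W z.2.

(** [T] is positive and preserves constants, so earlier errors are averaged without being amplified,
    and the weights met along the orbit add up. *)
Lemma heat_iter (e : R) n k z : 0 <= e <= 1 -> n%:R * e ^+ 2 = 1 -> (k <= n)%N ->
  b + sg2 <= b' -> D z ->
  `|iter k T (Theta e b) z - Theta e (b + k%:R * (sg2 * e ^+ 2)) z| <= bound_sum e k z.
Proof.
move=> e01 ne kn bb'; have se0 : 0 <= sg2 * e ^+ 2 by rewrite mulr_ge0 ?sqr_ge0.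
have tk j : (j <= n)%N -> b <= b + j%:R * (sg2 * e ^+ 2) <= b'.
  move=> jn; have j0 : 0 <= j%:R * (sg2 * e ^+ 2) by rewrite mulr_ge0.
  have : j%:R * (sg2 * e ^+ 2) <= n%:R * (sg2 * e ^+ 2).
    by rewrite ler_wpM2r // ler_nat.
  rewrite (mulrCA n%:R) ne => ?; apply/andP; split; lra.
elim: k kn z => [|k IH] kn z Dz.
  by rewrite mul0r addr0 subrr normr0 /bound_sum big_ord0 mulr0.
set tk' := b + k.+1%:R * _; set t := b + k%:R * (sg2 * e ^+ 2) in IH.
rewrite /= (_ : _ - _ = T (fun z => iter k T (Theta e b) z - Theta e t z) z +
  (T (Theta e t) z - Theta e tk' z)); last first.
  by have /= -> := iter_avgB p (skew phi) 1 (iter k T (Theta e b)) (Theta e t); ring.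
apply: le_trans (ler_normD _ _) _.
have -> : bound_sum e k.+1 z = T (bound_sum e k) z + C1 * e ^+ 3 * W z.2.
  have /= := iter_avgZ p (skew phi) 1 (C1 * e ^+ 3) (fun z => \sum_(j < k) iter j U W z.2).
  move=> ->; rewrite /bound_sum -mulrDr; congr (_ * _).
  rewrite big_ord_recl /= addrC; congr (_ + _).
  rewrite /avg; under [RHS]eq_bigr => i _ do rewrite mulr_sumr.
  by rewrite exchange_big /=; apply: eq_bigr => j _.
apply: lerD.
  apply: (@iter_avg_norm _ _ _ hp _ _ D skewD 1) => // y Dy.
  by apply: IH => //; exact: ltnW.
have -> : tk' = t + sg2 * e ^+ 2 by rewrite /tk' /t -natr1; ring.
apply: heat_one_step => //; first by apply: tk; exact: ltnW.
by rewrite (_ : t + _ = tk') ?tk // /tk' /t -natr1; ring.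
Qed.

Let C2 := C * (Bh + Bu + Bk).

(** As n e^2 = 1, the n errors of order e^3 sum up to order e. Removing the coboundary and the
    correction term at both ends costs order e as well. *)
Lemma heat_clt (e : R) n x : 0 <= e <= 1 -> n%:R * e ^+ 2 = 1 ->
  b + sg2 <= b' -> in01 x ->
  `|iter n T (fun z => u b (z.1 * e)) (phi x, x) - u (b + sg2) 0| <=
    (C1 * Mw + C2 * (Mw + 1)) * W x * e.
Proof.
move=> e01 ne bb' hx; have /andP[e0 e1] := e01.
have [C0 _ _ _ lip] := hu.
set z := (phi x, x); have Dz : D z by [].
have tb : b <= b <= b' by rewrite lexx; apply: le_trans bb'; rewrite lerDl.
have tb' : b <= b + sg2 <= b' by rewrite lerDl sg0.
have e2e : e ^+ 2 <= e by rewrite expr2 ler_piMr.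
(* Used at the final time with g = U h, to pass from the martingale to the Birkhoff sum, and at the
   starting point with g = h, to move the argument to 0. *)
have corr (t y g : R) : b <= t <= b' -> in01 y -> `|g| <= (Bh + Bu) * W y ->
    forall s s', `|s' - s| <= `|g| * e ->
    `|u t s' + e ^+ 2 / 2 * (u2 t s' * kap y) - u t s| <= C2 * e * W y.
  move=> tt hy hg s s' ss'.
  have [_ l1] := lip t s s' tt; have [l2 _] := lip t s' s tt.
  have Wy := W1 hy.
  rewrite addrAC; apply: le_trans (ler_normD _ _) _.
  have b1 : `|u t s' - u t s| <= C * ((Bh + Bu) * W y * e).
    apply: le_trans l1 _; rewrite ler_wpM2l //; apply: le_trans ss' _.
    by rewrite ler_wpM2r.
  have b2 : `|e ^+ 2 / 2 * (u2 t s' * kap y)| <= e * (C * (Bk * W y)).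
    have e20 : 0 <= e ^+ 2 / 2 by rewrite divr_ge0 ?sqr_ge0.
    rewrite normrM (ger0_norm e20); apply: ler_pM => //; first lra.
    by rewrite normrM; apply: ler_pM => //; exact: kB.
  by rewrite /C2; lra.
have s1 : `|iter n T (Theta e b) z - iter n T (fun z => u b (z.1 * e)) z| <=
    C2 * e * (Mw * W x).
  rewrite -[X in `|X|](congr1 (fun k => k z) (iter_avgB p (skew phi) n _ _)).
  apply: le_trans (_ : iter n T (fun z => C2 * e * W z.2) z <= _).
    apply: (iter_avg_norm hp skewD) => // y Dy.
    apply: (corr b y.2 (U h y.2) tb Dy).
      by apply: le_trans (uB Dy).1 _; rewrite ler_wpM2r ?lerDr //; have := W1 Dy; lra.
    by rewrite -mulrBl /m addrC addKr normrM (ger0_norm e0).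
  rewrite (iter_avgZ p (skew phi) n (C2 * e) (fun z => W z.2)).
  rewrite (iterT_snd W) ler_wpM2l ?iterW //.
  by rewrite !mulr_ge0 // !addr_ge0.
have s2 := heat_iter e01 ne (leqnn n) bb' Dz.
have s3 : `|Theta e (b + sg2) z - u (b + sg2) 0| <= C2 * e * W x.
  have mz : m z = h x by rewrite /m /=; have := poisson_h hx; lra.
  rewrite /Theta mz; apply: (corr _ x (h x)) => //.
    by apply: le_trans (hB hx).1 _; rewrite ler_wpM2r ?lerDl //; have := W1 hx; lra.
  by rewrite subr0 normrM (ger0_norm e0).
have s4 : bound_sum e n z <= C1 * e * (Mw * W x).
  rewrite /bound_sum (_ : C1 * e * _ = C1 * e ^+ 3 * (n%:R * (Mw * W x))); last first.
    rewrite (_ : C1 * e ^+ 3 * _ = C1 * e * (Mw * W x) * (n%:R * e ^+ 2)).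
      by rewrite ne mulr1.
    by ring.
  rewrite ler_wpM2l //.
    by rewrite /C1 !mulr_ge0 ?exprn_ge0 // !addr_ge0 ?mulr_ge0 ?sqr_ge0.
  have -> : n%:R * (Mw * W x) = \sum_(j < n) (Mw * W x).
    by rewrite sumr_const card_ord mulr_natl.
  by apply: ler_sum => j _; exact: iterW.
rewrite (mulrCA n%:R) ne mulr1 in s2.
rewrite (_ : (C1 * Mw + C2 * (Mw + 1)) * W x * e = C2 * e * (Mw * W x) +
  C1 * e * (Mw * W x) + C2 * e * W x); last by ring.
rewrite (_ : iter n T (fun z => u b (z.1 * e)) z - _ =
  - (iter n T (Theta e b) z - iter n T (fun z => u b (z.1 * e)) z) +
  (iter n T (Theta e b) z - Theta e (b + sg2) z) +
  (Theta e (b + sg2) z - u (b + sg2) 0)); last by ring.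
apply: le_trans (ler_normD _ _) _; apply: lerD => //.
apply: le_trans (ler_normD _ _) _; apply: lerD; first by rewrite normrN.
exact: le_trans s2 s4.
Qed.

End heat_step.

(** The square is unbounded and has to be treated directly: m^2 + kap grows in mean by exactly sg2
    per step. The cross term between [m] and the coboundary is split with weight e into e m^2 and a
    multiple of W / e, both of order e after multiplication by e^2. *)
Lemma second_moment (e : R) n x : 0 < e <= 1 -> n%:R * e ^+ 2 = 1 -> in01 x ->
  `|iter n T (fun z => (z.1 * e) ^+ 2) (phi x, x) - sg2| <=
    (2 * (Bh + Bk + sg2) + (2 * Bu + 2 * Bk) * Mw) * W x * e.
Proof.
move=> /andP[e0 e1] ne hx; set z := (phi x, x); have Dz : D z by [].
pose Q (z : R * R) := m z ^+ 2 + kap z.2.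
have TQ y : D y -> T Q y = Q y + sg2.
  move=> Dy.
  have -> : T Q y = m y ^+ 2 * (\sum_(i < N) p i) +
      2 * m y * (\sum_(i < N) p i * d i y.2) +
      (\sum_(i < N) p i * d i y.2 ^+ 2) + U kap y.2.
    rewrite /avg !mulr_sumr -!big_split /=; apply: eq_bigr => i _.
    by rewrite /Q m_skew // ; ring.
  by rewrite sum_d hp.2 /Q; have := poisson_kap Dy; lra.
have iterQ k y : D y -> iter k T Q y = Q y + k%:R * sg2.
  elim: k y => [|k IH] y Dy; first by rewrite mul0r addr0.
  rewrite iterSr (iter_avg_eq p skewD k TQ) // (iter_avgD p (skew phi) k Q (fun=> sg2)).
  by rewrite (iter_avg_cst hp) IH // -natr1; ring.
have mz : m z = h x by rewrite /m /=; have := poisson_h hx; lra.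
have Qz : `|Q z| <= (Bh + Bk) * W x.
  rewrite /Q mz; apply: le_trans (ler_normD _ _) _; rewrite mulrDl lerD ?kB //.
  by rewrite normrX; exact: (hB hx).2.
have W0 y : in01 y -> 0 <= W y by move=> hy; apply: le_trans (W1 hy).
have step y : D y -> `|y.1 ^+ 2 - Q y| <= e * Q y + (2 * Bu + 2 * Bk) / e * W y.2.
  move=> Dy; have [_ u2] := uB Dy; have k1 := kB Dy; have Wy := W0 _ Dy.
  rewrite /Q; set M := m y; set v := U h y.2 in u2.
  have -> : y.1 = M - v by rewrite /M /m addrK.
  rewrite (_ : (M - v) ^+ 2 - (M ^+ 2 + kap y.2) = v ^+ 2 - 2 * (M * v) - kap y.2); last by ring.
  rewrite real_normK ?num_real // in u2.
  have ei : 1 <= e^-1 by rewrite invf_ge1.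
  have eV : e * e^-1 = 1 by rewrite divff // gt_eqF.
  (* AM-GM: 2 |M v| <= e M^2 + v^2 / e *)
  have am : 2 * `|M * v| <= e * M ^+ 2 + e^-1 * v ^+ 2.
    have ei0 : 0 <= e^-1 by lra.
    have h1 : 0 <= e^-1 * (e * M - v) ^+ 2 by rewrite mulr_ge0 ?sqr_ge0.
    have h2 : 0 <= e^-1 * (e * M + v) ^+ 2 by rewrite mulr_ge0 ?sqr_ge0.
    rewrite (_ : e^-1 * _ = e * M ^+ 2 * (e * e^-1) - 2 * (M * v) * (e * e^-1)
      + e^-1 * v ^+ 2) in h1; last by ring.
    rewrite (_ : e^-1 * _ = e * M ^+ 2 * (e * e^-1) + 2 * (M * v) * (e * e^-1)
      + e^-1 * v ^+ 2) in h2; last by ring.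
    rewrite eV !mulr1 in h1 h2.
    by have [c0|c0] := leP 0 (M * v); [rewrite ger0_norm|rewrite ltr0_norm]; lra.
  apply: le_trans (ler_normB _ _) _.
  have := ler_normB (v ^+ 2) (2 * (M * v)).
  rewrite (normrM 2) (ger0_norm (sqr_ge0 v)) (ger0_norm (ler0n _ 2)) => h3.
  have v0 := sqr_ge0 v.
  have ev : v ^+ 2 <= Bu * W y.2 / e.
    by apply: le_trans u2 _; rewrite ler_peMr // mulr_ge0.
  have ev' : e^-1 * v ^+ 2 <= Bu * W y.2 / e.
    by rewrite mulrC ler_wpM2r //; lra.
  have ek : `|kap y.2| <= Bk * W y.2 / e.
    by apply: le_trans k1 _; rewrite ler_peMr // mulr_ge0.
  have ek' : - e * kap y.2 <= Bk * W y.2 / e.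
    apply: le_trans ek; apply: le_trans (ler_norm _) _.
    by rewrite normrM normrN (gtr0_norm e0) ler_piMl.
  have -> : (2 * Bu + 2 * Bk) / e * W y.2 = 2 * (Bu * W y.2 / e) + 2 * (Bk * W y.2 / e).
    by ring.
  lra.
have s1 : `|iter n T (fun y => y.1 ^+ 2) z - iter n T Q z| <=
    e * iter n T Q z + (2 * Bu + 2 * Bk) / e * (Mw * W x).
  rewrite -[X in `|X|](congr1 (fun k => k z) (iter_avgB p (skew phi) n _ _)).
  apply: le_trans (iter_avg_norm hp skewD n step Dz) _.
  rewrite (iter_avg_lin p (skew phi) n e _ Q (fun y => W y.2)) lerD2l (iterT_snd W).
  by rewrite ler_wpM2l ?iterW // divr_ge0 ?(ltW e0) // addr_ge0 // mulr_ge0.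
rewrite [X in `|X - _|](_ : _ = e ^+ 2 * iter n T (fun y => y.1 ^+ 2) z); last first.
  rewrite -[RHS](congr1 (fun k => k z) (iter_avgZ p (skew phi) n (e ^+ 2) _)).
  by congr (iter n T _ z); apply/funext => y; ring.
rewrite iterQ // in s1.
set S := iter n T _ z in s1 *.
have e20 := sqr_ge0 e.
have e2n : e ^+ 2 * (n%:R * sg2) = sg2 by rewrite mulrA [e ^+ 2 * _]mulrC ne mul1r.
have s2 : `|e ^+ 2 * S - (e ^+ 2 * Q z + sg2)| <=
    e * (e ^+ 2 * Q z + sg2) + (2 * Bu + 2 * Bk) * Mw * W x * e.
  rewrite (_ : _ - _ = e ^+ 2 * (S - (Q z + n%:R * sg2))); last first.
    transitivity (e ^+ 2 * S - (e ^+ 2 * Q z + e ^+ 2 * (n%:R * sg2))); last by ring.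
    by rewrite e2n.
  rewrite normrM (ger0_norm e20); apply: le_trans (ler_wpM2l e20 s1) _.
  have -> : e ^+ 2 * (e * (Q z + n%:R * sg2) + (2 * Bu + 2 * Bk) / e * (Mw * W x)) =
      e * (e ^+ 2 * Q z + e ^+ 2 * (n%:R * sg2)) +
      (2 * Bu + 2 * Bk) * Mw * W x * e * (e / e) by ring.
  by rewrite divff ?gt_eqF // mulr1 e2n.
have Wx := W1 hx.
have BW : 0 <= (Bh + Bk) * W x by rewrite mulr_ge0 ?W0 // addr_ge0.
have e2Q : `|e ^+ 2 * Q z| <= (Bh + Bk) * W x * e.
  rewrite normrM (ger0_norm e20) mulrC; apply: ler_pM => //.
  by rewrite expr2 ler_piMr // ltW.
have sW : e * sg2 <= sg2 * W x * e.
  by rewrite mulrC ler_wpM2r ?(ltW e0) // ler_peMr.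
have eQ : e * (e ^+ 2 * Q z) <= (Bh + Bk) * W x * e.
  apply: le_trans (ler_norm _) _; rewrite normrM (gtr0_norm e0).
  by apply: le_trans e2Q; rewrite ler_piMl.
rewrite (_ : _ - sg2 = (e ^+ 2 * S - (e ^+ 2 * Q z + sg2)) + e ^+ 2 * Q z); last by ring.
apply: le_trans (ler_normD _ _) _.
have s0 : 0 <= sg2 * W x * e by rewrite !mulr_ge0 ?W0 // ltW.
lra.
Qed.

End martingale.
End clt_core.

Section clt_finite.
Context {R : realType} {N : nat}.
Variables (p : 'I_N -> R) (F : 'I_N -> R -> R).
Hypothesis hp : prob_weights p.
Hypothesis F01 : forall i x, in01 x -> in01 (F i x).
Hypothesis Fincr : forall i, incr01 (F i).
Hypothesis spl : splitting p F.

Local Notation U := (avg p F).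

Let bvar_weaken (V V' g : R -> R) : (forall x, in01 x -> 0 <= V x <= V' x) ->
  bvar V g -> bvar V' g.
Proof.
move=> VV' [g1 [g2 [B [i1 i2 b e]]]]; exists g1, g2, `|B|; split => // x hx.
have [b1 b2] := b x hx; have /andP[V0 hV] := VV' x hx.
have BV : B * V x <= `|B| * V' x.
  apply: le_trans (ler_wpM2r V0 (ler_norm B)) _; exact: ler_wpM2l.
by split; [exact: le_trans b1 BV|exact: le_trans b2 BV].
Qed.

(** All weights being positive, growth in the mean bounds every single branch. The increments [d]
    need such a pointwise bound. *)
Let uniform_growth (V : R -> R) : lyapunov p F V -> exists2 M, 0 <= M &
  forall i x, in01 x -> V (F i x) <= M * V x.
Proof.
move=> lV; have [M M0 hM] := lyapunov_growth lV; have [V1 _ _] := lV.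
have V0 x : in01 x -> 0 <= V x by move=> hx; apply: le_trans (V1 x hx).
exists (\sum_i M / p i).
  by apply: sumr_ge0 => i _; rewrite divr_ge0 // (weight_ge0 hp).
move=> i x hx; apply: (@le_trans _ _ (M / p i * V x)).
  rewrite mulrAC ler_pdivlMr ?hp.1 // mulrC; apply: le_trans (hM x hx).
  exact: (weight_avg_le hp F01).
rewrite ler_wpM2r ?V0 // (bigD1 i) //= lerDl; apply: sumr_ge0 => j _.
by rewrite divr_ge0 // (weight_ge0 hp).
Qed.

(** With A = W^(1/4) one has h = O(A), conditional variance and kap = O(A^2), so d^3 and d kap are
    O(A^3), within W. *)
Theorem clt_finite (W phi : R -> R) : lyapunov p F W -> bvar (fun=> 1) phi ->
  (forall x, in01 x -> iter n U phi x @[n --> \oo] --> (0 : R)) ->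
  exists2 sg2 : R, 0 <= sg2 &
    (forall a b, 0 < b -> exists C, forall n x, (0 < n)%N -> in01 x ->
      `|iter n (avg p (skew F phi)) (fun z => heat b (z.1 / Num.sqrt n%:R - a)) (phi x, x)
        - heat (b + sg2) (0 - a)| <= C * W x / Num.sqrt n%:R) /\
    (exists C, forall n x, (0 < n)%N -> in01 x ->
      `|iter n (avg p (skew F phi)) (fun z => (z.1 / Num.sqrt n%:R) ^+ 2) (phi x, x)
        - sg2| <= C * W x / Num.sqrt n%:R).
Proof.
move=> lW bphi phi0; have [W1 cW [gam [K [hg K0 dW]]]] := lW.
have W0 x : in01 x -> 0 <= W x by move=> hx; apply: le_trans (W1 x hx).
pose A2 x := Num.sqrt (W x); pose A x := Num.sqrt (A2 x).
have lA2 : lyapunov p F A2 by exact: lyapunov_sqrt.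
have lA : lyapunov p F A by exact: lyapunov_sqrt.
have [A21 _ _] := lA2; have [A1 _ _] := lA.
have A0 x : 0 <= A x by exact: sqrtr_ge0.
have AA : (fun x => A x ^+ 2) = A2.
  by apply/funext => x; rewrite sqr_sqrtr // sqrtr_ge0.
have AAx x : A x ^+ 2 = A2 x by rewrite -AA.
have A4 x : in01 x -> A x ^+ 4 = W x.
  by move=> hx; rewrite -[4%N]/(2 * 2)%N exprM AAx sqr_sqrtr // W0.
have AW k x : in01 x -> (k <= 4)%N -> A x ^+ k <= W x.
  by move=> hx k4; rewrite -A4 // ler_weXn2l // A1.
have bphiA : bvar A phi.
  by apply: bvar_weaken bphi => x hx; rewrite ler01 A1.
have [c [h [bh eh lh]]] := poisson_equation hp F01 Fincr spl lA bphiA.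
have c0 : c = 0.
  have half01 : in01 (1 / 2 : R) by apply/andP; split; lra.
  exact: (@cvg_unique _ (@Rhausdorff R) _ _ _ _ (lh _ half01) (phi0 _ half01)).
have {}eh x : in01 x -> h x - U h x = phi x by move=> hx; rewrite eh // c0 subr0.
(* The conditional variance as U (h^2) - (U h)^2, the form in which it is seen to be a difference of
   increasing functions; [rE] gives the sum of squares, from which its sign is read. *)
pose r x := U (fun y => h y * h y) x - U h x * U h x.
have bUh : bvar A (U h) by exact: bvar_avg.
have br : bvar A2 r.
  apply: bvarB; last by rewrite -AA; exact: bvarM.
  by apply: bvar_avg => //; rewrite -AA; exact: bvarM.
have rE x : r x = \sum_(i < N) p i * (h (F i x) - U h x) ^+ 2.
  have key v : \sum_(i < N) p i * (h (F i x) - v) ^+ 2 =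
      U (fun y => h y * h y) x - 2 * v * U h x + v ^+ 2 * \sum_(i < N) p i.
    rewrite /avg !mulr_sumr -sumrB -big_split /=.
    by apply: eq_bigr => i _; ring.
  by rewrite key hp.2 /r; ring.
have [sg2 [kap [bkap ekap lkap]]] := poisson_equation hp F01 Fincr spl lA2 br.
have sg0 : 0 <= sg2.
  have half01 : in01 (1 / 2 : R) by apply/andP; split; lra.
  apply: (@cvgr_to_ge _ _ _ _ _ _ 0 (lkap _ half01)); near=> n.
  apply: (iter_avg_ge0 hp F01) => // x hx; rewrite rE; apply: sumr_ge0 => i _.
  by rewrite mulr_ge0 ?sqr_ge0 // (weight_ge0 hp).
have [M M0 hM] := uniform_growth lA.
have [H H0 hH] := bvar_bound (fun x _ => A0 x) bh.
have [H' H'0 hH'] := bvar_bound (fun x _ => A0 x) bUh.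
have [k k0 hk] := bvar_bound (fun x _ => sqrtr_ge0 (W x)) bkap.
pose Dd := H * M + H'.
have Dd0 : 0 <= Dd by rewrite addr_ge0 // mulr_ge0.
have dA i x : in01 x -> `|h (F i x) - U h x| <= Dd * A x.
  move=> hx; apply: le_trans (ler_normB _ _) _; rewrite mulrDl lerD ?hH' //.
  apply: le_trans (hH _ (F01 i hx)) _; rewrite -mulrA ler_wpM2l //; exact: hM.
have lin (B : R) (g : R -> R) : 0 <= B -> (forall x, in01 x -> `|g x| <= B * A x) ->
    forall x, in01 x -> `|g x| <= (B + B ^+ 2) * W x /\ `|g x| ^+ 2 <= (B + B ^+ 2) * W x.
  move=> B0 hB x hx; have b1 := hB x hx; rewrite mulrDl; split.
    apply: le_trans b1 _; apply: (@le_trans _ _ (B * W x)).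
      by rewrite ler_wpM2l // -[leLHS]expr1 AW.
    by rewrite lerDl mulr_ge0 ?sqr_ge0 // W0.
  apply: (@le_trans _ _ (B ^+ 2 * W x)); last by rewrite lerDr mulr_ge0 // W0.
  apply: (@le_trans _ _ ((B * A x) ^+ 2)).
    by rewrite lerXn2r ?nnegrE ?mulr_ge0.
  by rewrite exprMn ler_wpM2l ?sqr_ge0 // AW.
pose Mw := 1 + K / (1 - gam).
have g1' : 0 < 1 - gam by rewrite subr_gt0; case/andP: hg.
have iterW n x : in01 x -> iter n U W x <= Mw * W x.
  move=> hx; apply: le_trans (iter_drift hp F01 n hg K0 dW hx) _.
  rewrite /Mw mulrDl; apply: lerD.
    rewrite ler_wpM2r ?W0 //; case/andP: hg => g0 g1.
    by rewrite exprn_ile1 // ltW.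
  by rewrite ler_peMr ?W1 // divr_ge0 // ltW.
pose Bd := Dd ^+ 3 + Dd * k * M ^+ 2.
have Bd0 : 0 <= Bd by rewrite addr_ge0 ?exprn_ge0 // !mulr_ge0 // exprn_ge0.
have dB i x : in01 x -> `|h (F i x) - U h x| ^+ 3 <= Bd * W x /\
    `|h (F i x) - U h x| * `|kap (F i x)| <= Bd * W x.
  move=> hx; have b1 := dA i x hx; rewrite /Bd mulrDl; split.
    apply: (@le_trans _ _ (Dd ^+ 3 * W x)); last first.
      by rewrite lerDl mulr_ge0 ?W0 // !mulr_ge0 // exprn_ge0.
    apply: (@le_trans _ _ ((Dd * A x) ^+ 3)).
      by rewrite lerXn2r ?nnegrE ?mulr_ge0.
    by rewrite exprMn ler_wpM2l ?exprn_ge0 // AW.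
  apply: (@le_trans _ _ (Dd * k * M ^+ 2 * W x)); last first.
    by rewrite lerDr mulr_ge0 ?W0 // exprn_ge0.
  have b2 : `|kap (F i x)| <= k * (M * A x) ^+ 2.
    apply: le_trans (hk _ (F01 i hx)) _; rewrite ler_wpM2l // -[Num.sqrt _]AAx.
    by rewrite lerXn2r ?nnegrE ?mulr_ge0 // hM.
  apply: (@le_trans _ _ (Dd * A x * (k * (M * A x) ^+ 2))).
    by apply: ler_pM.
  rewrite (_ : _ * _ = Dd * k * M ^+ 2 * A x ^+ 3); last by ring.
  by rewrite ler_wpM2l ?AW // !mulr_ge0 // exprn_ge0.
have kB x : in01 x -> `|kap x| <= k * W x.
  move=> hx; apply: le_trans (hk x hx) _; rewrite ler_wpM2l // -[Num.sqrt _]AAx.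
  exact: AW.
have ekap' x : in01 x -> kap x - U kap x =
    \sum_(i < N) p i * (h (F i x) - U h x) ^+ 2 - sg2.
  by move=> hx; rewrite ekap // rE.
have sqrtn n : (0 < n)%N -> 0 < (Num.sqrt (n%:R : R))^-1 <= 1 /\
    n%:R * (Num.sqrt (n%:R : R))^-1 ^+ 2 = 1.
  move=> n0; have n1 : 1 <= n%:R :> R by rewrite ler1n.
  split; first by rewrite invr_gt0 sqrtr_gt0 ltr0n n0 /= invf_le1 ?sqrtr_gt0 ?ltr0n //
    -[leLHS]sqrtr1 ler_sqrt // (le_trans ler01).
  by rewrite exprVn sqr_sqrtr ?ler0n // divff // pnatr_eq0 -lt0n.
have [hHW H'HW] := (lin H h H0 hH, lin H' (U h) H'0 hH').
have HH0 : 0 <= H + H ^+ 2 by rewrite addr_ge0 // sqr_ge0.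
have H'H0 : 0 <= H' + H' ^+ 2 by rewrite addr_ge0 // sqr_ge0.
exists sg2 => //; split.
  move=> a b b0; have [C hC] := heat_testP (b + sg2) a b0.
  eexists => n x n0 hx; have [/andP[/ltW e0 e1] ne] := sqrtn n n0.
  have e01 : 0 <= (Num.sqrt (n%:R : R))^-1 <= 1 by rewrite e0.
  exact: (heat_clt hp F01 sg0 HH0 H'H0 Bd0 k0 eh ekap' W1 iterW hHW H'HW dB kB
    hC e01 ne (lexx _) hx).
eexists => n x n0 hx; have [e01 ne] := sqrtn n n0.
exact: (second_moment hp F01 sg0 HH0 H'H0 k0 eh ekap' W1 iterW hHW H'HW kB
    e01 ne hx).
Unshelve. all: by end_near. Qed.

End clt_finite.

(** * Gaussian test functions determine weak limits *)

Section gaussian_integrals.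
Context {R : realType}.
Local Notation mu := (@lebesgue_measure R).

Lemma continuous_heat (b a : R) : continuous (fun y : R => heat b (y - a)).
Proof.
move=> y; apply: continuous_comp; last exact: der_continuous (der_heat _ _).
by apply: cvgB; [exact: cvg_id|exact: cvg_cst].
Qed.

Lemma measurable_heat (b a : R) : measurable_fun setT (fun y : R => heat b (y - a)).
Proof. by apply: continuous_measurable_fun; exact: continuous_heat. Qed.

Lemma heat_le (b y : R) : 0 < b -> heat b y <= heat b 0.
Proof.
move=> b0; rewrite ler_expR lerD2r lerN2 !mul0r.
by rewrite -expr2 divr_ge0 // divr_ge0 ?sqr_ge0 // ltW.
Qed.

Lemma heatC (b y z : R) : heat b (y - z) = heat b (z - y).
Proof. by rewrite -(opprB z y) /heat mulrNN. Qed.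

(** The integral of [heat b], the same for every b > 0. *)
Definition heat_mass : R := Num.sqrt (pi *+ 2).

Lemma heat_mass_gt0 : 0 < heat_mass.
Proof. by rewrite sqrtr_gt0 mulrn_wgt0 // pi_gt0. Qed.

Lemma heat_normal_pdf (b a y : R) : 0 < b ->
  heat b (y - a) = heat_mass * normal_pdf a (Num.sqrt b) y.
Proof.
move=> b0; have sb0 : Num.sqrt b != 0 by rewrite gt_eqF ?sqrtr_gt0.
rewrite normal_pdfE // /normal_peak /normal_fun sqr_sqrtr ?(ltW b0) //.
rewrite mulrA -mulrnAr sqrtrM ?(ltW b0) // invfM mulrCA mulfV ?gt_eqF ?heat_mass_gt0 //.
rewrite mulr1 /heat expRD mulrC; congr (_ * _); last first.
  by congr expR; rewrite mulr2n expr2; field; rewrite gt_eqF.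
rewrite expRN; congr (_^-1); have e0 := expR_ge0 (ln b / 2).
have e2 : expR (ln b / 2) ^+ 2 = b by rewrite expr2 -expRD -splitr lnK.
by rewrite -{2}e2 sqrtr_sqr ger0_norm.
Qed.

Lemma integral_heat (b y : R) : 0 < b ->
  (\int[mu]_x (heat b (x - y))%:E = heat_mass%:E)%E.
Proof.
move=> b0; under eq_integral do rewrite heat_normal_pdf // EFinM.
rewrite ge0_integralZl_EFin //.
- by rewrite integral_normal_pdf mule1.
- by move=> x _; rewrite lee_fin normal_pdf_ge0.
- by apply/measurable_EFinP; exact: measurable_normal_pdf.
- by apply/ltW; exact: heat_mass_gt0.
Qed.

(** Change of measure through the Radon-Nikodym derivative, which agrees with the density almost
    everywhere because both have the same integral over every measurable set. *)
Lemma integral_normal_prob (s : R) (f : R -> R) : s != 0 ->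
  measurable_fun setT f -> [bounded f x | x in [set: R]] ->
  (\int[normal_prob 0 s]_x (f x)%:E = \int[mu]_x (f x * normal_pdf 0 s x)%:E)%E.
Proof.
move=> s0 mf bf.
have dom := normal_prob_dominates 0 s.
rewrite -(Radon_Nikodym_change_of_variables dom) //=; last first.
  apply: measurable_bounded_integrable => //.
  by rewrite -ge0_fin_numE // fin_num_measure.
under [RHS]eq_integral do rewrite EFinM.
have mN : measurable_fun setT (fun x => (normal_pdf 0 s x)%:E).
  by apply/measurable_EFinP; exact: measurable_normal_pdf.
apply: ae_eq_integral => //.
- apply: emeasurable_funM; first exact/measurable_EFinP.
  by apply: (measurable_int mu); apply: Radon_Nikodym_integrable.
- by apply: emeasurable_funM => //; exact/measurable_EFinP.
- apply: ae_eqe_mul2l => /=.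
  rewrite Radon_NikodymE //=.
  case: cid => /= h [h1 h2 h3].
  by apply: integral_ae_eq => // E _ mE; rewrite -h3.
Qed.

(* Completing the square in the product of two Gaussian densities. *)
Lemma heatM (b c a y : R) : 0 < b -> 0 < c ->
  heat b (y - a) * heat c (y - 0) =
  heat (b + c) (0 - a) * heat (b * c / (b + c)) (y - a * c / (b + c)).
Proof.
move=> b0 c0; have bc0 : 0 < b + c by rewrite addr_gt0.
rewrite /heat -!expRD; congr expR.
have -> : ln (b * c / (b + c)) = ln b + ln c - ln (b + c).
  by rewrite ln_div ?posrE ?mulr_gt0 // lnM ?posrE.
by field; rewrite !gt_eqF.
Qed.

(** Variances add under convolution; at 0 this is the value that the swapping argument reaches at
    time b + sg2. The Dirac mass fits the same formula. *)
Lemma integral_centred_normal_heat (b s a : R) : 0 < b ->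
  (\int[centred_normal s]_y (heat b (y - a))%:E = (heat (b + s ^+ 2) (0 - a))%:E)%E.
Proof.
move=> b0; rewrite /centred_normal; case: eqP => [->|/eqP s0].
  rewrite integral_dirac //; last by apply/measurable_EFinP; exact: measurable_heat.
  by rewrite diracE mem_set // mul1e expr0n addr0.
have s20 : 0 < s ^+ 2 by rewrite exprn_even_gt0.
have bh : [bounded heat b (y - a) | y in [set: R]].
  exists (heat b 0); split; first exact: num_real.
  move=> M hM y _ /=; rewrite gtr0_norm ?heat_gt0 //.
  exact: le_trans (heat_le _ b0) (ltW hM).
have mid : measurable_fun setT (id : measurableTypeR R -> R) by exact: measurable_id.
have mh : measurable_fun setT (fun y : R => (heat b (y - a))%:E).
  by apply/measurable_EFinP; exact: measurable_heat.
(* The law is given on measurableTypeR R, whose display differs from that of R. *)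
transitivity (\int[pushforward (normal_prob 0 s) (id : measurableTypeR R -> R)]_y
    (heat b (y - a))%:E)%E; first by [].
rewrite (ge0_integral_pushforward mid) //; last first.
  by move=> y _; rewrite lee_fin ltW // heat_gt0.
etransitivity; first exact: (integral_normal_prob s0 (measurable_heat b a) bh).
have bs0 : 0 < b * s ^+ 2 / (b + s ^+ 2).
  by apply: divr_gt0; [exact: mulr_gt0|exact: addr_gt0].
have m0 := heat_mass_gt0.
set C := heat (b + s ^+ 2) (0 - a) / heat_mass.
have C0 : 0 <= C by rewrite divr_ge0 ?ltW // heat_gt0.
have key y : heat b (y - a) * normal_pdf 0 s y =
    C * heat (b * s ^+ 2 / (b + s ^+ 2)) (y - a * s ^+ 2 / (b + s ^+ 2)).
  have -> : normal_pdf 0 s y = heat (s ^+ 2) (y - 0) / heat_mass.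
    rewrite heat_normal_pdf // mulrAC mulfV ?gt_eqF // mul1r.
    by rewrite sqrtr_sqr !normal_pdfE ?normr_eq0 // /normal_peak /normal_fun real_normK ?num_real.
  by rewrite mulrA heatM // /C [RHS]mulrAC.
under eq_integral do rewrite key EFinM.
rewrite ge0_integralZl_EFin //.
- by rewrite integral_heat // -EFinM /C divfK // gt_eqF.
- by move=> y _; rewrite lee_fin ltW // heat_gt0.
- by apply/measurable_EFinP; exact: measurable_heat.
Qed.

(* Away from the diagonal the kernel is an exponentially small multiple of the
   kernel of twice the variance. *)
Lemma heat_tail (b d z : R) : 0 < b -> 0 <= d -> d <= `|z| ->
  heat b z <= expR (ln 2 / 2 - d ^+ 2 / (4 * b)) * heat (2 * b) z.
Proof.
move=> b0 d0 dz; rewrite /heat -expRD ler_expR lnM ?posrE //.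
have dz2 : d ^+ 2 <= z ^+ 2 by rewrite -(real_normK (num_real z)) lerXn2r ?nnegrE.
have : d ^+ 2 / (4 * b) <= z ^+ 2 / (4 * b).
  by rewrite ler_wpM2r // invr_ge0 mulr_ge0 // ltW.
rewrite (_ : z * z / b / 2 = 2 * (z ^+ 2 / (4 * b))); last by field; rewrite gt_eqF.
rewrite (_ : z * z / (2 * b) / 2 = z ^+ 2 / (4 * b)); last by field; rewrite gt_eqF.
lra.
Qed.

End gaussian_integrals.

Section bounded_functions.
Context {R : realType} d (T : measurableType d) (P : probability T R).

Lemma bounded_integrable (f : T -> R) M : measurable_fun setT f ->
  (forall x, `|f x| <= M) -> P.-integrable setT (EFin \o f).
Proof.
move=> mf fM; apply: measurable_bounded_integrable => //.
  by rewrite -ge0_fin_numE // fin_num_measure.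
exists M; split; first exact: num_real.
by move=> M' MM' x _; exact: le_trans (fM x) (ltW MM').
Qed.

Lemma integral_EFin_Rintegral (f : T -> R) M : measurable_fun setT f ->
  (forall x, `|f x| <= M) -> (\int[P]_x (f x)%:E = (\int[P]_x f x)%R%:E)%E.
Proof.
move=> mf fM; rewrite /Rintegral fineK //.
by apply: integrable_fin_num => //; exact: bounded_integrable fM.
Qed.

Lemma le_Rintegral_dist (f g : T -> R) M e : measurable_fun setT f ->
  measurable_fun setT g -> (forall x, `|f x| <= M) -> (forall x, `|g x| <= M) ->
  (forall x, `|f x - g x| <= e) -> `|\int[P]_x f x - \int[P]_x g x| <= e.
Proof.
move=> mf mg fM gM fg.
rewrite -RintegralB //; [|exact: bounded_integrable fM|exact: bounded_integrable gM].
have mfg : measurable_fun setT (fun x => f x - g x) by exact: measurable_funB.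
have ifg := bounded_integrable mfg fg.
apply: le_trans (le_normr_Rintegral _ ifg) _ => //.
have -> : e = \int[P]_x cst e x.
  rewrite /= Rintegral_cst //. by rewrite [X in fine X](@probability_setT _ _ _ P) mulr1.
apply: le_Rintegral => //.
- apply: (@bounded_integrable _ e); first exact: measurableT_comp.
  by move=> x; rewrite normr_id.
- by apply: (@bounded_integrable _ `|e|).
Qed.

End bounded_functions.

Section uniform_continuity.
Context {R : realType}.

(** Heine-Cantor on [-(L+1), L+1]. As d < 1, points within distance d of a point outside this
    segment still have modulus above L, where [f] vanishes. *)
Lemma compact_support_unif_continuous (f : R -> R) (L e : R) : continuous f ->
  (forall x, L < `|x| -> f x = 0) -> 0 < e ->
  exists2 d, 0 < d & forall x y, `|x - y| <= d -> `|f x - f y| <= e.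
Proof.
move=> cf fL e0; set K := `[- (L + 1), L + 1]%classic : set R.
have /compact_near_coveringP cK : compact K by exact: segment_compact.
have e20 : 0 < e / 2 by rewrite divr_gt0.
have : \forall d \near 0^'+, K `<=` (fun x => forall y, `|x - y| <= d -> `|f x - f y| <= e).
  apply: cK => x _.
  have /cvgrPdist_lt /(_ _ e20) /nbhs_ballP[r /= r0 hr] := cf x.
  have r20 : 0 < r / 2 by rewrite divr_gt0.
  exists (ball x (r / 2), [set d | 0 < d < r / 2]) => /=.
    split; first exact: nbhsx_ballx.
    near=> d; apply/andP; split; first by near: d; exact: nbhs_right_gt.
    by near: d; exact: nbhs_right_lt.
  move=> [z d] /= [xz /andP[d0 dr]] y zy; rewrite /ball /= in xz.
  have h1 : `|f x - f z| < e / 2 by apply: hr; rewrite /ball /=; lra.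
  have h2 : `|f x - f y| < e / 2.
    apply: hr; rewrite /ball /= (_ : x - y = (x - z) + (z - y)); last by ring.
    by apply: le_lt_trans (ler_normD _ _) _; lra.
  rewrite (_ : f z - f y = (f x - f y) - (f x - f z)); last by ring.
  by apply: le_trans (ler_normB _ _) _; lra.
move=> hK.
have [d [d0 d1 dK]] : exists d, [/\ 0 < d, d < 1 &
    K `<=` (fun x => forall y, `|x - y| <= d -> `|f x - f y| <= e)].
  near (0 : R)^'+ => d; exists d; split.
  - by near: d; exact: nbhs_right_gt.
  - by near: d; exact: nbhs_right_lt.
  - by near: d.
exists d => // x y xy.
have [xL|Lx] := leP `|x| (L + 1).
  by apply: dK => //; rewrite /K /= in_itv /= -ler_norml.
rewrite !fL ?subrr ?normr0 ?ltW //.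
  have : `|x| <= `|x - y| + `|y| by rewrite -{1}(subrK y x) ler_normD.
  lra.
lra.
Unshelve. all: by end_near. Qed.

End uniform_continuity.

Section gaussian_convolution.
Context {R : realType}.
Local Notation mu := (@lebesgue_measure R).
Variables (f : R -> R) (K L : R).
Hypotheses (cf : continuous f) (f0 : forall x, 0 <= f x) (fK : forall x, f x <= K)
  (fL : forall x, L < `|x| -> f x = 0).

(** Extended real values let Tonelli's theorem apply before finiteness is known. *)
Definition smooth (b y : R) : \bar R :=
  (\int[mu]_a (f a * heat b (y - a))%:E)%E.

Let tail (b d : R) : R := expR (ln 2 / 2 - d ^+ 2 / (4 * b)).

Let mf : measurable_fun setT f.
Proof. by apply: continuous_measurable_fun. Qed.

Let mfmu : measurable_fun setT (f : measurableTypeR R -> R).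
Proof. by apply: continuous_measurable_fun. Qed.

Let mheat (b y : R) : measurable_fun setT (fun a : measurableTypeR R => heat b (y - a)).
Proof.
under eq_fun do rewrite heatC.
by apply: measurable_heat.
Qed.

Let K0 : 0 <= K.
Proof. exact: le_trans (f0 0) (fK 0). Qed.

Let heat_ge0 (b y : R) : 0 <= heat b y. Proof. exact/ltW/heat_gt0. Qed.

Let int_cheat (c b y : R) : 0 <= c -> 0 < b ->
  (\int[mu]_a (c * heat b (y - a))%:E = (c * heat_mass)%:E)%E.
Proof.
move=> c0 b0; under eq_integral do rewrite heatC EFinM.
rewrite ge0_integralZl_EFin //.
- by rewrite integral_heat.
- by move=> a _; rewrite lee_fin.
- by apply/measurable_EFinP; exact: measurable_heat.
Qed.

(** Within distance d the function varies by at most e; beyond it, the kernel is at most [tail b d]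
    times the kernel of variance 2 b, which has the same mass. *)
Lemma smooth_dist (b d e y : R) : 0 < b -> 0 < d -> 0 <= e ->
  (forall x x', `|x - x'| <= d -> `|f x - f x'| <= e) ->
  exists2 s : R, smooth b y = s%:E &
    `|s - heat_mass * f y| <= heat_mass * (e + K * tail b d).
Proof.
move=> b0 d0 e0 hf; have m0 := @heat_mass_gt0 R.
have t0 : 0 <= tail b d by exact: expR_ge0.
have b20 : 0 < 2 * b by rewrite mulr_gt0.
have Kt0 : 0 <= K * tail b d by exact: mulr_ge0.
have far a : ~~ (`|y - a| <= d) -> heat b (y - a) <= tail b d * heat (2 * b) (y - a).
  by rewrite -ltNge => /ltW; apply: heat_tail => //; exact: ltW.
have m1 c b' : measurable_fun setT (fun a : measurableTypeR R => (c * heat b' (y - a))%:E).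
  by apply/measurable_EFinP; apply: measurable_funM => //; exact: mheat.
have mfh : measurable_fun setT (fun a : measurableTypeR R => (f a * heat b (y - a))%:E).
  by apply/measurable_EFinP; apply: measurable_funM => //; exact: mheat.
have up a : f a * heat b (y - a) <=
    (f y + e) * heat b (y - a) + K * tail b d * heat (2 * b) (y - a).
  have h2 := heat_ge0 (2 * b) (y - a); have h1 := heat_ge0 b (y - a).
  have k2 : 0 <= K * tail b d * heat (2 * b) (y - a) by rewrite mulr_ge0.
  have k1 : 0 <= (f y + e) * heat b (y - a) by rewrite mulr_ge0 // addr_ge0.
  have [ya|ya] := boolP (`|y - a| <= d).
    have : f a * heat b (y - a) <= (f y + e) * heat b (y - a).
      by rewrite ler_wpM2r //; have := hf _ _ ya; rewrite ler_norml; lra.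
    lra.
  have : f a * heat b (y - a) <= K * (tail b d * heat (2 * b) (y - a)).
    by apply: ler_pM => //; exact: far.
  lra.
have dn a : f y * heat b (y - a) <=
    f a * heat b (y - a) + (e * heat b (y - a) + K * tail b d * heat (2 * b) (y - a)).
  have h2 := heat_ge0 (2 * b) (y - a); have h1 := heat_ge0 b (y - a).
  have k2 : 0 <= K * tail b d * heat (2 * b) (y - a) by rewrite mulr_ge0.
  have k1 : 0 <= e * heat b (y - a) by rewrite mulr_ge0.
  have k3 : 0 <= f a * heat b (y - a) by rewrite mulr_ge0.
  have [ya|ya] := boolP (`|y - a| <= d).
    have : f y * heat b (y - a) <= (f a + e) * heat b (y - a).
      by rewrite ler_wpM2r //; have := hf _ _ ya; rewrite ler_norml; lra.
    lra.
  have : f y * heat b (y - a) <= K * (tail b d * heat (2 * b) (y - a)).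
    by apply: ler_pM => //; exact: far.
  lra.
have hup : (smooth b y <= ((f y + e) * heat_mass + K * tail b d * heat_mass)%:E)%E.
  rewrite EFinD -(@int_cheat (f y + e) b y) ?addr_ge0 // -(@int_cheat (K * tail b d) (2 * b) y) //.
  rewrite -ge0_integralD //; last 2 first.
  - by move=> a _; rewrite lee_fin mulr_ge0 // addr_ge0.
  - by move=> a _; rewrite lee_fin mulr_ge0.
  apply: ge0_le_integral => //.
  - by move=> a _; rewrite lee_fin mulr_ge0.
  - exact: emeasurable_funD.
  - by move=> a _; rewrite -EFinD lee_fin.
have hdn : ((f y * heat_mass)%:E <=
    smooth b y + (e * heat_mass + K * tail b d * heat_mass)%:E)%E.
  rewrite EFinD -(@int_cheat e b y) // -(@int_cheat (K * tail b d) (2 * b) y) //.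
  rewrite -(@int_cheat (f y) b y) // /smooth.
  rewrite -ge0_integralD //; last 2 first.
  - by move=> a _; rewrite lee_fin mulr_ge0.
  - by move=> a _; rewrite lee_fin mulr_ge0.
  rewrite -ge0_integralD //; last 3 first.
  - by move=> a _; rewrite lee_fin mulr_ge0.
  - by move=> a _; rewrite -EFinD lee_fin addr_ge0 // mulr_ge0.
  - exact: emeasurable_funD.
  apply: ge0_le_integral => //.
  - by move=> a _; rewrite lee_fin mulr_ge0.
  - by apply: emeasurable_funD => //; exact: emeasurable_funD.
  - by move=> a _; rewrite -!EFinD lee_fin.
have s0 : (0 <= smooth b y)%E.
  by apply: integral_ge0 => a _; rewrite lee_fin mulr_ge0.
move: hup hdn s0; case: (smooth b y) => [s| |] //.
rewrite -EFinD !lee_fin => hup hdn s0; exists s => //.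
by rewrite ler_norml; apply/andP; split; lra.
Qed.

Lemma integral_smooth (b : R) (P : probability R R) :
  (\int[P]_y smooth b y = \int[mu]_a \int[P]_y (f a * heat b (y - a))%:E)%E.
Proof.
apply: (fubini_tonelli (m1 := P) (m2 := mu)
  (fun z : R * measurableTypeR R => (f z.2 * heat b (z.1 - z.2))%:E)).
  apply/measurable_EFinP; apply: measurable_funM.
    by apply: measurableT_comp.
  apply: (@measurableT_comp _ _ _ _ _ _ (heat b)).
    have := measurable_heat b (0 : R).
    by rewrite (_ : (fun y => heat b (y - 0)) = heat b) //; apply/funext => y; rewrite subr0.
  by apply: measurable_funB; [exact: measurable_fst|exact: measurable_snd].
by move=> z; rewrite lee_fin mulr_ge0.
Qed.

(** By Tonelli the integral is a superposition over the centre [a] of Gaussian tests. It converges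
    by domination, the integrand being bounded and supported in [-L, L]. *)
Lemma cvg_integral_smooth (b : R) (P : nat -> probability R R) (Q : probability R R) :
  0 < b ->
  (forall a, \int[P n]_y heat b (y - a) @[n --> \oo] --> \int[Q]_y heat b (y - a)) ->
  (\int[P n]_y smooth b y @[n --> \oo] --> \int[Q]_y smooth b y)%E.
Proof.
move=> b0 hPQ; pose M := heat b 0.
have hM a y : `|heat b (y - a)| <= M by rewrite ger0_norm // heat_le.
have fh (P' : probability R R) a : (\int[P']_y (f a * heat b (y - a))%:E =
    (f a * \int[P']_y heat b (y - a))%:E)%E.
  under eq_integral do rewrite EFinM.
  rewrite ge0_integralZl_EFin //.
  - by rewrite (integral_EFin_Rintegral _ (measurable_heat b a) (hM a)) -EFinM.
  - by move=> y _; rewrite lee_fin.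
  - by apply/measurable_EFinP; exact: measurable_heat.
have mh : measurable_fun setT (heat b).
  have := measurable_heat b (0 : R).
  by rewrite (_ : (fun y => heat b (y - 0)) = heat b) //; apply/funext => y; rewrite subr0.
have mF (P' : probability R R) : measurable_fun setT
    (fun a : measurableTypeR R => \int[P']_y (f a * heat b (y - a))%:E)%E.
  apply: (measurable_fun_fubini_tonelli_G (m1 := P')
    (fun z : R * measurableTypeR R => (f z.2 * heat b (z.1 - z.2))%:E)).
    apply/measurable_EFinP; apply: measurable_funM.
      by apply: measurableT_comp.
    apply: (@measurableT_comp _ _ _ _ _ _ (heat b)) => //.
    by apply: measurable_funB; [exact: measurable_fst|exact: measurable_snd].
  by move=> z; rewrite lee_fin mulr_ge0.
under eq_fun do rewrite integral_smooth.
rewrite integral_smooth.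
pose D : set R := `[- L, L]%classic.
have cv a : (\int[P n]_y (f a * heat b (y - a))%:E)%E @[n --> \oo] -->
    (\int[Q]_y (f a * heat b (y - a))%:E)%E.
  under eq_fun do rewrite fh.
  rewrite fh; apply: cvg_EFin; first by near=> n.
  by apply: cvgM; [exact: cvg_cst|exact: hPQ].
have dom a n : (`|\int[P n]_y (f a * heat b (y - a))%:E| <= (K * M)%:E * (\1_D a)%:E)%E.
  rewrite fh -EFinM /= lee_fin.
  have I0 : 0 <= \int[P n]_y heat b (y - a) by apply: Rintegral_ge0.
  rewrite ger0_norm ?mulr_ge0 // indicE; have [aD|aD] := boolP (a \in D).
    rewrite mulr1; apply: ler_pM => //.
    have -> : M = \int[P n]_y cst M y.
      by rewrite /= Rintegral_cst // [X in fine X](@probability_setT _ _ _ (P n)) mulr1.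
    apply: le_Rintegral => //.
    + exact: bounded_integrable (measurable_heat b a) (hM a).
    + by apply: (@bounded_integrable _ _ _ _ _ `|M|).
    + by move=> y _ /=; exact: heat_le.
  rewrite fL ?mul0r ?mulr0 // ltNge ler_norml; apply: contra aD => aL.
  by rewrite inE /D /= in_itv.
have intg : mu.-integrable setT (fun a => (K * M)%:E * (\1_D a)%:E)%E.
  by apply: integrableZl => //; exact: (integrable_indic_itv (- L) L true false).
pose I (P' : probability R R) (a : measurableTypeR R) :=
  (\int[P']_y (f a * heat b (y - a))%:E)%E.
have acv : {ae mu, forall a, setT a -> I (P n) a @[n --> \oo] --> I Q a}.
  by apply: aeW => a _; exact: cv.
have adom : {ae mu, forall a n, setT a -> (`|I (P n) a| <= (K * M)%:E * (\1_D a)%:E)%E}.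
  by apply: aeW => a n _; exact: dom.
by have [] := dominated_convergence measurableT (fun n => mF (P n)) (mF Q) acv intg adom.
Unshelve. all: by end_near. Qed.

Lemma cvg_mean_compact_support (P : nat -> probability R R) (Q : probability R R) :
  (forall b a, 0 < b ->
    \int[P n]_y heat b (y - a) @[n --> \oo] --> \int[Q]_y heat b (y - a)) ->
  \int[P n]_y f y @[n --> \oo] --> \int[Q]_y f y.
Proof.
move=> hPQ; have m0 := @heat_mass_gt0 R.
apply/cvgrPdist_lt => e e0.
have e40 : 0 < e / 8 by rewrite divr_gt0.
have [d d0 hd] := compact_support_unif_continuous cf fL e40.
have hd' x x' : `|x - x'| <= d -> `|f x - f x'| <= e / 8 by exact: hd.
have [b b0 hb] : exists2 b, 0 < b & K * tail b d <= e / 8.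
  have K10 : 0 < K + 1 by have := K0; lra.
  (* With b = d^2 / (4 v) the exponent of [tail] is ln 2 / 2 - v, and v = 1 + |ln u| brings the tail
     below 2 u = e / (8 (K + 1)). *)
  pose u := e / 8 / (K + 1) / 2.
  have u0 : 0 < u by rewrite !divr_gt0.
  pose v := 1 + `|ln u|.
  have v0 : 0 < v by rewrite ltr_pwDl.
  exists (d ^+ 2 / (4 * v)); first by rewrite divr_gt0 ?exprn_gt0 // mulr_gt0.
  have -> : tail (d ^+ 2 / (4 * v)) d = expR (ln 2 / 2 - v).
    by rewrite /tail; congr (expR (_ - _)); field; rewrite !gt_eqF.
  apply: (@le_trans _ _ ((K + 1) * (u * 2))); last first.
    by rewrite /u le_eqVlt; apply/orP; left; apply/eqP; field; rewrite gt_eqF.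
  apply: ler_pM; rewrite ?expR_ge0 //; first lra.
  have u20 : 0 < u * 2 by rewrite mulr_gt0.
  have -> : u * 2 = expR (ln (u * 2)) by rewrite lnK.
  rewrite ler_expR lnM ?posrE //.
  have : - ln u <= `|ln u| by rewrite -normrN ler_norm.
  have : 0 <= ln (2 : R) by rewrite ln_ge0 //; lra.
  by rewrite /v; lra.
have sm y : exists2 s : R, smooth b y = s%:E &
    `|s - heat_mass * f y| <= heat_mass * (e / 8 + K * tail b d).
  by apply: smooth_dist => //; exact: ltW.
pose s y := fine (smooth b y).
have sE y : smooth b y = (s y)%:E by have [r hr _] := sm y; rewrite /s hr.
have sd y : `|s y - heat_mass * f y| <= heat_mass * (e / 4).
  have [r hr h] := sm y; rewrite /s hr /=; apply: le_trans h _.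
  by rewrite ler_wpM2l ?(ltW m0) //; lra.
have ms : measurable_fun setT s.
  apply: (@measurableT_comp _ _ _ _ _ _ fine) => //.
  apply: (measurable_fun_fubini_tonelli_F (m2 := mu)
    (fun z : R * measurableTypeR R => (f z.2 * heat b (z.1 - z.2))%:E)).
    apply/measurable_EFinP; apply: measurable_funM; first exact: measurableT_comp.
    apply: (@measurableT_comp _ _ _ _ _ _ (heat b)).
      have := measurable_heat b (0 : R).
      by rewrite (_ : (fun y => heat b (y - 0)) = heat b) //; apply/funext => y; rewrite subr0.
    by apply: measurable_funB; [exact: measurable_fst|exact: measurable_snd].
  by move=> z; rewrite lee_fin mulr_ge0.
pose B := heat_mass * (K + e).
have mB y : `|heat_mass * f y| <= B.
  rewrite normrM (gtr0_norm m0) ger0_norm // ler_wpM2l ?(ltW m0) //.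
  by have := fK y; lra.
have sB y : `|s y| <= B.
  rewrite -(subrK (heat_mass * f y) (s y)); apply: le_trans (ler_normD _ _) _.
  rewrite [X in _ + X]normrM (gtr0_norm m0) (ger0_norm (f0 y)).
  have := sd y; have := ler_wpM2l (ltW m0) (fK y); have := mulr_gt0 m0 e0.
  rewrite /B; lra.
have mmf : measurable_fun setT (fun y => heat_mass * f y) by exact: measurable_funM.
have close (P' : probability R R) :
    `|\int[P']_y s y - heat_mass * \int[P']_y f y| <= heat_mass * (e / 4).
  rewrite -RintegralZl //; first exact: (le_Rintegral_dist _ ms mmf sB mB sd).
  by apply: (@bounded_integrable _ _ _ _ _ K) => // x; rewrite ger0_norm.
have sc : \int[P n]_y s y @[n --> \oo] --> \int[Q]_y s y.
  have := cvg_integral_smooth b0 (fun a => hPQ b a b0).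
  have eI (P' : probability R R) : (\int[P']_y smooth b y = (\int[P']_y s y)%R%:E)%E.
    by under eq_integral do rewrite sE; exact: (integral_EFin_Rintegral _ ms sB).
  by under eq_fun do rewrite eI; rewrite eI => /fine_cvgP[].
have me : 0 < heat_mass * (e / 4) by rewrite mulr_gt0 // divr_gt0.
move/cvgrPdist_lt : sc => /(_ _ me) sc; near=> n.
have scn : `|\int[Q]_y s y - \int[P n]_y s y| < heat_mass * (e / 4) by near: n.
rewrite -(ltr_pM2l m0) -{1}(gtr0_norm m0) -normrM mulrBr.
rewrite (_ : _ - _ = - (\int[Q]_y s y - heat_mass * \int[Q]_y f y) +
  (\int[Q]_y s y - \int[P n]_y s y) +
  (\int[P n]_y s y - heat_mass * \int[P n]_y f y)); last by ring.
apply: le_lt_trans (ler_normD _ _) _.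
have := ler_normD (- (\int[Q]_y s y - heat_mass * \int[Q]_y f y))
  (\int[Q]_y s y - \int[P n]_y s y).
have := close Q; have := close (P n); rewrite normrN; lra.
Unshelve. all: by end_near. Qed.

End gaussian_convolution.

Section weak_convergence.
Context {R : realType}.

(* Equal to 1 on [-M, M], to 0 outside [-2M, 2M], and affine in between. *)
Definition tent (M y : R) : R := (`|2 - `|y| / M| - `|1 - `|y| / M| + 1) / 2.

Lemma continuous_tent M : continuous (tent M).
Proof.
have c0 c : continuous (fun y : R => `|c - `|y| / M|).
  move=> y; apply: cvg_norm; apply: cvgB; first exact: cvg_cst.
  by apply: cvgM; [exact: norm_continuous|exact: cvg_cst].
move=> y; apply: cvgM; last exact: cvg_cst.
apply: cvgD; last exact: cvg_cst.
by apply: cvgB; exact: c0.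
Qed.

Let tentE (t : R) : [/\ 0 <= (`|2 - t| - `|1 - t| + 1) / 2 <= 1,
  t <= 1 -> (`|2 - t| - `|1 - t| + 1) / 2 = 1 &
  2 < t -> (`|2 - t| - `|1 - t| + 1) / 2 = 0].
Proof.
have [t2|t2] := leP t 2; have [t1|t1] := leP t 1.
- rewrite !ger0_norm ?subr_ge0 //; split; first (by apply/andP; split; lra); lra.
- rewrite ger0_norm ?subr_ge0 // ltr0_norm ?subr_lt0 //.
  by split; first (by apply/andP; split; lra); lra.
- lra.
- rewrite !ltr0_norm ?subr_lt0 //; split; first (by apply/andP; split; lra); lra.
Qed.

Lemma tent_ge0 M y : 0 <= tent M y.
Proof. by have [/andP[]] := tentE (`|y| / M). Qed.

Lemma tent_le1 M y : tent M y <= 1.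
Proof. by have [/andP[]] := tentE (`|y| / M). Qed.

Lemma tent_supp M y : 0 < M -> 2 * M < `|y| -> tent M y = 0.
Proof.
by move=> M0; rewrite -ltr_pdivlMr // => yM; have [_ _ h] := tentE (`|y| / M); exact: h.
Qed.

Lemma tent_tail M y : 0 < M -> 1 - tent M y <= (M ^+ 2)^-1 * y ^+ 2.
Proof.
move=> M0; have M20 : 0 < M ^+ 2 by rewrite exprn_gt0.
have yM20 : 0 <= (M ^+ 2)^-1 * y ^+ 2 by rewrite mulr_ge0 ?sqr_ge0 ?invr_ge0 // ltW.
have [yM|/ltW My] := leP `|y| M.
  suff -> : tent M y = 1 by rewrite subrr.
  by have [_ h _] := tentE (`|y| / M); apply: h; rewrite ler_pdivrMr // mul1r.
apply: (@le_trans _ _ 1); first by rewrite gerBl tent_ge0.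
rewrite mulrC ler_pdivlMr // mul1r -(real_normK (num_real y)).
by rewrite lerXn2r ?nnegrE // ltW.
Qed.

(** Bounded second moments give tightness, so [g] may be cut off by a tent and the compactly
    supported case applies. *)
Theorem weak_cvg_of_gaussian (P : nat -> probability R R) (Q : probability R R)
    (C : R) (g : R -> R) (K : R) :
  (forall b a, 0 < b ->
    \int[P n]_y heat b (y - a) @[n --> \oo] --> \int[Q]_y heat b (y - a)) ->
  (forall n, \int[P n]_y (y ^+ 2)%:E <= C%:E)%E ->
  continuous g -> (forall x, `|g x| <= K) ->
  \int[P n]_y g y @[n --> \oo] --> \int[Q]_y g y.
Proof.
move=> hPQ hC cg gK; apply/cvgrPdist_lt => e e0.
have K0 : 0 <= K by apply: le_trans (gK 0).
have C0 : 0 <= C.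
  rewrite -lee_fin; apply: le_trans (hC 0%N); apply: integral_ge0 => y _.
  by rewrite lee_fin sqr_ge0.
(* Makes the cut-off error 2 K C / M^2 at most e / 8 (see [small]). *)
pose M := 1 + 16 * K * C / e.
have KCe : 0 <= 16 * K * C / e by rewrite divr_ge0 ?(ltW e0) // !mulr_ge0.
have M1 : 1 <= M by rewrite lerDl.
have M0 : 0 < M by lra.
pose chi := tent M.
have mchi : measurable_fun setT chi.
  by apply: continuous_measurable_fun; exact: continuous_tent.
have mg : measurable_fun setT g by apply: continuous_measurable_fun.
have chi1 y : `|chi y| <= 1 by rewrite ger0_norm ?tent_ge0 // tent_le1.
have hB (P' : probability R R) : measurable_fun setT (fun y => 1 - chi y) /\
    P'.-integrable setT (EFin \o (fun y => 1 - chi y)).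
  have m1 : measurable_fun setT (fun y => 1 - chi y) by exact: measurable_funB.
  split => //; apply: (@bounded_integrable _ _ _ _ _ 1) => // y.
  by rewrite ger0_norm ?subr_ge0 ?tent_le1 // gerBl tent_ge0.
pose tl (P' : probability R R) := \int[P']_y (1 - chi y).
have tlP n : tl (P n) <= (M ^+ 2)^-1 * C.
  rewrite -lee_fin /tl -(integral_EFin_Rintegral (M := 1) _ (hB (P n)).1); last first.
    by move=> y; rewrite ger0_norm ?subr_ge0 ?tent_le1 // gerBl tent_ge0.
  have Mi : 0 <= (M ^+ 2)^-1 by rewrite invr_ge0 exprn_ge0 // ltW.
  rewrite EFinM; apply: le_trans (lee_wpmul2l _ (hC n)); last by rewrite lee_fin.
  have msq : measurable_fun setT (fun y : R => (y ^+ 2)%:E).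
    by apply/measurable_EFinP; exact: measurable_funX.
  rewrite -ge0_integralZl_EFin //; last first.
    by move=> y _; rewrite lee_fin sqr_ge0.
  apply: ge0_le_integral => //.
  - by move=> y _; rewrite lee_fin subr_ge0 tent_le1.
  - by apply/measurable_EFinP; exact: (hB (P n)).1.
  - by apply: emeasurable_funM.
  - by move=> y _; rewrite -EFinM lee_fin tent_tail.
(* Adding K makes the test function nonnegative, as the compactly supported case requires. *)
pose f y := (g y + K) * chi y.
have cf : continuous f.
  move=> y; apply: cvgM; last exact: continuous_tent.
  by apply: cvgD; [exact: cg|exact: cvg_cst].
have f0 y : 0 <= f y.
  by rewrite mulr_ge0 ?tent_ge0 //; have := gK y; rewrite ler_norml; lra.
have fK y : f y <= 2 * K.
  rewrite -[leRHS]mulr1; apply: ler_pM; rewrite ?tent_ge0 ?tent_le1 //.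
    by have := gK y; rewrite ler_norml; lra.
  by have := gK y; rewrite ler_norml; lra.
have fL y : 2 * M < `|y| -> f y = 0 by move=> h; rewrite /f /chi tent_supp // mulr0.
have chiL y : 2 * M < `|y| -> chi y = 0 by exact: tent_supp.
have cvf := cvg_mean_compact_support cf f0 fK fL hPQ.
have cvchi := cvg_mean_compact_support (@continuous_tent M) (tent_ge0 M) (tent_le1 M) chiL hPQ.
have tlE (P' : probability R R) : tl P' = 1 - \int[P']_y chi y.
  rewrite /tl RintegralB //.
  - by rewrite Rintegral_cst // [X in fine X](@probability_setT _ _ _ P') mulr1.
  - by apply: (@bounded_integrable _ _ _ _ _ 1) => // y; rewrite normr1.
  - exact: (@bounded_integrable _ _ _ _ _ 1).
(* The tail of the limit law is controlled as a limit of the tails of the [P n], the tent being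
   itself a compactly supported test. *)
have tlQ : tl Q <= (M ^+ 2)^-1 * C.
  have l : tl (P n) @[n --> \oo] --> tl Q.
    rewrite tlE; under eq_fun do rewrite tlE.
    by apply: cvgB; [exact: cvg_cst|exact: cvchi].
  by apply: (cvgr_to_le l); near=> n.
have small : 2 * K * ((M ^+ 2)^-1 * C) <= e / 8.
  have MM : M <= M ^+ 2 by rewrite expr2 ler_peMr // ltW.
  have h : 16 * K * C <= e * M ^+ 2.
    apply: (@le_trans _ _ (e * M)); last by rewrite ler_wpM2l // ltW.
    by rewrite /M mulrDr mulr1 [e * (_ / e)]mulrC divfK ?gt_eqF // lerDr ltW.
  rewrite (_ : 2 * K * _ = 2 * K * C / M ^+ 2); last by ring.
  by rewrite ler_pdivrMr ?exprn_gt0 //; lra.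
have mf : measurable_fun setT f by apply: continuous_measurable_fun.
have decomp (P' : probability R R) : `|\int[P']_y g y - (\int[P']_y f y - K)| <=
    2 * K * tl P'.
  have fB : P'.-integrable setT (EFin \o f).
    apply: (@bounded_integrable _ _ _ _ _ (2 * K)) => // y.
    by rewrite ger0_norm.
  have gI : P'.-integrable setT (EFin \o g) by exact: bounded_integrable gK.
  have KE : K = \int[P']_y cst K y.
    by rewrite /= Rintegral_cst // [X in fine X](@probability_setT _ _ _ P') mulr1.
  have KI : P'.-integrable setT (EFin \o (cst K)).
    by apply: (@bounded_integrable _ _ _ _ _ `|K|).
  have mfK : measurable_fun setT (fun y => f y - cst K y) by exact: measurable_funB.
  have fKI : P'.-integrable setT (EFin \o (fun y => f y - cst K y)).
    apply: (@bounded_integrable _ _ _ _ _ (2 * K + K)) => // y.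
    by apply: le_trans (ler_normB _ _) _; rewrite lerD ?(ger0_norm K0) // ger0_norm.
  rewrite [X in _ - X](_ : _ = \int[P']_y (f y - cst K y)); last first.
    by rewrite RintegralB // -KE.
  rewrite -RintegralB // -RintegralZl //; last exact: (hB P').2.
  have mgf : measurable_fun setT (fun y => g y - (f y - cst K y)) by exact: measurable_funB.
  have bgf y : `|g y - (f y - cst K y)| <= 2 * K * (1 - chi y).
    rewrite (_ : _ - _ = (g y + K) * (1 - chi y)); last by rewrite /f /=; ring.
    rewrite normrM (ger0_norm (_ : 0 <= 1 - chi y)) ?subr_ge0 ?tent_le1 //.
    rewrite ler_wpM2r ?subr_ge0 ?tent_le1 //.
    by have := gK y; rewrite !ler_norml; lra.
  have bgf' y : `|g y - (f y - cst K y)| <= 2 * K.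
    apply: le_trans (bgf y) _; rewrite ler_piMr ?mulr_ge0 // gerBl; exact: tent_ge0.
  have gfI : P'.-integrable setT (EFin \o (fun y => g y - (f y - cst K y))).
    exact: bounded_integrable mgf bgf'.
  apply: le_trans (le_normr_Rintegral _ gfI) _ => //.
  apply: le_Rintegral => //.
  - apply: (@bounded_integrable _ _ _ _ _ (2 * K)); first exact: measurableT_comp.
    by move=> y; rewrite normr_id.
  - apply: (@bounded_integrable _ _ _ _ _ (2 * K)).
      by apply: measurable_funM => //; exact: (hB P').1.
    move=> y; rewrite ger0_norm ?mulr_ge0 ?subr_ge0 ?tent_le1 //.
    by rewrite ler_piMr ?mulr_ge0 // gerBl; exact: tent_ge0.
have e20 : 0 < e / 2 by rewrite divr_gt0.
move/cvgrPdist_lt : cvf => /(_ _ e20) cvf; near=> n.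
have fn : `|\int[Q]_y f y - \int[P n]_y f y| < e / 2 by near: n.
have dQ := decomp Q; have dP := decomp (P n).
have K20 : 0 <= 2 * K by rewrite mulr_ge0.
have tQ := ler_wpM2l K20 tlQ; have tP := ler_wpM2l K20 (tlP n).
rewrite (_ : _ - _ = (\int[Q]_y g y - (\int[Q]_y f y - K)) +
  (\int[Q]_y f y - \int[P n]_y f y) -
  (\int[P n]_y g y - (\int[P n]_y f y - K))); last by ring.
apply: le_lt_trans (ler_normB _ _) _.
have := ler_normD (\int[Q]_y g y - (\int[Q]_y f y - K)) (\int[Q]_y f y - \int[P n]_y f y).
lra.
Unshelve. all: by end_near. Qed.

End weak_convergence.

(** * The law of the Markov chain *)

Section mixture.
Context {R : realType} {N : nat} {d : measure_display} {S : measurableType d}.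
Variable p : 'I_N -> R.
Hypothesis hp : prob_weights p.
Local Open Scope ereal_scope.

(** [msum] expects a sequence of measures, so the family is padded with the zero measure. *)
Let component (m : 'I_N -> {measure set S -> \bar R}) (k : nat) :
    {measure set S -> \bar R} :=
  if insub k is Some i then mscale (NngNum (weight_ge0 hp i)) (m i) else mzero.

Definition mixture (m : 'I_N -> {measure set S -> \bar R}) :
  {measure set S -> \bar R} := msum (component m) N.

Lemma mixtureE m A : mixture m A = \sum_(i < N) (p i)%:E * m i A.
Proof. by rewrite /mixture /msum /=; apply: eq_bigr => i _; rewrite /component valK. Qed.

Lemma ge0_integral_mixture (m0 : {measure set S -> \bar R})
    (m : 'I_N -> {measure set S -> \bar R}) (G : S -> \bar R) :
  (forall A, measurable A -> m0 A = \sum_(i < N) (p i)%:E * m i A) ->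
  measurable_fun setT G -> (forall x, 0 <= G x) ->
  \int[m0]_x G x = \sum_(i < N) (p i)%:E * \int[m i]_x G x.
Proof.
move=> hm mG G0; have -> : \int[m0]_x G x = \int[mixture m]_x G x.
  by apply: eq_measure_integral => A mA _; rewrite mixtureE hm.
rewrite ge0_integral_measure_sum //; apply: eq_bigr => i _.
by rewrite /component valK ge0_integral_mscale.
Qed.

End mixture.

Section clip.
Context {R : realType}.

(* Composing with this projection of R onto [0,1] makes the values of a map
   outside [0,1] irrelevant. *)
Definition clip (x : R) : R := Num.max 0 (Num.min x 1).

Lemma clip_I01 x : I01 (clip x).
Proof.
rewrite /I01 /= in_itv /= le_max lexx /= ge_max ler01 /=.
by rewrite ge_min lexx orbT.
Qed.

Lemma clip_id x : I01 x -> clip x = x.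
Proof.
rewrite /I01 /= in_itv /= => /andP[x0 x1].
by rewrite /clip (min_idPl x1); apply/max_idPr.
Qed.

Lemma measurable_clip : measurable_fun setT clip.
Proof. by apply: measurable_maxr => //; exact: measurable_minr. Qed.

Lemma measurable_I01 : measurable (I01 : set R).
Proof. exact: measurable_itv. Qed.

Lemma measurable_comp_clip (g : R -> R) :
  {within I01, continuous g} -> measurable_fun setT (g \o clip).
Proof.
move=> cg; apply: (@measurable_comp _ _ _ _ _ _ I01) => //.
- exact: measurable_I01.
- by move=> _ [x _ <-]; exact: clip_I01.
- by apply: subspace_continuous_measurable_fun => //; exact: measurable_I01.
- exact: measurable_clip.
Qed.

End clip.

Section chain_law.
Context {R : realType} {N : nat}.
Variables (f : 'I_N -> R -> R) (p : 'I_N -> R) (nu : set R -> \bar R) (phi : R -> R).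
Context {d : measure_display} {T : measurableType d}.
Variables (Pr : probability T R) (X : nat -> {RV Pr >-> R}).
Hypothesis hp : prob_weights p.
Hypothesis hX : markov_chain f p nu X.

Let F i := f i \o clip.
Let Phi := phi \o clip.

Hypothesis mF : forall i, measurable_fun setT (F i).
Hypothesis mPhi : measurable_fun setT Phi.

Definition birkhoff (n : nat) (w : T) : R := \sum_(k < n.+1) Phi (X k w).

(** The generating system of the sigma-algebra of [X 0], ..., [X n]. Turning it into a measurable
    type lets the usual closure rules show that [birkhoff n] depends on the past only. *)
Let past n : set (set T) :=
  \big[setU/set0]_(i < n.+1) preimage_set_system setT (X i : T -> R) measurable.

Let measurable_past n (k : 'I_n.+1) :
  measurable_fun setT (X k : g_sigma_algebraType (past n) -> R).
Proof.
move=> _ A mA; apply: sub_sigma_algebra.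
rewrite /past -bigcup_mkord_ord; exists k => //=.
have -> : inord k = k by apply/val_inj; rewrite /= inordK.
by exists A.
Qed.

Let birkhoff_past n (C : set R) : measurable C ->
  g_sigma_preimage (fun k : 'I_n.+1 => (X k : T -> R)) (birkhoff n @^-1` C).
Proof.
move=> mC.
have mS : measurable_fun setT (birkhoff n : g_sigma_algebraType (past n) -> R).
  by apply: measurable_sum => k; exact: measurableT_comp.
by have := mS measurableT C mC; rewrite setTI.
Qed.

Let measurable_birkhoff n : measurable_fun setT (birkhoff n).
Proof. by apply: measurable_sum => k; exact: measurableT_comp. Qed.

Let X01 n w : I01 (X n w). Proof. by case: hX => h _ _; exact: h. Qed.

Let transitionE n w (A : set R) : measurable A ->
  transition f p (X n w) A = (\sum_(i < N) (p i)%:E * (\1_(F i @^-1` A) (X n w))%:E)%E.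
Proof.
move=> mA; apply: eq_bigr => i _; congr (_ * _)%E.
rewrite /dirac !indicE; congr (_%:R%:E); congr (nat_of_bool _).
have FE : F i (X n w) = f i (X n w) by rewrite /F /= clip_id.
apply/idP/idP; rewrite !inE /preimage /= FE => h; first by case: h.
by split => //; exact: X01.
Qed.

Let pairX n : {mfun T >-> (R * R)%type} :=
  mfun_Sub (mem_set (measurable_fun_pair (measurable_birkhoff n)
    (measurable_funPT (X n.+1)))).

Let pairF n i : {mfun T >-> (R * R)%type} :=
  mfun_Sub (mem_set (measurable_fun_pair (measurable_birkhoff n)
    (measurableT_comp (mF i) (measurable_funPT (X n))))).

(** The Markov property for the event, measurable with respect to the past, that [birkhoff n] lies
    in C. *)
Let one_step_rect n (C A : set R) : measurable C -> measurable A ->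
  distribution Pr (pairX n) (C `*` A) =
  (\sum_(i < N) (p i)%:E * distribution Pr (pairF n i) (C `*` A))%E.
Proof.
move=> mC mA; set B := birkhoff n @^-1` C.
have mB : measurable B by rewrite -[B]setTI; exact: measurable_birkhoff.
have mFA i : measurable (F i @^-1` A) by rewrite -[_ @^-1` _]setTI; exact: mF.
have mXFA i : measurable (X n @^-1` (F i @^-1` A)).
  by rewrite -[_ @^-1` (_ @^-1` _)]setTI; exact: measurable_funPT.
have [_ _ hmarkov] := hX.
have -> : distribution Pr (pairX n) (C `*` A) = Pr (B `&` X n.+1 @^-1` A) by [].
rewrite hmarkov //; last exact: birkhoff_past.
under eq_integral do rewrite transitionE //.
rewrite ge0_integral_sum //; last 2 first.
- move=> i; apply: emeasurable_funM => //; apply/measurable_EFinP.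
  by apply: measurableT_comp => //; exact: measurable_funTS.
- by move=> i w _; rewrite mule_ge0 ?lee_fin ?weight_ge0.
apply: eq_bigr => i _; rewrite ge0_integralZl_EFin ?weight_ge0 //; last first.
  apply/measurable_EFinP; apply: measurableT_comp => //; exact: measurable_funTS.
congr (_ * _)%E.
under eq_integral do rewrite -[\1_ _ _]/(\1_(X n @^-1` (F i @^-1` A)) _).
rewrite integral_indic // setIC.
by [].
Qed.

(** Rectangles form a generating system stable under intersection, so two probabilities that agree
    on them coincide. *)
Let one_step n (E : set (R * R)) : measurable E ->
  distribution Pr (pairX n) E =
  (\sum_(i < N) (p i)%:E * distribution Pr (pairF n i) E)%E.
Proof.
move=> mE; rewrite -(mixtureE hp (fun i => distribution Pr (pairF n i))).
apply: (measure_unique [set A `*` B | A in measurable & B in measurable] (fun=> setT)) => //.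
- exact: measurable_prod_measurableType.
- move=> _ _ [A mA [B mB <-]] [A' mA' [B' mB' <-]].
  by rewrite -setXI; exists (A `&` A'); [exact: measurableI|
    exists (B `&` B') => //; exact: measurableI].
- by move=> _; exists setT => //; exists setT => //; rewrite setXTT.
- by rewrite bigcup_const.
- by move=> _ [A mA [B mB <-]];
  exact: (etrans (one_step_rect n mA mB) (esym (mixtureE _ _ _))).
- by move=> _; apply: le_lt_trans (probability_le1 _ _) (ltry _).
Qed.

Let T' := avg p (skew F Phi).

Let measurable_skew i : measurable_fun setT (skew F Phi i).
Proof.
apply: measurable_fun_pair => /=.
  apply: measurable_funD; first exact: measurable_fst.
  by apply: measurableT_comp => //; apply: measurableT_comp => //; exact: measurable_snd.
by apply: measurableT_comp => //; exact: measurable_snd.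
Qed.

Let measurable_avg (G : R * R -> R) : measurable_fun setT G -> measurable_fun setT (T' G).
Proof.
move=> mG; apply: measurable_sum => i; apply: measurable_funM => //.
exact: measurableT_comp.
Qed.

Lemma measurable_iter_avg n (G : R * R -> R) : measurable_fun setT G ->
  measurable_fun setT (iter n T' G).
Proof. by move=> mG; elim: n => //= n; exact: measurable_avg. Qed.

Let integral_step n (G : R * R -> R) : measurable_fun setT G -> (forall z, 0 <= G z) ->
  (\int[Pr]_w (G (birkhoff n.+1 w, X n.+1 w))%:E =
   \int[Pr]_w (T' G (birkhoff n w, X n w))%:E)%E.
Proof.
move=> mG G0.
(* Recovers the pair at time n + 1 from ([birkhoff n], [X n.+1]). *)
pose H (z : R * R) := G (z.1 + Phi z.2, z.2).
have mH : measurable_fun setT (fun z => (H z)%:E).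
  apply/measurable_EFinP; apply: measurableT_comp => //.
  apply: measurable_fun_pair; last exact: measurable_snd.
  apply: measurable_funD; first exact: measurable_fst.
  by apply: measurableT_comp => //; exact: measurable_snd.
have H0 z : (0 <= (H z)%:E)%E by rewrite lee_fin /H.
transitivity (\int[distribution Pr (pairX n)]_z (H z)%:E)%E.
  rewrite ge0_integral_distribution //; apply: eq_integral => w _ /=.
  by rewrite /H /birkhoff big_ord_recr.
rewrite (ge0_integral_mixture hp (m := fun i => distribution Pr (pairF n i))
  (one_step n)) //.
under [RHS]eq_integral do rewrite /T' /avg -sumEFin.
rewrite ge0_integral_sum //; last 2 first.
- move=> i; apply/measurable_EFinP; apply: measurable_funM => //.
  apply: measurableT_comp => //; apply: measurableT_comp => //.
  by apply: measurable_fun_pair => //; exact: measurable_birkhoff.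
- by move=> i w _; rewrite lee_fin mulr_ge0 ?weight_ge0.
apply: eq_bigr => i _; rewrite ge0_integral_distribution //.
under [RHS]eq_integral do rewrite EFinM.
rewrite ge0_integralZl_EFin ?weight_ge0 //.
- by move=> w _; rewrite lee_fin.
- apply/measurable_EFinP; apply: measurableT_comp => //; apply: measurableT_comp => //.
  by apply: measurable_fun_pair => //; exact: measurable_birkhoff.
Qed.

(** From here on only the law of [X 0] and the averaging operator matter. The induction generalises
    [G] because it peels off the last step. *)
Theorem integral_birkhoff n (G : R * R -> R) : measurable_fun setT G ->
  (forall z, 0 <= G z) ->
  (\int[Pr]_w (G (birkhoff n w, X n w))%:E =
   \int[distribution Pr (X 0%N)]_x (iter n T' G (Phi x, x))%:E)%E.
Proof.
move=> mG G0; have iter0 k z : 0 <= iter k T' G z.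
  exact: (iter_avg_ge0 hp (D := fun=> True)).
transitivity (\int[Pr]_w (iter n T' G (birkhoff 0 w, X 0%N w))%:E)%E.
  elim: n G mG G0 {iter0} => [//|n IH] G mG G0.
  rewrite integral_step // IH; first by under eq_integral do rewrite -iterSr.
    exact: measurable_avg.
  by move=> z; apply: sumr_ge0 => i _; rewrite mulr_ge0 ?weight_ge0.
rewrite ge0_integral_distribution //.
- by apply: eq_integral => w _ /=; rewrite /birkhoff big_ord_recl big_ord0 addr0.
- apply/measurable_EFinP; apply: measurableT_comp; first exact: measurable_iter_avg.
  by apply: measurable_fun_pair.
- by move=> x; rewrite lee_fin.
Qed.

End chain_law.

(** * Verification of the hypotheses for an admissible system *)

Section interval_homeomorphisms.
Context {R : realType}.
Implicit Types (f : R -> R) (x y c : R).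

Lemma I01E x : I01 x <-> 0 <= x <= 1.
Proof. by rewrite /I01 /= in_itv /=. Qed.

Lemma in01_I01 x : in01 x -> I01 x.
Proof. by move=> /andP[x0 x1]; apply/I01E; rewrite !ltW. Qed.

Let I0 : I01 (0 : R). Proof. by apply/I01E; rewrite lexx ler01. Qed.
Let I1 : I01 (1 : R). Proof. by apply/I01E; rewrite lexx ler01. Qed.

Lemma Hplus_I01 f : Hplus f -> forall x, I01 x -> I01 (f x).
Proof. by move=> [[[hf _ _] _ _] _ _ _] x hx; exact: hf. Qed.

Lemma Hplus_homo f : Hplus f -> forall x y, I01 x -> I01 y -> x < y -> f x < f y.
Proof. by move=> [_ h _ _] x y hx hy; apply: h; exact: mem_set. Qed.

Lemma Hplus0 f : Hplus f -> f 0 = 0.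
Proof.
move=> hf; have [[[_ _ sf] _ _] _ _ _] := hf.
have [x hx fx] := sf 0 I0.
have [x0 _] := andP ((I01E x).1 hx).
move: x0; rewrite le_eqVlt => /predU1P[x0|x0]; first by move: fx; rewrite -x0.
have := Hplus_homo hf I0 hx x0; rewrite fx ltNge.
by have /I01E /andP[-> ] := Hplus_I01 hf I0.
Qed.

Lemma Hplus1 f : Hplus f -> f 1 = 1.
Proof.
move=> hf; have [[[_ _ sf] _ _] _ _ _] := hf.
have [x hx fx] := sf 1 I1.
have [_ x1] := andP ((I01E x).1 hx).
move: x1; rewrite le_eqVlt => /predU1P[x1|x1]; first by move: fx; rewrite x1.
have := Hplus_homo hf hx I1 x1; rewrite fx ltNge.
by have /I01E /andP[_ -> ] := Hplus_I01 hf I1.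
Qed.

Lemma Hplus_in01 f : Hplus f -> forall x, in01 x -> in01 (f x).
Proof.
move=> hf x hx; have /andP[x0 x1] := hx; have Ix := in01_I01 hx.
apply/andP; split; first by rewrite -[ltLHS](Hplus0 hf) Hplus_homo.
by rewrite -[ltRHS](Hplus1 hf) Hplus_homo.
Qed.

Lemma Hplus_continuous f : Hplus f -> forall x, in01 x -> {for x, continuous f}.
Proof.
move=> [[_ cf _] _ _ _] x hx.
have /(continuous_within_itvP _ ltr01)[h _ _] := cf.
by apply: h; rewrite in_itv.
Qed.

Let near_diff_quotient f a c : C1_near f a -> I01 a -> c < deriv01 f a ->
  exists2 d, 0 < d & forall y, `|a - y| < d -> y != a -> I01 y ->
    c < (f y - f a) / (y - a).
Proof.
move=> [V Va [dV _]] Ia ca.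
have cv : derivable01 f a by apply: dV; split => //; exact: nbhs_singleton.
have : nbhs a [set y | y != a -> I01 y -> c < diff_quotient f a y].
  exact: (cvgr_gt _ cv _ ca).
move=> /nbhs_ballP[d /= d0 hd].
by exists d => // y yd ya Iy; exact: hd.
Qed.

Lemma Hplus_repel0 f c : Hplus f -> c < deriv01 f 0 ->
  exists2 d, 0 < d & forall x, 0 < x < d -> x < 1 -> c * x <= f x.
Proof.
move=> hf cd; have [_ _ h0 _] := hf.
have [d d0 hd] := near_diff_quotient h0 I0 cd.
exists d => // x /andP[x0 xd] x1.
have := hd x; rewrite (Hplus0 hf) !subr0 sub0r normrN gtr0_norm //.
move=> /(_ xd (lt0r_neq0 x0)) h; apply: ltW; rewrite -ltr_pdivlMr //; apply: h.
by apply/I01E; rewrite !ltW.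
Qed.

Lemma Hplus_repel1 f c : Hplus f -> c < deriv01 f 1 ->
  exists2 d, 0 < d & forall x, 0 < x < d -> x < 1 -> c * x <= 1 - f (1 - x).
Proof.
move=> hf cd; have [_ _ _ h1] := hf.
have [d d0 hd] := near_diff_quotient h1 I1 cd.
exists d => // x /andP[x0 xd] x1.
have := hd (1 - x); rewrite (Hplus1 hf) subKr (gtr0_norm x0).
have n1 : 1 - x != 1 by rewrite lt_eqF // gtrBl.
move=> /(_ xd n1) h; apply: ltW; rewrite -ltr_pdivlMr //.
rewrite (_ : (1 - f (1 - x)) / x = (f (1 - x) - 1) / (1 - x - 1)); last first.
  by rewrite (_ : 1 - x - 1 = - x) ?invrN ?mulrN -?mulNr ?opprB //; ring.
by apply: h; apply/I01E; apply/andP; split; lra.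
Qed.

End interval_homeomorphisms.

Section admissible.
Context {R : realType} {N : nat}.
Variables (f : 'I_N -> R -> R) (p : 'I_N -> R).
Hypothesis hIFS : admissible_IFS f p.

Definition clipped i : R -> R := f i \o clip.

Lemma clipped_in01E i x : in01 x -> clipped i x = f i x.
Proof. by move=> hx; rewrite /clipped /= clip_id //; exact: in01_I01. Qed.

Lemma admissible_weights : prob_weights p.
Proof. by case: hIFS. Qed.

Let hf i : Hplus (f i). Proof. by case: hIFS. Qed.

Lemma clipped_in01 i x : in01 x -> in01 (clipped i x).
Proof. by move=> hx; rewrite clipped_in01E //; exact: Hplus_in01. Qed.

Lemma clipped_incr i : incr01 (clipped i).
Proof.
move=> x y hx hy; rewrite !clipped_in01E // le_eqVlt => /predU1P[-> //|xy].
by apply/ltW/Hplus_homo => //; exact: in01_I01.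
Qed.

Lemma clipped_measurable i : measurable_fun setT (clipped i).
Proof. by apply: measurable_comp_clip; have [[_ cf _] _ _ _] := hf i. Qed.

Lemma clipped_splitting : splitting p clipped.
Proof.
have [_ _ ud _ _] := hIFS.
apply: (splittingP admissible_weights clipped_in01 clipped_incr).
  move=> i x hx; have h := Hplus_continuous (hf i) hx.
  change (clipped i y @[y --> x] --> clipped i x).
  rewrite clipped_in01E //; apply: cvg_trans h.
  apply: near_eq_cvg; near=> y; apply/esym/clipped_in01E.
  near: y.
  have : x \in `]0, 1[ by rewrite in_itv.
  move=> /near_in_itvoo; apply: filterS => y; by rewrite in_itv.
by move=> x hx; have [i [j h]] := ud x hx; exists i, j; rewrite !clipped_in01E.
Unshelve. all: by end_near. Qed.

Lemma admissible_lyapunov :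
  exists al be, lyapunov p clipped (endpoint_weight al be).
Proof.
have [_ _ _ pos [s0 s1]] := hIFS.
apply: (lyapunov_endpoint_weight admissible_weights clipped_in01 clipped_incr
    (fun i => (pos i).1) s0 (fun i => (pos i).2) s1).
  move=> i c /(Hplus_repel0 (hf i))[d d0 hd].
  exists (Num.min d 1); first by rewrite lt_min d0 ltr01.
  move=> x; rewrite lt_min => /and3P[x0 xd x1].
  by rewrite clipped_in01E ?hd ?x0 //; apply/andP.
move=> i c /(Hplus_repel1 (hf i))[d d0 hd].
exists (Num.min d 1); first by rewrite lt_min d0 ltr01.
move=> x; rewrite lt_min => /and3P[x0 xd x1].
by rewrite /flip clipped_in01E ?hd ?x0 //; apply/andP; split; lra.
Qed.

End admissible.

(** * Integrals against laws carried by (0,1) *)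

Section integrals_over_open_interval.
Context {R : realType}.
Variable (P0 : probability R R).
Hypothesis null : P0 (~` [set x | in01 x]) = 0%E.

Lemma measurable_in01 : measurable [set x : R | in01 x].
Proof.
rewrite (_ : [set x | in01 x] = `]0, 1[%classic); first exact: measurable_itv.
by apply/seteqP; split => x; rewrite /= in_itv.
Qed.

Lemma ae_in01 (Q : R -> Prop) : (forall x, in01 x -> Q x) -> {ae P0, forall x, Q x}.
Proof.
move=> hQ; exists (~` [set x | in01 x]); split => //.
  by apply: measurableC; exact: measurable_in01.
by move=> x /= nQ hx; apply: nQ; exact: hQ.
Qed.

Lemma le_integral_in01 (g h : R -> R) : measurable_fun setT g -> measurable_fun setT h ->
  (forall x, 0 <= g x) -> (forall x, 0 <= h x) -> (forall x, in01 x -> g x <= h x) ->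
  (\int[P0]_x (g x)%:E <= \int[P0]_x (h x)%:E)%E.
Proof.
move=> mg mh g0 h0 gh; apply: ae_ge0_le_integral => //.
- by move=> x _; rewrite lee_fin.
- exact/measurable_EFinP.
- by move=> x _; rewrite lee_fin.
- exact/measurable_EFinP.
- by apply: ae_in01 => x hx _; rewrite lee_fin gh.
Qed.

(** As [q] is merely nonnegative, finiteness of its integral is part of the conclusion. The absolute
    value of [W] appears because estimates on [W] are available on (0,1) only. *)
Lemma integral_close (q W : R -> R) (L e w : R) : measurable_fun setT q ->
  measurable_fun setT W -> (forall x, 0 <= q x) -> 0 <= L -> 0 <= e ->
  (forall x, in01 x -> `|q x - L| <= e * `|W x|) ->
  (\int[P0]_x `|W x|%:E = w%:E)%E ->
  exists2 r : R, (\int[P0]_x (q x)%:E = r%:E)%E & `|r - L| <= e * w.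
Proof.
move=> mq mW q0 L0 e0 hq hw.
have mnW : measurable_fun setT (fun x => e * `|W x|).
  by apply: measurable_funM => //; exact: measurableT_comp.
have eW0 x : 0 <= e * `|W x| by rewrite mulr_ge0.
have cst_int c : (\int[P0]_x c%:E = c%:E)%E.
  by rewrite integral_cst // [X in (_ * X)%E](@probability_setT _ _ _ P0) mule1.
have eWint : (\int[P0]_x (e * `|W x|)%:E = (e * w)%:E)%E.
  under eq_integral do rewrite EFinM.
  rewrite ge0_integralZl_EFin //; first by rewrite hw.
  by apply/measurable_EFinP; exact: measurableT_comp.
have hup : (\int[P0]_x (q x)%:E <= (L + e * w)%:E)%E.
  rewrite EFinD -eWint -[X in (X + _)%E](cst_int L).
  rewrite -ge0_integralD; [|exact: measurableT|by move=> x _; rewrite lee_fin|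
    by apply/measurable_EFinP|by move=> x _; rewrite lee_fin|by apply/measurable_EFinP].
  apply: (@le_integral_in01 q (fun x => L + e * `|W x|)) => //.
  - exact: measurable_funD.
  - by move=> x; rewrite addr_ge0.
  - by move=> x /hq; rewrite ler_norml; lra.
have hdn : (L%:E <= \int[P0]_x (q x)%:E + (e * w)%:E)%E.
  rewrite -eWint -[X in (X <= _)%E](cst_int L).
  rewrite -ge0_integralD; [|exact: measurableT|by move=> x _; rewrite lee_fin|
    by apply/measurable_EFinP|by move=> x _; rewrite lee_fin|by apply/measurable_EFinP].
  apply: (@le_integral_in01 (fun=> L) (fun x => q x + e * `|W x|)) => //.
  - exact: measurable_funD.
  - by move=> x; rewrite addr_ge0.
  - by move=> x /hq; rewrite ler_norml; lra.
have i0 : (0 <= \int[P0]_x (q x)%:E)%E by apply: integral_ge0 => x _; rewrite lee_fin.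
move: hup hdn i0; case: (\int[P0]_x (q x)%:E)%E => [r| |] //.
rewrite -EFinD !lee_fin => hup hdn i0; exists r => //.
by rewrite ler_norml; apply/andP; split; lra.
Qed.

End integrals_over_open_interval.

(** * The invariant measure: means and integrability of the weight *)

Section invariant_measure.
Context {R : realType} {N : nat}.
Variables (f : 'I_N -> R -> R) (p : 'I_N -> R) (mu : probability R R).
Hypothesis hIFS : admissible_IFS f p.
Hypothesis hmu : prob_on_open01 mu.
Hypothesis hinv : invariant_measure f p mu.

Local Notation F := (clipped f).
Local Notation U := (avg p F).
Let hp := admissible_weights hIFS.
Let F01 := clipped_in01 hIFS.

Lemma prob_I01C : mu (~` I01) = 0%E.
Proof. by rewrite probability_setC ?hmu.1 ?subee //; exact: measurable_I01. Qed.

Lemma prob_I01I (B : set R) : measurable B -> mu (I01 `&` B) = mu B.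
Proof.
move=> mB; have mI := @measurable_I01 R.
have mIB : measurable (I01 `&` B) by exact: measurableI.
have mIC : measurable (~` I01 : set R) by exact: measurableC.
apply/eqP; rewrite eq_le le_measure ?inE //=.
apply: (@le_trans _ _ (mu ((I01 `&` B) `|` ~` I01))).
  apply: le_measure; rewrite ?inE //; first exact: measurableU.
  by move=> x Bx; have [Ix|Ix] := pselect (I01 x); [left|right].
by apply: le_trans (measureU2 _ mIB mIC) _; rewrite [X in (_ + X)%E]prob_I01C adde0.
Qed.

Lemma prob_in01C : mu (~` [set x | in01 x]) = 0%E.
Proof.
have m0 := prob_I01C; have m1 := hmu.2; have mI := @measurable_I01 R.
apply/eqP; rewrite eq_le measure_ge0 andbT.
apply: (@le_trans _ _ (mu (~` I01 `|` [set 0; 1]))).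
  apply: le_measure; rewrite ?inE.
  - by apply: measurableC; exact: measurable_in01.
  - by apply: measurableU; [exact: measurableC|exact: measurableU].
  - move=> x /= nx; have [/I01E/andP[]|] := pselect (I01 x); last by left.
    rewrite !le_eqVlt => /predU1P[<- _|x0 /predU1P[->|x1]]; [by right; left|by right; right|].
    by case: nx; rewrite /in01 x0.
apply: le_trans (measureU2 _ _ _) _.
- exact: measurableC.
- exact: measurableU.
- by rewrite [X in (X + _)%E]m0 [X in (_ + X)%E]m1 adde0.
Qed.

Let Fm i : {mfun R >-> R} := mfun_Sub (mem_set (clipped_measurable hIFS i)).

Let invariantE A : measurable A ->
  mu A = (\sum_(i < N) (p i)%:E * distribution mu (Fm i) A)%E.
Proof.
move=> mA; rewrite -(hinv mA); apply: eq_bigr => i _; congr (_ * _)%E.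
have mB : measurable (F i @^-1` A) by have := clipped_measurable hIFS i measurableT mA; rewrite setTI.
rewrite -[RHS](prob_I01I mB); congr (mu _); apply/seteqP.
by split => x [Ix Ax]; split => //; move: Ax; rewrite /preimage /clipped /= (clip_id Ix).
Qed.

Lemma measurable_avg (G : R -> R) : measurable_fun setT G -> measurable_fun setT (U G).
Proof.
move=> mG; apply: measurable_sum => i; apply: measurable_funM => //.
by apply: measurableT_comp => //; exact: (clipped_measurable hIFS).
Qed.

Lemma measurable_iterU n (G : R -> R) : measurable_fun setT G ->
  measurable_fun setT (iter n U G).
Proof. by move=> mG; elim: n => //= n; exact: measurable_avg. Qed.

Lemma invariant_iter n (G : R -> R) : measurable_fun setT G -> (forall x, 0 <= G x) ->
  (\int[mu]_x (iter n U G x)%:E = \int[mu]_x (G x)%:E)%E.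
Proof.
move=> mG G0; elim: n => //= n <-.
have mH := measurable_iterU n mG.
have H0 x : 0 <= iter n U G x by exact: (iter_avg_ge0 hp (D := fun=> True)).
have mHE : measurable_fun setT (fun x => (iter n U G x)%:E) by apply/measurable_EFinP.
have H0E x : (0 <= (iter n U G x)%:E)%E by rewrite lee_fin.
rewrite [RHS](ge0_integral_mixture hp (m := fun i => distribution mu (Fm i)) invariantE mHE H0E).
under eq_integral do rewrite {1}/avg -sumEFin.
rewrite ge0_integral_sum //; last 2 first.
- move=> i; apply/measurable_EFinP; apply: measurable_funM => //.
  by apply: measurableT_comp => //; exact: (clipped_measurable hIFS).
- by move=> i x _; rewrite lee_fin mulr_ge0 ?(weight_ge0 hp).
apply: eq_bigr => i _; rewrite [in RHS](ge0_integral_distribution (Fm i) mHE H0E).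
under eq_integral do rewrite EFinM.
rewrite ge0_integralZl_EFin ?(weight_ge0 hp) //.
by apply/measurable_EFinP; apply: measurableT_comp => //; exact: (clipped_measurable hIFS).
Qed.

(** By invariance all U^n G have integral 0, and by dominated convergence these integrals tend to
    [c]. The shift by [K] is made because [invariant_iter] is for nonnegative functions. *)
Lemma limit_mean (G : R -> R) (K c : R) : measurable_fun setT G ->
  (forall x, `|G x| <= K) -> (\int[mu]_(x in I01) (G x)%:E = 0)%E ->
  (forall x, in01 x -> iter n U G x @[n --> \oo] --> c) -> c = 0.
Proof.
move=> mG GK hmean hlim.
pose H x := G x + K.
have mH : measurable_fun setT H by exact: measurable_funD.
have H0 x : 0 <= H x by rewrite /H; have := GK x; rewrite ler_norml; lra.
have iterH n : iter n U H = fun x => iter n U G x + K.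
  by rewrite (iter_avgD p F n G (fun=> K)) (iter_avg_cst hp).
have HK x : H x <= 2 * K by rewrite /H; have := GK x; rewrite ler_norml; lra.
have iterHK n x : (`|(iter n U H x)%:E| <= (2 * K)%R%:E)%E.
  rewrite /= lee_fin ger0_norm; last exact: (iter_avg_ge0 hp (D := fun=> True)).
  have := iter_avg_le hp (F := F) (D := fun=> True) (fun _ _ _ => I) n (h := fun=> 2 * K) (fun x _ => HK x) (s := x) I.
  by rewrite (iter_avg_cst hp).
have cst_int e : (\int[mu]_x e%:E = e%:E)%E.
  by rewrite integral_cst // [X in (_ * X)%E](@probability_setT _ _ _ mu) mule1.
have GI : mu.-integrable setT (EFin \o G) by exact: bounded_integrable GK.
have G0 : (\int[mu]_x (G x)%:E = 0)%E.
  rewrite (negligible_integral _ _ _ prob_I01C) //.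
  - by rewrite setTD setCK.
  - by apply: measurableC; exact: measurable_I01.
have intH : (\int[mu]_x (H x)%:E = K%:E)%E.
  under eq_integral do rewrite EFinD.
  rewrite integralD_EFin //; first by rewrite G0 cst_int add0e.
  by apply: (@bounded_integrable _ _ _ _ _ `|K|).
have ac : {ae mu, forall x, setT x -> (iter n U H x)%:E @[n --> \oo] --> (c + K)%R%:E}.
  apply: (ae_in01 prob_in01C) => x hx _; apply: cvg_EFin; first by near=> n.
  under eq_fun do rewrite iterH.
  by apply: cvgD; [exact: hlim|exact: cvg_cst].
have ad : {ae mu, forall x n, setT x -> (`|(iter n U H x)%:E| <= (2 * K)%R%:E)%E}.
  by apply: aeW => x n _; exact: iterHK.
have KI : mu.-integrable setT (fun=> (2 * K)%R%:E).
  by apply: (@bounded_integrable _ _ _ _ (cst (2 * K)) `|2 * K|).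
have mn n : measurable_fun setT (fun x => (iter n U H x)%:E).
  by apply/measurable_EFinP; exact: measurable_iterU.
have mc : measurable_fun setT (fun _ : R => (c + K)%R%:E) by exact: measurable_cst.
have [_ _] := dominated_convergence measurableT mn mc ac KI ad.
rewrite cst_int; under eq_fun do rewrite (invariant_iter _ mH H0) intH.
move=> h; have e1 : limn (fun=> K%:E) = (c + K)%R%:E by apply: cvg_lim.
have [] : K%:E = (c + K)%R%:E by rewrite -e1; apply/esym/cvg_lim => //; exact: cvg_cst.
by move=> hK; lra.
Unshelve. all: by end_near. Qed.

(** The drift inequality cannot be integrated before [W] is known to be integrable, so [W] is
    truncated at M. Invariance and n steps of drift bound the integral of min(W, M) by K1 plus that
    of min(gam^n W, M), which tends to 0 with n; then M tends to infinity by monotone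
    convergence. *)
Lemma invariant_lyapunov_integrable (W : R -> R) : measurable_fun setT W ->
  lyapunov p F W -> exists w : R, (\int[mu]_x `|W x|%:E = w%:E)%E.
Proof.
move=> mW [W1 _ [gam [K [/andP[g0 g1] K0 dW]]]].
pose K1 := K / (1 - gam).
have K10 : 0 <= K1 by rewrite divr_ge0 // subr_ge0 ltW.
pose a x := `|W x|.
have ma : measurable_fun setT a by exact: measurableT_comp.
have aE x : in01 x -> a x = W x.
  by move=> hx; rewrite /a ger0_norm // (le_trans ler01) // W1.
have mmin M : measurable_fun setT (fun x => Num.min (a x) M) by exact: measurable_minr.
have trunc (M : R) : 0 <= M -> (\int[mu]_x (Num.min (a x) M)%:E <= K1%:E)%E.
  move=> M0.
  pose J n x := Num.min (gam ^+ n * a x) M.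
  have mJ n : measurable_fun setT (J n).
    by apply: measurable_minr => //; exact: measurable_funM.
  have J0 n x : 0 <= J n x by rewrite le_min M0 andbT mulr_ge0 ?exprn_ge0 ?normr_ge0.
  have JM n x : `|J n x| <= M by rewrite ger0_norm // ge_min lexx orbT.
  have min0 x : 0 <= Num.min (a x) M by rewrite le_min M0 andbT normr_ge0.
  have step n : (\int[mu]_x (Num.min (a x) M)%:E <= (K1 + \int[mu]_x J n x)%R%:E)%E.
    rewrite -(invariant_iter n (mmin M) min0) EFinD.
    rewrite -(integral_EFin_Rintegral mu (mJ n) (JM n)).
    have -> : K1%:E = (\int[mu]_x K1%:E)%E.
      by rewrite integral_cst // [X in (_ * X)%E](@probability_setT _ _ _ mu) mule1.
    rewrite -ge0_integralD; [|exact: measurableT|by move=> x _; rewrite lee_fin|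
      by apply/measurable_EFinP|by move=> x _; rewrite lee_fin|by apply/measurable_EFinP].
    apply: (@le_integral_in01 _ mu prob_in01C _ (fun x => K1 + J n x)) => //.
    - exact: measurable_iterU.
    - exact: measurable_funD.
    - by move=> x; exact: (iter_avg_ge0 hp (D := fun=> True)).
    - by move=> x; rewrite addr_ge0.
    move=> x hx; rewrite /J -lerBlDl le_min; apply/andP; split.
      rewrite lerBlDr aE //.
      have hdr : iter n U W x <= gam ^+ n * W x + K1.
        by apply: (iter_drift hp F01) => //; rewrite g0 g1.
      apply: le_trans hdr.
      by apply: (iter_avg_le hp F01) => // y hy; rewrite aE // ge_min lexx.
    rewrite lerBlDr; apply: (@le_trans _ _ M); last by rewrite lerDl.
    have := iter_avg_le hp F01 n (g := fun x => Num.min (a x) M) (h := fun=> M) _ hx.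
    by rewrite (iter_avg_cst hp); apply => y _; rewrite ge_min lexx orbT.
  have Jc : \int[mu]_x J n x @[n --> \oo] --> (0 : R).
    have ac : {ae mu, forall x, setT x -> (J n x)%:E @[n --> \oo] --> 0%E}.
      apply: aeW => x _; apply: cvg_EFin; first by near=> n.
      apply: (@squeeze_cvgr _ _ _ _ (fun=> 0) (fun n => gam ^+ n * a x)).
      - by near=> n; rewrite J0 ge_min lexx.
      - exact: cvg_cst.
      - rewrite -[X in _ --> X](mul0r (a x)); apply: cvgM; last exact: cvg_cst.
        by apply: cvg_expr; rewrite ger0_norm.
    have ad : {ae mu, forall x n, setT x -> (`|(J n x)%:E| <= M%:E)%E}.
      by apply: aeW => x n _; rewrite /= lee_fin.
    have KI : mu.-integrable setT (fun=> M%:E).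
      by apply: (@bounded_integrable _ _ _ _ (cst M) `|M|).
    have mn n : measurable_fun setT (fun x => (J n x)%:E) by exact/measurable_EFinP.
    have m0 : measurable_fun setT (fun _ : R => 0%E : \bar R) by exact: measurable_cst.
    have [_ _] := dominated_convergence measurableT mn m0 ac KI ad.
    rewrite integral0.
    under eq_fun do rewrite (integral_EFin_Rintegral mu (mJ _) (JM _)).
    by move=> /fine_cvgP[].
  have -> : (\int[mu]_x (Num.min (a x) M)%:E =
      (\int[mu]_x Num.min (a x) M)%R%:E)%E.
    apply: (integral_EFin_Rintegral mu (M := M)) => // x.
    by rewrite ger0_norm // ge_min lexx orbT.
  rewrite lee_fin -[leRHS]addr0.
  have l : (fun n => K1 + \int[mu]_x J n x) @ \oo --> K1 + 0.
    by apply: cvgD => //; exact: cvg_cst.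
  apply: (cvgr_to_ge l); near=> n; have := step n.
  rewrite (integral_EFin_Rintegral mu (M := M)) ?lee_fin // => x.
  by rewrite ger0_norm // ge_min lexx orbT.
suff : (\int[mu]_x (a x)%:E <= K1%:E)%E.
  have : (0 <= \int[mu]_x (a x)%:E)%E by apply: integral_ge0 => x _; rewrite lee_fin normr_ge0.
  by rewrite /a; case: (\int[mu]_x _)%E => [w| |] // _ _; exists w.
have -> : (\int[mu]_x (a x)%:E = \int[mu]_x limn (fun n => (Num.min (a x) n%:R)%:E))%E.
  apply: eq_integral => x _; apply/esym/cvg_lim => //.
  apply: cvg_EFin; first by near=> n.
  apply: cvg_near_cst; near=> n; apply/min_idPl; near: n.
  exact: nbhs_infty_ger.
rewrite monotone_convergence //; last 3 first.
- by move=> n; exact/measurable_EFinP.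
- by move=> n x _; rewrite lee_fin le_min ?normr_ge0 ?ler0n.
- move=> x _ m n mn; rewrite lee_fin le_min ge_min lexx /= ge_min.
  by rewrite ler_nat mn orbT.
apply: lime_le.
  apply: ereal_nondecreasing_is_cvgn => m n mn; apply: ge0_le_integral => //.
  - by move=> x _; rewrite lee_fin le_min ?normr_ge0 ?ler0n.
  - exact/measurable_EFinP.
  - exact/measurable_EFinP.
  - move=> x _; rewrite lee_fin le_min ge_min lexx /= ge_min.
    by rewrite ler_nat mn orbT.
by near=> n; apply: trunc.
Unshelve. all: by end_near. Qed.

End invariant_measure.

(** * Lipschitz observables and the limit law *)

Section lipschitz_observable.
Context {R : realType}.
Variables (phi : R -> R) (L : R).
Hypothesis L0 : 0 <= L.
Hypothesis phiL : forall x y, I01 x -> I01 y -> `|phi x - phi y| <= L * `|x - y|.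

Lemma lipschitz_measurable_clip : measurable_fun setT (phi \o clip).
Proof.
apply: measurable_comp_clip; apply/subspace_continuousP => x Ix.
apply/cvgrPdist_lt => e e0; rewrite near_withinE.
have d0 : 0 < e / (L + 1) by rewrite divr_gt0 // ltr_wpDl.
near=> y => Iy; apply: le_lt_trans (phiL Ix Iy) _.
have : `|x - y| < e / (L + 1) by near: y; exact: (nbhsx_ballx x _ d0).
rewrite ltr_pdivlMr ?ltr_wpDl //; apply: le_lt_trans.
by rewrite mulrC ler_wpM2l // lerDl.
Unshelve. all: by end_near. Qed.

Lemma lipschitz_clip_bound x : `|(phi \o clip) x| <= `|phi 0| + L.
Proof.
have I0 : I01 (0 : R) by apply/I01E; rewrite lexx ler01.
have Ix := @clip_I01 R x.
have := phiL Ix I0; rewrite subr0 => h.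
have /I01E/andP[c0 c1] := Ix.
have h1 : L * `|clip x| <= L by rewrite -[leRHS]mulr1 ler_wpM2l // ger0_norm.
have := ler_normD (phi (clip x) - phi 0) (phi 0); rewrite subrK /=; lra.
Qed.

(* [phi] is the difference of the increasing functions [phi + L id] and [L id]. *)
Lemma lipschitz_bvar (V : R -> R) : (forall x, in01 x -> 1 <= V x) ->
  bvar V (phi \o clip).
Proof.
move=> V1; have V0 x : in01 x -> 0 <= V x by move/V1; apply: le_trans.
have pE x : in01 x -> (phi \o clip) x = phi x by move=> /in01_I01 Ix /=; rewrite clip_id.
apply: (@bvar_eq _ _ (fun x => ((phi \o clip) x + L * x) - L * x)).
  by move=> x _; rewrite addrK.
apply: bvarB.
- apply: (@bvar_incr _ _ _ (`|phi 0| + L + L)) => //.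
    move=> x y hx hy xy; rewrite !pE //.
    have := phiL (in01_I01 hx) (in01_I01 hy).
    by rewrite (ler0_norm (x := x - y)) ?subr_le0 // ler_norml; lra.
  move=> x hx; have /andP[x0 x1] := hx.
  rewrite -[leLHS]mulr1; apply: ler_pM => //; last exact: V1.
  apply: le_trans (ler_normD _ _) _; apply: lerD; first exact: lipschitz_clip_bound.
  by rewrite normrM (ger0_norm L0) (gtr0_norm x0) ler_piMr // ltW.
- apply: (@bvar_incr _ _ _ L) => //.
    by move=> x y _ _ xy; exact: ler_wpM2l.
  move=> x hx; have /andP[x0 x1] := hx; rewrite normrM (ger0_norm L0) (gtr0_norm x0).
  by rewrite ler_wpM2l // (le_trans (ltW x1)) // V1.
Qed.

End lipschitz_observable.

Lemma lipschitz_constant {R : realType} (phi : R -> R) :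
  [lipschitz phi x | x in (I01 : set R)] ->
  exists2 L : R, 0 <= L &
    forall x y, I01 x -> I01 y -> `|phi x - phi y| <= L * `|x - y|.
Proof.
move=> [M [_ hM]]; exists (`|M| + 1); first by rewrite addr_ge0.
move=> x y Ix Iy; apply: (hM _ _ (x, y)) => //.
by apply: le_lt_trans (ler_norm M) _; rewrite ltrDl.
Qed.

(** The image under the identity changes only the measurable structure on which the law is declared,
    so that it can be compared with laws on [R]. *)
Lemma centred_normal_probability {R : realType} (s : R) :
  exists Q : probability R R, forall h : R -> R, measurable_fun setT h ->
    (\int[centred_normal s]_y (h y)%:E = \int[Q]_y (h y)%:E)%E.
Proof.
rewrite /centred_normal; case: eqP => [_|/eqP s0]; first by exists \d_(0 : R).
have mid : @measurable_fun _ _ (measurableTypeR R) R setT id by exact: measurable_id.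
pose j : {mfun (measurableTypeR R) >-> R} := @mfun_Sub _ _ (measurableTypeR R) R id (mem_set mid).
by exists (distribution (normal_prob 0 s) j : probability R R).
Qed.

Lemma measurable_endpoint_weight {R : realType} (al be : R) :
  measurable_fun setT (endpoint_weight al be).
Proof.
apply: measurable_funD.
  apply: measurableT_comp; first exact: measurable_expR.
  by apply: measurable_funM => //; exact: measurable_ln.
apply: measurableT_comp; first exact: measurable_expR.
apply: measurable_funM => //; apply: measurableT_comp; first exact: measurable_ln.
exact: measurable_funB.
Qed.

Lemma cvg_inv_sqrt {R : realType} (c : R) : c / Num.sqrt n.+1%:R @[n --> \oo] --> (0 : R).
Proof.
have h : Num.sqrt (n.+1%:R^-1 : R) @[n --> \oo] --> Num.sqrt (0 : R).
  by apply: continuous_cvg; [exact: sqrt_continuous|exact: cvg_harmonic].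
rewrite -(mulr0 c); apply: cvgM; first exact: cvg_cst.
by under eq_fun do rewrite -sqrtrV //; rewrite sqrtr0 in h.
Qed.

(** * The central limit theorem for the chain *)

Section chain_clt.
Context {R : realType} {N : nat}.
Variables (f : 'I_N -> R -> R) (p : 'I_N -> R) (phi W : R -> R) (sg2 : R).
Hypothesis hIFS : admissible_IFS f p.
Hypothesis mPhi : measurable_fun setT (phi \o clip).
Hypothesis mW : measurable_fun setT W.
Hypothesis sg20 : 0 <= sg2.

Let Phi := phi \o clip.
Let T2 := avg p (skew (clipped f) Phi).
Let hp := admissible_weights hIFS.

Hypothesis heat_close : forall a b, 0 < b -> exists C, forall n x,
  (0 < n)%N -> in01 x ->
  `|iter n T2 (fun z => heat b (z.1 / Num.sqrt n%:R - a)) (Phi x, x) -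
    heat (b + sg2) (0 - a)| <= C * W x / Num.sqrt n%:R.
Hypothesis square_close : exists C, forall n x, (0 < n)%N -> in01 x ->
  `|iter n T2 (fun z => (z.1 / Num.sqrt n%:R) ^+ 2) (Phi x, x) - sg2| <=
    C * W x / Num.sqrt n%:R.

Context {d : measure_display} {T : measurableType d}.
Variables (Pr : probability T R) (X : nat -> {RV Pr >-> R}) (nu : set R -> \bar R).
Hypothesis hX : markov_chain f p nu X.
Hypothesis null : distribution Pr (X 0%N) (~` [set x | in01 x]) = 0%E.
Variable w : R.
Hypothesis hw : (\int[distribution Pr (X 0%N)]_x `|W x|%:E = w%:E)%E.

Local Notation S := (normalized_sum phi (fun n => (X n : T -> R))).

Let SE n u : S n u = birkhoff phi X n u / Num.sqrt n%:R.
Proof.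
rewrite /normalized_sum /birkhoff; congr (_ / _); apply: eq_bigr => k _ /=.
by rewrite clip_id //; case: hX => h _ _; exact: h.
Qed.

Let measurable_S n : measurable_fun setT (S n).
Proof.
rewrite (_ : S n = fun u => birkhoff phi X n u / Num.sqrt n%:R); last exact/funext.
apply: measurable_funM => //; apply: measurable_sum => k.
exact: measurableT_comp.
Qed.

Let mean_close (q : R -> R) (L C : R) : measurable_fun setT q -> (forall y, 0 <= q y) ->
  0 <= L ->
  (forall n x, (0 < n)%N -> in01 x ->
    `|iter n T2 (fun z => q (z.1 / Num.sqrt n%:R)) (Phi x, x) - L| <=
    C * W x / Num.sqrt n%:R) ->
  forall n, exists2 r, (\int[Pr]_u (q (S n.+1 u))%:E = r%:E)%E &
    `|r - L| <= `|C| * w / Num.sqrt n.+1%:R.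
Proof.
move=> mq q0 L0 hq n.
pose G (z : R * R) := q (z.1 / Num.sqrt n.+1%:R).
have mG : measurable_fun setT G.
  apply: measurableT_comp => //; apply: measurable_funM => //; exact: measurable_fst.
have G0 z : 0 <= G z by exact: q0.
have mF i : measurable_fun setT (clipped f i) := clipped_measurable hIFS i.
have eG := integral_birkhoff hp hX mF mPhi n.+1 mG G0.
have mI : measurable_fun setT (fun x => iter n.+1 T2 G (Phi x, x)).
  apply: (@measurableT_comp _ _ _ _ _ _ (iter n.+1 T2 G)).
    exact: (measurable_iter_avg p mF mPhi).
  exact: measurable_fun_pair.
have e0 : 0 <= `|C| / Num.sqrt n.+1%:R by rewrite divr_ge0.
have I0 x : 0 <= iter n.+1 T2 G (Phi x, x) by exact: (iter_avg_ge0 hp (D := fun=> True)).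
have hcl x : in01 x -> `|iter n.+1 T2 G (Phi x, x) - L| <= `|C| / Num.sqrt n.+1%:R * `|W x|.
  move=> hx; apply: le_trans (hq n.+1 x isT hx) _.
  rewrite [leRHS]mulrAC ler_wpM2r ?invr_ge0 // -normrM; exact: ler_norm.
have [r er hr] := integral_close null mI mW I0 L0 e0 hcl hw.
exists r; last by rewrite mulrAC.
by rewrite -er -eG; apply: eq_integral => u _; rewrite SE.
Qed.

Let mean_cvg (L C : R) (r : nat -> R) :
  (forall n, `|r n - L| <= C / Num.sqrt n.+1%:R) -> r n @[n --> \oo] --> L.
Proof.
move=> hr; apply/cvgrPdist_lt => e e0.
have c0 := @cvg_inv_sqrt R C.
near=> n; rewrite distrC; apply: le_lt_trans (hr n) _.
by near: n; exact: (cvgr_lt _ c0 _ e0).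
Unshelve. all: by end_near. Qed.

(** The initial law enters only through the integral [w] of the weight, so the stationary chain and
    the chain started at a point are treated alike. *)
Lemma chain_satisfies_CLT :
  satisfies_CLT phi (Num.sqrt sg2) Pr (fun n => (X n : T -> R)).
Proof.
have msq : measurable_fun setT (fun y : R => y ^+ 2) by exact: measurable_funX.
have [Csq hsq] := square_close.
have sq0 (y : R) : 0 <= y ^+ 2 by exact: sqr_ge0.
have sqc := mean_close msq sq0 sg20 hsq.
have C0 : 0 <= `|Csq| * w.
  rewrite mulr_ge0 // -lee_fin -hw; apply: integral_ge0 => x _.
  by rewrite lee_fin.
split.
  (* At n = 0 the normalisation divides by 0 and yields 0; the estimates start at n = 1, hence the
     shift. *)
  rewrite unlock sqr_sqrtr // -cvg_shiftS.
  have [r er] := choice (fun n => let: ex_intro2 a b c := sqc n in ex_intro _ a (conj b c)).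
  under eq_fun do rewrite (er _).1.
  apply: cvg_EFin; first by near=> n.
  by apply: mean_cvg => n; exact: (er n).2.
move=> g cg [K0 [_ hK]].
have gK x : `|g x| <= `|K0| + 1.
  apply: hK => //; apply: le_lt_trans (ler_norm K0) _; by rewrite ltrDl.
have [Q hQ] := centred_normal_probability (Num.sqrt sg2).
pose Y n : {mfun T >-> R} := mfun_Sub (mem_set (measurable_S n.+1)).
pose P n : probability R R := distribution Pr (Y n).
have PE n (h : R -> R) : measurable_fun setT h -> (forall y, 0 <= h y) ->
    (\int[P n]_y (h y)%:E = \int[Pr]_u (h (S n.+1 u))%:E)%E.
  move=> mh h0; rewrite (ge0_integral_distribution (Y n)) //.
  exact/measurable_EFinP.
have mg : measurable_fun setT g by exact: continuous_measurable_fun.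
rewrite unlock (hQ _ mg) (integral_EFin_Rintegral Q mg gK) -cvg_shiftS.
have gE n : (\int[Pr]_u ((g \o S n.+1) u)%:E = (\int[P n]_y g y)%R%:E)%E.
  rewrite -(integral_EFin_Rintegral (P n) mg gK).
  rewrite (integral_distribution (X := Y n)) //; first exact/measurable_EFinP.
  apply: (@bounded_integrable _ _ _ _ (g \o Y n) (`|K0| + 1)) => //.
    exact: measurableT_comp.
  by move=> x; exact: gK.
under eq_fun do rewrite gE.
apply: cvg_EFin; first by near=> n.
(* The constant bounds all second moments, since 1 / sqrt (n + 1) is at most 1. *)
apply: (@weak_cvg_of_gaussian _ P Q (sg2 + `|Csq| * w) g (`|K0| + 1)) => //.
- move=> b a b0.
  have hh y : 0 <= heat b (y - a) by rewrite ltW // heat_gt0.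
  have hB y : `|heat b (y - a)| <= heat b 0 by rewrite ger0_norm // heat_le.
  have mh := measurable_heat b a.
  have [C hC] := heat_close a b0.
  have hL : 0 <= heat (b + sg2) (0 - a) by rewrite ltW // heat_gt0.
  have hc := mean_close mh hh hL hC.
  have [r er] := choice (fun n => let: ex_intro2 a b c := hc n in ex_intro _ a (conj b c)).
  have -> : \int[Q]_y heat b (y - a) = heat (b + sg2) (0 - a).
    apply: EFin_inj; rewrite -(integral_EFin_Rintegral Q mh hB) -(hQ _ mh).
    by rewrite integral_centred_normal_heat // sqr_sqrtr.
  have rE n : \int[P n]_y heat b (y - a) = r n.
    apply: EFin_inj; rewrite -(integral_EFin_Rintegral (P n) mh hB) PE //.
    exact: (er n).1.
  under eq_fun do rewrite rE.
  by apply: mean_cvg => n; exact: (er n).2.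
- move=> n; rewrite PE //; have [r -> hr] := sqc n; rewrite lee_fin.
  move: hr; rewrite ler_norml => /andP[_ hr].
  have : `|Csq| * w / Num.sqrt n.+1%:R <= `|Csq| * w.
    rewrite ler_pdivrMr ?sqrtr_gt0 // ler_peMr //.
    by rewrite -[leLHS]sqrtr1 ler_sqrt // ler1n.
  lra.
Unshelve. all: by end_near. Qed.

End chain_clt.

Theorem theorem4 (R : realType) (N : nat) (f : 'I_N -> R -> R) (p : 'I_N -> R)
    (mu : probability R R) (phi : R -> R)
    (hIFS : admissible_IFS f p)
    (hmu : prob_on_open01 mu)
    (hinv : invariant_measure f p mu)
    (hphi : [lipschitz phi x | x in (I01 : set R)])
    (hmean : (\int[mu]_(x in I01) (phi x)%:E = 0)%E) :
  exists2 sigma : R, 0 <= sigma &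
    (forall (d : measure_display) (T : measurableType d)
        (Pr : probability T R) (X : nat -> {RV Pr >-> R}),
      markov_chain f p mu X ->
      satisfies_CLT phi sigma Pr (fun n => (X n : T -> R))) /\
    (forall x : R, 0 < x < 1 ->
      forall (d : measure_display) (T : measurableType d)
        (Pr : probability T R) (X : nat -> {RV Pr >-> R}),
      markov_chain f p (\d_x) X ->
      satisfies_CLT phi sigma Pr (fun n => (X n : T -> R))).
Proof.
have [L L0 phiL] := lipschitz_constant hphi.
have hp := admissible_weights hIFS; have F01 := clipped_in01 hIFS.
have Fincr := clipped_incr hIFS; have spl := clipped_splitting hIFS.
have [al [be lW]] := admissible_lyapunov hIFS.
have mW := measurable_endpoint_weight al be; set W := endpoint_weight al be in lW mW.
have mPhi := lipschitz_measurable_clip L0 phiL.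
have mean0 : (\int[mu]_(x in I01) ((phi \o clip) x)%:E = 0)%E.
  by rewrite -hmean; apply: eq_integral => x; rewrite inE => /clip_id /= ->.
(* Here the equation only supplies the limit of U^n phi, which invariance then shows to be 0. *)
have [c [_ [_ _ hc]]] := poisson_equation hp F01 Fincr spl lW
  (lipschitz_bvar L0 phiL (let: And3 h _ _ := lW in h)).
have c0 : c = 0.
  exact: (limit_mean hIFS hmu hinv mPhi (lipschitz_clip_bound L0 phiL) mean0 hc).
rewrite {c}c0 in hc.
(* The variance is produced before any chain is introduced, hence is common to all initial laws. *)
have [sg2 sg20 [hheat hsq]] := clt_finite hp F01 Fincr spl lW
  (lipschitz_bvar L0 phiL (fun _ _ => lexx 1)) hc.
exists (Num.sqrt sg2); first exact: sqrtr_ge0.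
have mD : measurable (~` [set x : R | in01 x]) by apply: measurableC; exact: measurable_in01.
split.
  move=> d T Pr X hX; have [_ hX0 _] := hX.
  have [w hw] := invariant_lyapunov_integrable hIFS hmu hinv mW lW.
  apply: (chain_satisfies_CLT hIFS mPhi mW sg20 hheat hsq hX _ (w := w)).
    by rewrite hX0 //; exact: prob_in01C.
  by rewrite -hw; apply: eq_measure_integral => A mA _; exact: hX0.
move=> x hx d T Pr X hX; have [_ hX0 _] := hX.
apply: (chain_satisfies_CLT hIFS mPhi mW sg20 hheat hsq hX _ (w := `|W x|)).
  by rewrite hX0 // /dirac indicE memNset //; exact.
have mnW : measurable_fun setT (fun y => `|W y|%:E).
  by apply/measurable_EFinP; exact: measurableT_comp.
rewrite (eq_measure_integral (\d_x)); last by move=> A mA _; exact: hX0.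
by rewrite integral_dirac // diracT mul1e.
Qed.
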